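(* Let $f\colon\mathbb{N}\to\mathbb{R}$ be a strongly additive function with $|f(p)|\le M$ for all primes $p$, where $M>0$ is constant, and let $g\in\mathbb{Q}[x]$ be a nonconstant irreducible polynomial such that $g(0)\ne0$ and $g(\mathbb{N})\subseteq\mathbb{N}$. Let $\alpha\in\mathcal{M}^{\ast}$ with parameters $A_0,\beta,\sigma_0,\vartheta_0,\varrho_0,r$, and fix $0<h_0<(3/2)^{2/3}$ and $h_0'>0$. For any $q\in\mathbb{N}$ and $a\in\mathbb{Z}$ coprime to $q$, define $$\Delta_{\alpha}(x;q,a)=\sum_{\substack{n\le x\\ n\equiv a\,(\mathrm{mod}\,q)}}\alpha(n)-\frac{1}{\varphi(q)}\sum_{\substack{n\le x\\ \gcd(n,q)=1}}\alpha(n).$$ Suppose that there exist a constant $\epsilon_0>0$ and a function $\delta(x)\in(0,1]$ with $\delta(x)^2B_{f,g}(x)\to\infty$ as $x\to\infty$, such that $$\sum_{\substack{q:\ \omega(q)\le m\\ P^+(q)\le x^{\delta(x)/m}}}\mu(q)^2\sum_{a\in\mathcal{Z}^{\ast}_g(q)}|\Delta_{\alpha}(x;q,a)|\ll S(x)\exp\left(-(\log\log x)^{1/3+\epsilon_0}\right)$$ uniformly for all sufficiently large $x$ and all integers $m$ with $$1\le m\le\min\left(h_0(B_{f,g}(x)/M^2)^{1/3},\ h_0'(\delta(x)^2B_{f,g}(x)/M^2)^{1/3}\right),$$ where $\mathcal{Z}^{\ast}_g(q)=\{n\in(\mathbb{Z}/q\mathbb{Z})^{\times}\colon g(n)\equiv0\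 (\mathrm{mod}\ q)\}$ is the zero locus of $g$ in $(\mathbb{Z}/q\mathbb{Z})^{\times}$. Then $$S(x)^{-1}\sum_{n\le x}\alpha(n)\left(f(g(n))-A_{f,g}(x)\right)^m=C_mB_{f,g}(x)^{\frac{m}{2}}\left(\chi_m+O\left(\frac{Mm^{\frac{3}{2}}}{\delta(x)\sqrt{B_{f,g}(x)}}\right)\right)$$ uniformly for all sufficiently large $x$ and all $m\in\mathbb{N}$ in the same range $1\le m\le\min\left(h_0(B_{f,g}(x)/M^2)^{1/3},\,h_0'(\delta(x)^2B_{f,g}(x)/M^2)^{1/3}\right)$, where the implicit constant in the error term depends at most on the explicit and implicit constants in the hypotheses except for $M$.
   Context: $\mathbb{N}$ is the set of positive integers; $p$ always denotes a prime and $p^\nu$ ($\nu\ge1$) a prime power. A function $f\colon\mathbb{N}\to\mathbb{R}$ is additive if $f(mn)=f(m)+f(n)$ whenever $\gcd(m,n)=1$, and strongly additive if moreover $f(p^\nu)=f(p)$ for all prime powers $p^\nu$. $\omega(q)$ is the number of distinct prime divisors of $q$, $P^+(q)$ is the greatest prime factor of $q$ (with $P^+(1)=1$), $\mu$ is the Möbius function and $\varphi$ is Euler's totient function. The class $\mathcal{M}^{\ast}$ consists of the multiplicative functions $\alpha\colon\mathbb{N}\to\mathbb{R}_{\ge0}$ for which there exist constants (called the parameters of $\alpha$) $A_0,\beta,\sigma_0>0$, $\vartheta_0\ge0$, $\varrho_0\in[0,1)$ and $r\in(0,1)$ such that: (i) $\alpha(p^{\nu})\ll p^{(\varrho_0+\sigma_0-1)\nu}$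 for all prime powers $p^\nu$; (ii) $\sum_{p\le x}\frac{\alpha(p)\log p}{p^{\sigma_0-1}}=\beta x+O\left(\frac{x}{(\log x)^{A_0}}\right)$; (iii) $\sum_{p}'\left(\frac{\alpha(p)^2}{p^{2(r+\sigma_0-1)}}+\sum_{\nu\ge2}\frac{\alpha(p^{\nu})}{p^{(r+\sigma_0-1)\nu}}\right)<\infty$, where $\sum_p'$ runs over all but finitely many primes; (iv) $\sum_{\nu\ge1}\frac{\nu\alpha(p^{\nu})}{p^{\sigma_0\nu}}\ll\frac{(\log\log(p+1))^{\vartheta_0}}{p}$ for all primes $p$. For $g\in\mathbb{Q}[x]$ nonconstant irreducible, let $c_g\in\mathbb{N}$ be the least positive integer with $c_gg(x)\in\mathbb{Z}[x]$. Define $\rho_g(1)=1$, $\rho_g(n)=0$ if $\gcd(n,c_g)>1$, and $\rho_g(n)$ = the number of zeros of $g$ (equivalently, of $c_gg$) in $\mathbb{Z}/n\mathbb{Z}$ if $\gcd(n,c_g)=1$. In line with this, $\mathcal{Z}^{\ast}_g(q)$ is taken to be empty when $\gcd(q,c_g)>1$. Put $S(x)=\sum_{n\le x}\alpha(n)$, $$A_{f,g}(x)=\sum_{p\le x}\rho_g(p)\frac{f(p)}{p},\qquad B_{f,g}(x)=\sum_{p\le x}\rho_g(p)\frac{f(p)^2}{p},$$ $$\chi_m=\frac{1+(-1)^m}{2},\qquad C_m=\frac{m!}{2^{m/2}\,\Gamma(m/2+1)}\qquad(m\in\mathbb{N}).$$ *)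

(* Defs.v *)
From HB Require Import structures.
From mathcomp Require Import all_boot all_order all_algebra.
From mathcomp Require Import all_classical all_reals all_analysis.

Set Implicit Arguments.
Unset Strict Implicit.
Unset Printing Implicit Defensive.

Import Order.TTheory GRing.Theory Num.Theory.
Import numFieldNormedType.Exports.

Local Open Scope classical_set_scope.
Local Open Scope ring_scope.

(* Arithmetic functions are total functions on [nat]; their values at [0%N]
   are irrelevant, and the conditions below only concern positive integers. *)

Definition nb_primes (n : nat) : nat := size (primes n).

Definition moebius (n : nat) : int :=
  if all (fun p => logn p n == 1%N) (primes n) then (-1) ^+ nb_primes n else 0.

Section ArithmeticFunctions.
Variable R : realType.
Implicit Types f alpha : nat -> R.

Definition strongly_additive f : Prop :=
  (forall m n, (0 < m)%N -> (0 < n)%N -> coprime m n -> f (m * n)%N = f m + f n)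
  /\ (forall p k, prime p -> (0 < k)%N -> f (p ^ k)%N = f p).

Definition multiplicative alpha : Prop :=
  alpha 1%N = 1 /\
  (forall m n, (0 < m)%N -> (0 < n)%N -> coprime m n ->
     alpha (m * n)%N = alpha m * alpha n).

(* [alpha] belongs to the class M^* with parameters
   [A0 beta sigma0 theta0 rho0 r]; [L] bounds all the implicit constants, as
   well as the value of the convergent sum in [Mstar_sum], where [E] is the
   finite set of omitted primes.  The series have nonnegative terms and are
   taken in [\bar R]. *)
Record in_Mstar alpha (A0 beta sigma0 theta0 rho0 r L : R) : Prop := InMstar {
  Mstar_A0_gt0 : 0 < A0;
  Mstar_beta_gt0 : 0 < beta;
  Mstar_sigma0_gt0 : 0 < sigma0;
  Mstar_theta0_ge0 : 0 <= theta0;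
  Mstar_rho0 : 0 <= rho0 < 1;
  Mstar_r : 0 < r < 1;
  Mstar_ge0 : forall n, (0 < n)%N -> 0 <= alpha n;
  Mstar_mul : multiplicative alpha;
  Mstar_prime_powers : forall p k, prime p -> (0 < k)%N ->
    alpha (p ^ k)%N <= L * p%:R `^ ((rho0 + sigma0 - 1) * k%:R);
  Mstar_primes : forall x : R, 2 <= x ->
    `| \sum_(0 <= p < (Num.truncn x).+1 | prime p)
          alpha p * ln p%:R / p%:R `^ (sigma0 - 1) - beta * x |
      <= L * (x / (ln x) `^ A0);
  Mstar_sum : exists E : seq nat,
    (\sum_(0 <= p <oo | prime p && (p \notin E))
       ((alpha p ^+ 2 / p%:R `^ (2 * (r + sigma0 - 1)))%:E
        + \sum_(2 <= k <oo)
            (alpha (p ^ k)%N / p%:R `^ ((r + sigma0 - 1) * k%:R))%:E)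
     <= L%:E)%E;
  Mstar_local : forall p, prime p ->
    (\sum_(1 <= k <oo) (k%:R * alpha (p ^ k)%N / p%:R `^ (sigma0 * k%:R))%:E
     <= (L * ((ln (ln p.+1%:R)) `^ theta0 / p%:R))%:E)%E
}.

Definition summatory alpha (x : R) : R :=
  \sum_(1 <= n < (Num.truncn x).+1) alpha n.

Definition discrepancy alpha (x : R) (q : nat) (a : int) : R :=
  \sum_(1 <= n < (Num.truncn x).+1 | (n%:Z == a %[mod q%:Z])%Z) alpha n
  - (totient q)%:R^-1
    * \sum_(1 <= n < (Num.truncn x).+1 | coprime n q) alpha n.

End ArithmeticFunctions.

Section RationalPolynomials.
Implicit Type g : {poly rat}.

Lemma ex_cden g :
  exists c : nat, (0 < c)%N && (c%:R *: g \is a polyOver Num.int).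
Proof.
exists (\prod_(i < size g) `|denq g`_i|)%N; apply/andP; split.
  by apply: prodn_gt0 => i; rewrite absz_gt0 denq_neq0.
apply/polyOverP => i; rewrite coefZ.
have [ltig | /(nth_default 0) ->] := ltnP i (size g); last by rewrite mulr0 rpred0.
rewrite (bigD1 (Ordinal ltig)) //= natrM mulrAC rpredM ?rpred_nat //.
have -> : (`|denq g`_i|)%:R = (denq g`_i)%:~R :> rat.
  by rewrite -[in RHS](gez0_abs (denq_ge0 _)).
by rewrite mulrC -[X in X * _]divq_num_den divfK ?intr_eq0 ?denq_neq0 // intr_int.
Qed.

Definition cden g : nat := ex_minn (ex_cden g).

(* [numq] is the identity on integers, so this is [(cden g)%:R *: g] seen as an
   integer polynomial; see [map_cleared]. *)
Definition cleared g : {poly int} := map_poly numq ((cden g)%:R *: g).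

Lemma map_cleared g : map_poly intr (cleared g) = (cden g)%:R *: g.
Proof.
apply/polyP => i; rewrite coef_map /= coef_map_id0 //.
have : (cden g)%:R *: g \is a polyOver Num.int.
  by rewrite /cden; case: ex_minnP => c /andP[].
by move=> /polyOverP /(_ i) /intrP[z ->]; rewrite numq_int.
Qed.

Definition rho g (n : nat) : nat :=
  if coprime n (cden g)
  then #|[set i : 'I_n | (n%:Z %| (cleared g).[(i : nat)%:Z])%Z]%SET| else 0%N.

Lemma rho1 g : rho g 1 = 1%N.
Proof.
rewrite /rho coprime1n -[RHS](card_ord 1).
by apply: eq_card => i; rewrite inE dvd1z.
Qed.

(* Classes of Z/qZ are represented by their least nonnegative residues. *)
Definition Zstar g (q : nat) : {set 'I_q} :=
  [set a : 'I_q | [&& coprime q (cden g), coprime a q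
                    & (q%:Z %| (cleared g).[(a : nat)%:Z])%Z]]%SET.

Definition maps_pos_to_pos g : Prop :=
  forall n : nat, (0 < n)%N -> exists2 k : nat, (0 < k)%N & g.[n%:R] = k%:R.

(* g(n) as a natural number; meaningful under [maps_pos_to_pos] *)
Definition natval g (n : nat) : nat := Num.truncn g.[n%:R].

End RationalPolynomials.

Section Moments.
Variable R : realType.
Implicit Types (f alpha : nat -> R) (g : {poly rat}).

Definition Amean f g (x : R) : R :=
  \sum_(0 <= p < (Num.truncn x).+1 | prime p) (rho g p)%:R * (f p / p%:R).

Definition Bvar f g (x : R) : R :=
  \sum_(0 <= p < (Num.truncn x).+1 | prime p) (rho g p)%:R * (f p ^+ 2 / p%:R).

Definition moment_range (h0 h0' M B d : R) (m : nat) : Prop :=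
  (1 <= m)%N /\
  m%:R <= Num.min (h0 * (B / M ^+ 2) `^ 3^-1)
                  (h0' * (d ^+ 2 * B / M ^+ 2) `^ 3^-1).

(* The moduli form an infinite set, but only the finitely many squarefree
   ones contribute, so the finitely supported sum is the full sum
   (see [finite_level_support]). *)
Definition level_sum alpha g (x d : R) (m : nat) : R :=
  \sum_(q \in [set q : nat | [/\ (0 < q)%N, (nb_primes q <= m)%N
                              & (max_pdiv q)%:R <= x `^ (d / m%:R)]])
    ((moebius q)%:~R ^+ 2
     * \sum_(a in Zstar g q) `|discrepancy alpha x q (a : nat)%:Z|).

Lemma finite_level_support (y : R) :
  finite_set [set q : nat | (0 < q)%N /\ (max_pdiv q)%:R <= y
                            /\ moebius q != 0].
Proof.
apply: (@sub_finite_set _ _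
  `I_(\prod_(p < (Num.truncn y).+1) p.+1).+1); last exact: finite_II.
move=> q /= [q0 [qy]].
rewrite /moebius; case: ifP => [/allP sf _|_]; last by rewrite eqxx.
rewrite ltnS.
rewrite {1}(prod_prime_decomp q0) prime_decompE big_map /=.
have sub : {subset primes q <= iota 0 (Num.truncn y).+1}.
  move=> p pq; rewrite mem_iota /= add0n ltnS.
  have py : p%:R <= y.
    apply: le_trans qy; rewrite ler_nat; apply: max_pdiv_max.
    by move: pq; rewrite mem_primes => /and3P[-> -> ->] //; rewrite mem_primes.
  by rewrite truncn_ge_nat // (le_trans _ py).
rewrite (eq_big_seq (fun p : nat => p)); last first.
  by move=> p /sf /eqP ->; rewrite expn1.
rewrite -(big_mkord xpredT succn) /index_iota subn0.
apply: (@leq_trans (\prod_(p <- primes q) p.+1)).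
  by apply: leq_prod => p _.
rewrite [leqRHS](bigID (mem (primes q))) /= -[leqLHS]muln1 leq_mul //; last first.
  exact: prodn_gt0.
rewrite -[leqRHS]big_filter; apply/eq_leq/perm_big.
apply: uniq_perm; first exact: primes_uniq.
  exact/filter_uniq/(iota_uniq 0 (Num.truncn y).+1).
by move=> p; rewrite mem_filter; case: (boolP (p \in primes q)) => //= /sub ->.
Qed.

Definition Gamma (s : R) : R :=
  (\int[lebesgue_measure]_(t in `]0, +oo[) (t `^ (s - 1) * expR (- t)))%R.

Definition chi (m : nat) : R := (1 + (-1) ^+ m) / 2.

Definition Cmoment (m : nat) : R :=
  m`!%:R / (2 `^ (m%:R / 2) * Gamma (m%:R / 2 + 1)).

End Moments.

Arguments chi {R} m.
Arguments Cmoment {R} m.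

(* Main.v *)
Require Import Defs.
From HB Require Import structures.
From mathcomp Require Import all_boot all_order all_algebra.
From mathcomp Require Import all_classical all_reals all_analysis measurable_realfun.
From mathcomp Require Import ring lra zify.

Set Implicit Arguments.
Unset Strict Implicit.
Unset Printing Implicit Defensive.

Import Order.TTheory GRing.Theory Num.Theory.
Import numFieldNormedType.Exports.

Local Open Scope classical_set_scope.
Local Open Scope ring_scope.

(** The proof is the moment method for a sieve, in the style of Granville and
    Soundararajan.  Draw [n <= x] with probability [alpha n / S x], put
    [z = x ^ (delta / m)], and call sieving primes the primes [p <= z] above a
    bound depending on [g], [L] and [rho0] alone.  With [h p] the density with
    which [p] divides [g n], the deviation [f (g n) - A] is the sum [S_n] of
    [((p divides g n) - h p) * f p] over the sieving primes, plus a remainder.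
    The remainder is [O (M m / delta)]: a value [g n] has [O (m / delta)] prime
    factors above [z], and by Mertens the sum of [1 / p] over [z < p <= x] is
    [O (m / delta)] too ([remainder_le]).

    A power [S_n ^ j] with [j <= m] only sees the probabilities that [g n] be
    divisible by products [q] of at most [m] sieving primes
    ([signed_moment_le]).  Splitting into the classes of [Zstar g q], such a
    probability is a sum of discrepancies, controlled by the level of
    distribution, plus a local factor times the proportion of the weight
    carried by the integers prime to [q] ([law_gap_incl_le]).  That proportion
    is a product over the primes of [q] because [S] varies regularly,
    [S y ~ (y / x) ^ sigma * S x] with a saving of a power of [ln x]
    ([summatory_regular]); this follows from the prime sums of [alpha] through
    the identity [S x ln x ~ sum of alpha m * theta (x / m)].  Hence the moments
    of [S_n] agree with those of a sum of independent centred Bernoulli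
    variables of parameters [h p], up to [(C ln ln x) ^ (2 m)] times
    [exp (- (ln ln x) ^ (1/3 + eps0))] or a negative power of [ln x].  As
    [m = O ((ln ln x) ^ (1/3))], this is negligible ([small_gap_eventually]).

    For the independent model, the cumulants of order [k >= 2], divided by
    [(k - 1)!], are at most [V M ^ (k - 2)], [V] being the variance.  Moments divided by factorials obey
    the recursion [j a_j = sum of K_l a_(j - l)]; keeping [K_2] alone gives the
    Gaussian coefficients, and the higher cumulants change [a_m] by a relative
    [O (m ^ (3/2) M / sqrt V)] ([bernoulli_cumulants], [moment_asymp]).
    Adding the remainder costs a relative [sqrt m / sqrt V] times its size,
    i.e. [O (M m ^ (3/2) / (delta sqrt V))] ([shifted_moment]), and so does the
    replacement of [V] by [B], as [V - B = O (M ^ 2 m / delta)]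
    ([var_gap_le]).  The lemma [assembled_moment] adds these errors up. *)

(** * The gamma function and the Gaussian coefficients *)

Section GammaFunction.
Variable R : realType.
Implicit Types a s t : R.
Local Notation mu := (@lebesgue_measure R).
Local Notation half_line := (`]0, +oo[%classic : set R).

Definition gamma_integrand a t : R := t `^ a * expR (- t).

(** Crude domination, enough to integrate [t ^ a * exp (- t)] against
    [exp (- t / 2)]. *)
Lemma powR_le_exp a : 0 <= a -> exists2 C : R, 0 <= C &
  forall t, 0 <= t -> t `^ a <= C * expR (t / 2).
Proof.
move=> a0; pose n := Num.truncn a; pose C := 2 ^+ n.+1 * n.+1`!%:R : R.
have C0 : 0 <= C by rewrite mulr_ge0 ?exprn_ge0.
exists (1 + C) => [|t t0]; first exact: addr_ge0.
have an : a <= n.+1%:R by exact/ltW/truncnS_gt.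
have e1 : 1 <= expR (t / 2) by apply: le_trans (expR_ge1Dx _); rewrite lerDl divr_ge0.
have [t1|t1] := leP t 1.
  apply: (@le_trans _ _ 1); last by rewrite mulrDl mul1r; nra.
  by apply: le_trans (ge0_ler_powR a0 _ _ t1) _; rewrite ?nnegrE // powR1.
apply: le_trans (ler_powR (ltW t1) an) _; rewrite powR_mulrn //.
have := @expR_ge1Dxn R (t / 2) n (divr_ge0 t0 (ler0n _ _)).
set e := expR _ in e1 *; rewrite exprMn exprVn => h.
have f0 : 0 < n.+1`!%:R :> R by rewrite ltr0n fact_gt0.
have p0 : 0 < 2 ^+ n.+1 :> R by rewrite exprn_gt0.
have : t ^+ n.+1 <= C * e.
  rewrite mulrC -ler_pdivrMr ?mulr_gt0 // /C invfM mulrA.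
  by apply: le_trans h; rewrite lerDr.
nra.
Qed.

Lemma gamma_integrand_le a : 0 <= a -> exists2 C : R, 0 <= C &
  forall t, 0 <= t -> gamma_integrand a t <= C * expR (- (t / 2)).
Proof.
move=> a0; have [C C0 HC] := powR_le_exp a0; exists C => // t t0.
apply: le_trans (ler_wpM2r (expR_ge0 _) (HC t t0)) _.
by rewrite -mulrA -expRD (_ : t / 2 - t = - (t / 2)) //; field.
Qed.

Lemma cvg_expN_half : expR (- (t / 2)) @[t --> +oo] --> (0 : R).
Proof.
apply: (@cvg_comp _ _ _ (fun t : R => t / 2) (fun t : R => expR (- t)) _ (pinfty_nbhs R)).
  exact: gt0_cvgMly.
exact: cvgr_expR.
Qed.

Lemma continuous_expN_half : continuous (fun t : R => expR (- (t / 2))).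
Proof.
move=> t; apply: (@continuous_comp _ _ _ (fun t : R => - (t / 2)) expR).
  by apply: continuousN; apply: mulrr_continuous.
exact: continuous_expR.
Qed.

Lemma integral_expN_half :
  (\int[mu]_(t in half_line) (expR (- (t / 2)))%:E = 2%:E)%E.
Proof.
rewrite integral_itv_obnd_cbnd; last first.
  apply/measurable_EFinP; apply: measurable_funTS; apply: continuous_measurable_fun.
  exact: continuous_expN_half.
rewrite (@ge0_continuous_FTC2y _ _ (fun t : R => - 2 * expR (- (t / 2))) _ 0).
- by rewrite mul0r oppr0 expR0 mulr1 -EFinB sub0r opprK.
- by move=> t _; exact: expR_ge0.
- by apply: continuous_subspaceT; exact: continuous_expN_half.
- by rewrite -[X in _ --> X](mulr0 (- 2 : R)); apply: (cvgM (cvg_cst _)); exact: cvg_expN_half.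
- by move=> t _; apply: ex_derive.
- by apply: cvg_at_right_filter; apply: (cvgM (cvg_cst _)); exact: continuous_expN_half.
- move=> t _; by rewrite derive1E derive_val /= /GRing.scale /=; field.
Qed.

Lemma integrable_expN_half :
  mu.-integrable half_line (EFin \o (fun t => expR (- (t / 2)))).
Proof.
apply/integrableP; split.
  apply/measurable_EFinP; apply: measurable_funTS; apply: continuous_measurable_fun.
  exact: continuous_expN_half.
have <- : (\int[mu]_(t in half_line) (expR (- (t / 2)))%:E =
    \int[mu]_(t in half_line) `|(EFin \o (fun t => expR (- (t / 2)))) t|)%E.
  by apply: eq_integral => t _ /=; rewrite ger0_norm // expR_ge0.
by rewrite integral_expN_half ltry.
Qed.

Lemma integrableEZ c (f : R -> R) : mu.-integrable half_line (EFin \o f) ->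
  mu.-integrable half_line (EFin \o (fun t => c * f t)).
Proof. by move=> fi; exact: (@integrableZl _ _ _ mu _ _ c _ fi). Qed.

Lemma measurable_gamma_integrand a : measurable_fun half_line (gamma_integrand a).
Proof.
apply: measurable_funTS; apply: measurable_funM; first exact: measurable_powR.
by apply: measurableT_comp; [exact: measurable_expR | exact: measurable_funN].
Qed.

Lemma integrable_gamma a : 0 <= a ->
  mu.-integrable half_line (EFin \o gamma_integrand a).
Proof.
move=> a0; have [C C0 HC] := gamma_integrand_le a0.
apply: (@le_integrable _ _ _ mu _ _ _ (EFin \o (fun t => C * expR (- (t / 2))))) => //.
- by apply/measurable_EFinP; exact: measurable_gamma_integrand.
- move=> t; rewrite /= in_itv /= andbT => t0.
  rewrite !ger0_norm ?mulr_ge0 ?expR_ge0 ?powR_ge0 // lee_fin.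
  exact: HC (ltW t0).
exact: integrableEZ integrable_expN_half.
Qed.

Lemma is_derive_gamma a t : 0 < t -> is_derive t 1 (gamma_integrand a)
  (a * gamma_integrand (a - 1) t - gamma_integrand a t).
Proof.
move=> t0; have := is_derive1_powR a t0 => dp.
rewrite /gamma_integrand.
have de : is_derive t 1 (fun t : R => expR (- t)) (- expR (- t)).
  by apply: is_derive_eq; rewrite /GRing.scale /= mulrN mulr1.
apply: is_derive_eq; rewrite /GRing.scale /=; ring.
Qed.

Lemma continuous_powR_ge0 a : 0 <= a -> {within `[0, +oo[, continuous (fun t : R => t `^ a)}.
Proof.
move=> a0; apply/continuous_within_itvcyP; split.
  move=> t; rewrite in_itv /= andbT => t0.
  apply: differentiable_continuous; apply/derivable1_diffP.
  by apply: derivable_powR; rewrite in_itv /= t0.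
have [->|an0] := eqVneq a 0.
  rewrite powRr0; under eq_fun do rewrite powRr0; exact: cvg_cst.
by rewrite powR0 //; apply: powR_cvg0; rewrite lt_def an0.
Qed.

Lemma cvg_gamma_integrand a : 0 <= a -> gamma_integrand a t @[t --> +oo] --> (0 : R).
Proof.
move=> a0; have [C C0 HC] := gamma_integrand_le a0.
apply: (@squeeze_cvgr _ _ _ _ (cst 0) (fun t => C * expR (- (t / 2)))).
- near=> t; rewrite mulr_ge0 ?expR_ge0 ?powR_ge0 //= HC //.
- exact: cvg_cst.
- by rewrite -[X in _ --> X](mulr0 C); apply: (cvgM (cvg_cst _)); exact: cvg_expN_half.
Unshelve. all: by end_near. Qed.

Lemma continuous_gamma_integrand a : 0 <= a ->
  {within `[0, +oo[, continuous (gamma_integrand a)}.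
Proof.
move=> a0 t; apply: cvgM; first exact: continuous_powR_ge0.
apply: continuous_subspaceT => u.
apply: (@continuous_comp _ _ _ (fun t : R => - t) expR); first exact: continuousN.
exact: continuous_expR.
Qed.

(** Integration by parts for [Gamma], run through the fundamental theorem of
    calculus for nonnegative integrands: adding a multiple of [exp (- t / 2)] to
    the derivative of [t ^ s * exp (- t)] makes it nonnegative. *)
Lemma Gamma_rec s : 1 <= s -> Gamma (s + 1) = s * Gamma s.
Proof.
move=> s1; have s0 : 0 <= s by apply: le_trans s1.
have s10 : 0 <= s - 1 by rewrite subr_ge0.
have [C C0 HC] := gamma_integrand_le s0.
pose E t := C * expR (- (t / 2)).
pose F t := - (2 * E t) + gamma_integrand s t.
pose f t := E t + s * gamma_integrand (s - 1) t - gamma_integrand s t.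
have intE : mu.-integrable half_line (EFin \o E).
  exact: integrableEZ integrable_expN_half.
have ints := integrable_gamma s0.
have ints1 := integrable_gamma s10.
have intss1 : mu.-integrable half_line (EFin \o (fun t => s * gamma_integrand (s - 1) t)).
  exact: integrableEZ.
have intsum : mu.-integrable half_line (EFin \o (fun t => E t + s * gamma_integrand (s - 1) t)).
  exact: (@integrableD _ _ _ mu _ _ _ _ intE intss1).
have intf : mu.-integrable half_line (EFin \o f).
  exact: (@integrableB _ _ _ mu _ _ _ _ intsum ints).
have Ef : \int[mu]_(t in half_line) E t = 2 * C.
  rewrite RintegralZl //; last exact: integrable_expN_half.
  by rewrite /Rintegral integral_expN_half mulrC.
have cE : continuous E.
  by move=> t; apply: (cvgM (cvg_cst _)); exact: continuous_expN_half.
have : \int[mu]_(t in half_line) f t = 0 - F 0.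
  rewrite Rintegral_itv_obnd_cbnd //; apply: Rintegral_ge0_continuous_FTC2y.
  - move=> t t0; rewrite /f addrAC addr_ge0 ?mulr_ge0 ?expR_ge0 ?powR_ge0 //.
    by rewrite subr_ge0 HC.
  - move=> t; apply: cvgB; last exact: continuous_gamma_integrand.
    apply: cvgD; first by apply: continuous_subspaceT.
    by apply: (cvgM (cvg_cst _)); exact: continuous_gamma_integrand.
  - rewrite -[X in _ --> X]addr0; apply: cvgD; last exact: cvg_gamma_integrand.
    rewrite -oppr0; apply: cvgN; rewrite -[X in _ --> X](mulr0 2); apply: (cvgM (cvg_cst _)).
    rewrite -[X in _ --> X](mulr0 C); apply: (cvgM (cvg_cst _)); exact: cvg_expN_half.
  - by move=> t t0; have := is_derive_gamma s t0 => ?; apply: ex_derive.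
  - have := @continuous_gamma_integrand s s0 => /continuous_within_itvcyP[_ cg].
    apply: cvgD => //; apply: cvg_at_right_filter; apply: cvgN; apply: (cvgM (cvg_cst _)); exact: cE.
  - move=> t; rewrite in_itv /= andbT => t0; have := is_derive_gamma s t0 => ?.
    by rewrite derive1E derive_val /f /E /GRing.scale /=; field.
have e1 : Gamma (s + 1) = \int[mu]_(t in half_line) gamma_integrand s t.
  by rewrite /Gamma addrK.
have e2 : \int[mu]_(t in half_line) gamma_integrand (s - 1) t = Gamma s by [].
rewrite RintegralB; [|exact: measurable_itv|exact: intsum|exact: ints].
rewrite RintegralD; [|exact: measurable_itv|exact: intE|exact: intss1].
rewrite RintegralZl; [|exact: measurable_itv|exact: ints1].
rewrite Ef -e1 e2.
have -> : F 0 = - (2 * C).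
  rewrite /F /E /gamma_integrand mul0r oppr0 expR0 powR0; first by rewrite mulr1 mul0r addr0.
  by rewrite gt_eqF // (lt_le_trans ltr01).
clear e1 e2 Ef; move: (Gamma s) (Gamma (s + 1)) => g g' e; lra.
Qed.

Lemma Gamma1 : Gamma (1 : R) = 1.
Proof.
rewrite /Gamma; pose F (t : R) := - expR (- t).
have dF (t : R) : is_derive t 1 F (expR (- t)).
  by apply: is_derive_eq; rewrite /GRing.scale /= mulrN mulr1 opprK.
have cE : continuous (fun t : R => expR (- t)).
  move=> t; apply: (@continuous_comp _ _ _ (fun t : R => - t) expR).
    exact: continuousN.
  exact: continuous_expR.
transitivity (\int[mu]_(t in half_line) expR (- t)).
  by apply: eq_Rintegral => t _; rewrite subrr powRr0 mul1r.
rewrite Rintegral_itv_obnd_cbnd; last first.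
  apply: (@eq_integrable _ _ _ mu _ _ (EFin \o gamma_integrand 0)) => //.
    by move=> t _; rewrite /= /gamma_integrand powRr0 mul1r.
  exact: integrable_gamma.
rewrite (@Rintegral_ge0_continuous_FTC2y _ _ F _ 0).
- by rewrite /F oppr0 expR0 sub0r opprK.
- by move=> t _; exact: expR_ge0.
- exact: continuous_subspaceT.
- by rewrite -oppr0; apply: cvgN; exact: cvgr_expR.
- by move=> t _; apply: ex_derive.
- by apply: cvg_at_right_filter; apply: cvgN; exact: cE.
- by move=> t _; rewrite derive1E derive_val.
Qed.

(** Since [(3 t - t ^ 2) / 2 <= sqrt t], the integral is at least
    [(3 * Gamma 2 - Gamma 3) / 2 = 1 / 2]. *)
Lemma Gamma_three_halves : 0 < Gamma (3 / 2 : R).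
Proof.
have G2 : Gamma (2 : R) = 1 by rewrite -[2]/(1 + 1) Gamma_rec // Gamma1 mulr1.
have G3 : Gamma (3 : R) = 2.
  rewrite [X in Gamma X](_ : 3 = 2 + 1 :> R); last by lra.
  by rewrite Gamma_rec ?ler1n // G2 mulr1.
(* u ^ 3 - 3 u + 2 = (u - 1) ^ 2 (u + 2) at u = sqrt t *)
have key t : 0 < t -> 2^-1 * (3 * gamma_integrand 1 t - gamma_integrand 2 t) <=
    gamma_integrand (3 / 2 - 1) t.
  move=> t0; rewrite /gamma_integrand powRr1 ?(ltW t0) // powR_mulrn ?(ltW t0) //.
  have -> : 3 / 2 - 1 = 2^-1 :> R by lra.
  rewrite powR12_sqrt ?(ltW t0) //; set u := Num.sqrt t.
  have u0 : 0 <= u := sqrtr_ge0 _.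
  have -> : t = u ^+ 2 by rewrite sqr_sqrtr // ltW.
  rewrite -subr_ge0 [X in 0 <= X](_ : _ = 2^-1 * u * ((u - 1) ^+ 2 * (u + 2)) * expR (- u ^+ 2)); last by field.
  apply: mulr_ge0 (expR_ge0 _); apply: mulr_ge0; first exact: mulr_ge0.
  by apply: mulr_ge0 (sqr_ge0 _) _; exact: addr_ge0.
have i1 := @integrable_gamma 1 ler01.
have i2 : mu.-integrable half_line (EFin \o gamma_integrand 2) by exact: integrable_gamma.
have i3 : mu.-integrable half_line (EFin \o (fun t => 3 * gamma_integrand 1 t)).
  exact: integrableEZ.
have i4 : mu.-integrable half_line (EFin \o (fun t => 3 * gamma_integrand 1 t - gamma_integrand 2 t)).
  exact: (@integrableB _ _ _ mu _ _ _ _ i3 i2).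
have i5 : mu.-integrable half_line (EFin \o (fun t => 2^-1 * (3 * gamma_integrand 1 t - gamma_integrand 2 t))).
  exact: integrableEZ.
apply: (@lt_le_trans _ _ (\int[mu]_(t in half_line) (2^-1 * (3 * gamma_integrand 1 t - gamma_integrand 2 t)))).
  rewrite RintegralZl // RintegralB // RintegralZl //.
  have -> : \int[mu]_(t in half_line) gamma_integrand 1 t = 1.
    transitivity (Gamma (2 : R)); last exact: G2.
    rewrite /Gamma; apply: eq_Rintegral => t _.
    by have -> : 2 - 1 = 1 :> R by lra.
  have -> : \int[mu]_(t in half_line) gamma_integrand 2 t = 2.
    transitivity (Gamma (3 : R)); last exact: G3.
    rewrite /Gamma; apply: eq_Rintegral => t _.
    by have -> : 3 - 1 = 2 :> R by lra.
  lra.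
apply: le_Rintegral => //; first by apply: integrable_gamma; lra.
by move=> t; rewrite /= in_itv /= andbT; exact: key.
Qed.

(** [Cmoment m / m!], the coefficient of [t ^ m] in [exp (t ^ 2 / 2)] when [m]
    is even, extended to all [m] by the Gamma function. *)
Definition gauss_coef (j : nat) : R := (2 `^ (j%:R / 2) * Gamma (j%:R / 2 + 1))^-1.

Lemma gauss_coef0 : gauss_coef 0 = 1.
Proof. by rewrite /gauss_coef mul0r powRr0 add0r Gamma1 mulr1 invr1. Qed.

Lemma gauss_coef1 : 0 < gauss_coef 1.
Proof.
rewrite invr_gt0 mulr_gt0 ?powR_gt0 //.
have -> : 1%:R / 2 + 1 = 3 / 2 :> R by lra.
exact: Gamma_three_halves.
Qed.

Lemma gauss_coefS j : j.+2%:R * gauss_coef j.+2 = gauss_coef j.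
Proof.
have h : j.+2%:R / 2 = j%:R / 2 + 1 :> R by rewrite -addn2 natrD; field.
rewrite /gauss_coef h Gamma_rec ?lerDr ?divr_ge0 // powRD ?pnatr_eq0 ?implybT //.
rewrite powRr1 // -h !invfM invrK.
by move: (Gamma _)^-1 (powR _ _)^-1 => u v; field; rewrite -natrD pnatr_eq0.
Qed.

Lemma CmomentE m : Cmoment m = m`!%:R * gauss_coef m.
Proof. by []. Qed.

End GammaFunction.

(** * Cumulants of sums of independent centred Bernoulli variables *)

Section TruncatedSeries.
Variable R : realFieldType.
Implicit Types p q : {poly R}.

(** Generating functions are polynomials, compared up to degree [N]. *)
Definition agree N p q := forall k, (k <= N)%N -> p`_k = q`_k.

Lemma agree_mul N p p' q q' :
  agree N p p' -> agree N q q' -> agree N (p * q) (p' * q').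
Proof.
move=> pp qq k kN; rewrite !coefM; apply: eq_bigr => i _.
have ik : (i <= k)%N by rewrite -ltnS.
by rewrite pp ?(leq_trans ik) // qq // (leq_trans (leq_subr _ _)).
Qed.

Definition expT N (c : R) : {poly R} := \poly_(k < N.+1) (c ^+ k / k`!%:R).

Lemma factR_neq0 k : k`!%:R != 0 :> R.
Proof. by rewrite pnatr_eq0 -lt0n fact_gt0. Qed.

Lemma expT_add N c d : agree N (expT N c * expT N d) (expT N (c + d)).
Proof.
move=> k kN; rewrite coefM coef_poly ltnS kN exprDn big_distrl /=.
rewrite [RHS](reindex_inj rev_ord_inj) /=; apply: eq_bigr => i _.
have ik : (i <= k)%N by rewrite -ltnS.
rewrite subSS !coef_poly !ltnS (leq_trans ik kN) (leq_trans (leq_subr _ _) kN).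
rewrite subKn // bin_sub //.
have : ('C(k, i)%:R * (i`!%:R * (k - i)`!%:R) = k`!%:R :> R)
  by rewrite -!natrM bin_fact.
have := factR_neq0 i; have := factR_neq0 (k - i); have := factR_neq0 k.
set u := i`!%:R; set v := (k - i)`!%:R; set w := k`!%:R => w0 v0 u0 e.
rewrite -mulr_natr mulf_div -[RHS]mulrA; congr (_ * _).
apply: (mulfI (mulf_neq0 u0 v0)); rewrite divff ?mulf_neq0 // mulrA.
by rewrite [_ * 'C(k, i)%:R]mulrC e divff.
Qed.

Lemma expT0 N : agree N 1 (expT N 0).
Proof.
by move=> k kN; rewrite coef1 coef_poly ltnS kN expr0n; case: k kN => //= k;
  rewrite ?mul0r ?divr1.
Qed.

Lemma expT_prod N (I : finType) (X : I -> R) :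
  agree N (\prod_i expT N (X i)) (expT N (\sum_i X i)).
Proof.
elim/big_rec2 : _ => [|i p s _ IH]; first exact: expT0.
move=> k kN; rewrite -(@expT_add N _ _ k kN).
by apply: (@agree_mul N) => //.
Qed.

(** The logarithmic derivative of a generating function is a polynomial in
    disguise: [K] carries the cumulants, [K`_l = kappa_l / (l - 1)!]. *)
Definition cumulant_of N p K := agree N ('X * p^`()) (K * p).

Lemma cumulant_mul N p q K L :
  cumulant_of N p K -> cumulant_of N q L -> cumulant_of N (p * q) (K + L).
Proof.
move=> pK qL k kN.
have -> : 'X * (p * q)^`() = ('X * p^`()) * q + p * ('X * q^`()).
  by rewrite derivM; ring.
have -> : (K + L) * (p * q) = (K * p) * q + p * (L * q) by ring.
rewrite !coefD; congr (_ + _).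
  exact: (@agree_mul N _ _ q q pK).
exact: (@agree_mul N p p _ _ _ qL).
Qed.

Lemma cumulant_prod N (I : finType) (G K : I -> {poly R}) :
  (forall i, cumulant_of N (G i) (K i)) ->
  cumulant_of N (\prod_i G i) (\sum_i K i).
Proof.
move=> GK; elim/big_rec2 : _ => [|i p s _ IH].
  by move=> k kN; rewrite mul0r derivC mulr0.
exact: cumulant_mul.
Qed.

Lemma cumulant_rec N p K j : cumulant_of N p K -> (j <= N)%N ->
  j%:R * p`_j = \sum_(l < j.+1) K`_l * p`_(j - l).
Proof.
move=> pK jN; rewrite -coefM -(pK _ jN) coefXM.
by case: j jN => [|j] jN; rewrite ?mul0r //= coef_deriv mulr_natl.
Qed.

(** The full series is [e - 2 < 1]; the explicit gap is what an induction on
    [N] can carry. *)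
Lemma sum_inv_fact N : (2 <= N)%N ->
  \sum_(2 <= s < N.+1) (s`!%:R)^-1 <= 1 - (2 ^+ N.-1)^-1 :> R.
Proof.
elim: N => // -[//|[|N]] IH _; first by rewrite big_nat1 expr1 (_ : 2`! = 2)%N //; lra.
rewrite big_nat_recr //=.
have := IH isT; set a := \sum_(_ <= _ < _) _ => IHa.
have : (N.+3`!%:R)^-1 <= (2 ^+ N.+2)^-1 :> R.
  rewrite lef_pV2 ?posrE ?exprn_gt0 ?ltr0n ?fact_gt0 // -natrX ler_nat.
  elim: N {IH IHa a} => // N IH; rewrite factS expnS.
  by apply: leq_mul.
move: IHa => /=; have -> : (2 ^+ N.+2)^-1 = (2 ^+ N.+1)^-1 / 2 :> R.
  by rewrite [2 ^+ N.+2]exprSr invfM.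
lra.
Qed.

(** A centred variable bounded by [M] with variance [v] has moments bounded by
    [v * M ^ (k - 2)]; its cumulants inherit the same bound, without any
    combinatorial loss, because [1/2! + 1/3! + ... < 1]. *)
Lemma cumulant_bound N (G : {poly R}) (v M : R) :
  0 <= M -> 0 <= v <= M ^+ 2 ->
  G`_0 = 1 -> G`_1 = 0 -> G`_2 = v / 2 ->
  (forall k, (2 <= k <= N)%N -> `|G`_k| <= v * M ^+ (k - 2) / k`!%:R) ->
  exists K : {poly R}, [/\ cumulant_of N G K, K`_0 = 0, K`_1 = 0,
    (2 <= N)%N -> K`_2 = v &
    forall k, (2 <= k <= N)%N -> `|K`_k| <= v * M ^+ (k - 2)].
Proof.
move=> M0 /andP[v0 vM] G0 G1 G2 Gk.
elim: N Gk => [|N IH] Gk.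
  exists 0; split; rewrite ?coef0 //; last by case=> [|[|]].
  by move=> k; rewrite leqn0 => /eqP->; rewrite mul0r coef0 coefXM.
have [|K [GK K0 K1 K2 Kb]] := IH.
  by move=> k /andP[k2 kN]; apply: Gk; rewrite k2 leqW.
set s := \sum_(l < N.+1) K`_l * G`_(N.+1 - l).
pose c := N.+1%:R * G`_N.+1 - s.
pose K' := \poly_(l < N.+2) (if l == N.+1 then c else K`_l).
have K'E l : (l <= N)%N -> K'`_l = K`_l.
  by move=> lN; rewrite coef_poly ltnS (leqW lN) ltn_eqF.
have K'N : K'`_N.+1 = c by rewrite coef_poly leqnn eqxx.
have GK' : cumulant_of N.+1 G K'.
  move=> k; rewrite leq_eqVlt => /orP[/eqP->|]; last first.
    rewrite ltnS => kN; rewrite GK // !coefM; apply: eq_bigr => l _.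
    by rewrite K'E // (leq_trans _ kN) // -ltnS.
  rewrite coefXM /= coef_deriv coefM big_ord_recr /= subnn G0 mulr1 K'N.
  rewrite /c (eq_bigr (fun l : 'I_N.+1 => K`_l * G`_(N.+1 - l))).
    by rewrite addrC subrK mulr_natl.
  by move=> l _; rewrite K'E // -ltnS.
have cE : N = 0 -> c = 0.
  by move=> N0; rewrite /c /s N0 big_ord1 K0 G1 mulr0 mul0r subr0.
have cE2 : N = 1 -> c = v.
  move=> N1; rewrite /c /s N1 big_ord_recr big_ord1 /= K0 K1 G2 !mul0r addr0 subr0.
  by field.
exists K'; split=> //.
- by case: (N) K'E => [|n] ->.
- by case: (N) K'E K'N cE => [|n] K'E' K'N' cE'; [rewrite K'N' cE'|rewrite K'E'].
- case: (N) K'E K'N cE2 K2 => [|[|n]] // K'E' K'N' cE' K2' _.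
    by rewrite K'N' cE'.
  by rewrite K'E' // K2'.
move=> k /andP[k2]; rewrite leq_eqVlt => /orP[/eqP kN|]; last first.
  by rewrite ltnS => kN; rewrite K'E // Kb // k2.
rewrite {k}kN in k2 *; rewrite K'N.
case: N => [//|[|N]] in GK K2 Kb s c K' K'E K'N GK' cE cE2 IH Gk k2 *.
  by rewrite cE2 // expr0 mulr1 ger0_norm.
rewrite /c.
apply: le_trans (ler_normB _ _) _.
have sb : `|s| <= v * M ^+ N.+1 * \sum_(2 <= t < N.+2) (t`!%:R)^-1.
  rewrite /s big_ord_recl /= K0 mul0r add0r big_ord_recl /= K1 mul0r add0r.
  apply: le_trans (ler_norm_sum _ _ _) _.
  rewrite big_ord_recr /= /bump /= !add1n subSnn G1 mulr0 normr0 addr0.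
  rewrite mulr_sumr -(addn2 N) -[X in \sum_(X <= _ < _) _]add0n.
  rewrite big_addn addnK big_mkord [leLHS](reindex_inj rev_ord_inj) /=.
  apply: ler_sum => t _.
  have tN := ltn_ord t.
  have e1 : (N.+3 - (1 + (1 + (N - t.+1))) = t + 2)%N by lia.
  rewrite /bump /= addn2 e1 normrM.
  have l2 : (2 <= 1 + (1 + (N - t.+1)) <= N.+2)%N by lia.
  have t2 : (2 <= t + 2 <= N.+3)%N by lia.
  have := Kb _ l2; have := Gk _ t2.
  set l := (1 + (1 + _))%N => Gt Kl.
  apply: le_trans (ler_pM _ _ Kl Gt) _ => //.
  rewrite !mulrA ler_wpM2r ?invr_ge0 //.
  rewrite -!mulrA ler_wpM2l // addnK mulrC -mulrA -exprD.
  apply: le_trans (ler_wpM2r _ vM) _; first exact: exprn_ge0.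
  rewrite -exprD; suff -> : (2 + (t + (l - 2)) = N.+1)%N by [].
  rewrite /l; lia.
have -> : (N.+3 - 2)%N = N.+1 by lia.
have : `|N.+3%:R * G`_N.+3| <= v * M ^+ N.+1 * (N.+2`!%:R)^-1.
  rewrite normrM ger0_norm //.
  apply: (le_trans (ler_wpM2l _ (Gk N.+3 _))) => //; first by rewrite k2 leqnn.
  rewrite (_ : (N.+3 - 2)%N = N.+1) // factS natrM invfM.
  by rewrite mulrCA -!mulrA (mulrA N.+3%:R) divff ?mul1r ?mulrA.
have := @sum_inv_fact N.+2 isT; rewrite big_nat_recr //=.
set a := \sum_(_ <= _ < _) _ in sb *; set b := (N.+2`!%:R)^-1.
set A := v * _ in sb *.
have A0 : 0 <= A by rewrite mulr_ge0 ?exprn_ge0.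
have : 0 <= (2 ^+ N.+1)^-1 :> R by rewrite invr_ge0 exprn_ge0.
nra.
Qed.

End TruncatedSeries.

Section BernoulliModel.
Variables (R : realFieldType) (I : finType) (h f : I -> R).

(** The law of a random subset of [I] containing each [i] independently with
    probability [h i]. *)
Definition bernoulli_weight (Q : {set I}) : R :=
  \prod_i (if i \in Q then h i else 1 - h i).

Definition centred_sum (Q : {set I}) : R := \sum_i ((i \in Q)%:R - h i) * f i.

Definition bernoulli_moment j : R :=
  \sum_(Q : {set I}) bernoulli_weight Q * centred_sum Q ^+ j.

Lemma bernoulli_incl (T : {set I}) :
  \sum_(Q : {set I} | T \subset Q) bernoulli_weight Q = \prod_(i in T) h i.
Proof.
transitivity (\sum_(Q in {set I})
    \prod_i (if i \in Q then h i else if i \in T then 0 else 1 - h i)).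
  rewrite big_mkcond /=; apply: eq_bigr => Q _; case: ifPn => [TQ|].
    apply: eq_bigr => i _; case: ifPn => // iQ.
    by case: ifPn => // /(fintype.subsetP TQ); rewrite (negPf iQ).
  case/fintype.subsetPn => i iT iQ; rewrite (bigD1 i) //=.
  by rewrite (negPf iQ) iT mul0r.
rewrite -bigA_distr [RHS]big_mkcond; apply: eq_bigr => i _.
by case: ifP => _ /=; rewrite ?addr0 // addrC subrK.
Qed.

Definition bernoulli_egf N i : {poly R} :=
  h i *: expT N ((1 - h i) * f i) + (1 - h i) *: expT N (- h i * f i).

Lemma bernoulli_moment_egf N j : (j <= N)%N ->
  bernoulli_moment j / j`!%:R = (\prod_i bernoulli_egf N i)`_j.
Proof.
move=> jN; rewrite bigA_distr coef_sum mulr_suml; apply: eq_bigr => Q _.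
rewrite (eq_bigr (fun i => (if i \in Q then h i else 1 - h i) *:
  expT N (((i \in Q)%:R - h i) * f i))); last first.
  by move=> i _; case: ifP => // _; rewrite sub0r.
rewrite scaler_prod coefZ (@expT_prod _ N) // coef_poly ltnS jN.
by rewrite mulrA.
Qed.

Variable M : R.
Hypothesis h01 : forall i, 0 <= h i <= 1.
Hypothesis fM : forall i, `|f i| <= M.

Definition bernoulli_var : R := \sum_i h i * (1 - h i) * f i ^+ 2.

(** Each centred Bernoulli variable is bounded by [M], so [cumulant_bound]
    applies to each factor and the variances add up. *)
Lemma bernoulli_cumulants N : (2 <= N)%N -> 0 <= M ->
  exists K : {poly R}, [/\ cumulant_of N (\prod_i bernoulli_egf N i) K,
    K`_0 = 0, K`_1 = 0, K`_2 = bernoulli_var &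
    forall k, (2 <= k <= N)%N -> `|K`_k| <= bernoulli_var * M ^+ (k - 2)].
Proof.
move=> N2 M0.
pose v i := h i * (1 - h i) * f i ^+ 2.
have v0 i : 0 <= v i.
  have /andP[h0 h1] := h01 i.
  by apply: mulr_ge0 (sqr_ge0 _); rewrite mulr_ge0 // subr_ge0.
have coefG i k : (k <= N)%N -> (bernoulli_egf N i)`_k =
    (h i * ((1 - h i) * f i) ^+ k + (1 - h i) * (- h i * f i) ^+ k) / k`!%:R.
  by move=> kN; rewrite coefD !coefZ !coef_poly ltnS kN; ring.
have [|K HK] := @fin_all_exists _ _ (fun i (K : {poly R}) =>
  [/\ cumulant_of N (bernoulli_egf N i) K, K`_0 = 0, K`_1 = 0,
    (2 <= N)%N -> K`_2 = v i &
    forall k, (2 <= k <= N)%N -> `|K`_k| <= v i * M ^+ (k - 2)]).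
  move=> i; have /andP[h0 h1] := h01 i.
  have f2 : f i ^+ 2 <= M ^+ 2.
    by rewrite -[f i ^+ 2]ger0_norm ?sqr_ge0 // normrX lerXn2r ?nnegrE.
  have hh : 0 <= h i * (1 - h i) <= 1 by nra.
  apply: cumulant_bound => //.
  - rewrite v0 /=; apply: le_trans f2.
    by rewrite -[leRHS]mul1r ler_wpM2r ?sqr_ge0 //; case/andP: hh.
  - by rewrite coefG // !expr0 fact0; field.
  - by rewrite coefG ?(ltnW N2) // (_ : 1`! = 1)%N // divr1; ring.
  - by rewrite coefG // (_ : 2`! = 2)%N // /v; field.
  move=> k /andP[k2 kN]; rewrite coefG // normrM normfV normr_nat.
  rewrite ler_wpM2r ?invr_ge0 //.
  have -> : h i * ((1 - h i) * f i) ^+ k + (1 - h i) * (- h i * f i) ^+ k =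
    v i * (((1 - h i) * ((1 - h i) * f i) ^+ (k - 2)) +
           (h i * (- h i * f i) ^+ (k - 2))).
    rewrite -{1 2}(subnK k2) !exprD /v; ring.
  rewrite normrM (ger0_norm (v0 i)) ler_wpM2l //.
  have b1 : `|((1 - h i) * f i) ^+ (k - 2)| <= M ^+ (k - 2).
    rewrite normrX lerXn2r ?nnegrE // normrM.
    apply: le_trans (fM i); rewrite -[leRHS]mul1r ler_wpM2r //.
    by rewrite ger0_norm; lra.
  have b2 : `|(- h i * f i) ^+ (k - 2)| <= M ^+ (k - 2).
    rewrite normrX lerXn2r ?nnegrE // normrM normrN.
    apply: le_trans (fM i); rewrite -[leRHS]mul1r ler_wpM2r //.
    by rewrite ger0_norm; lra.
  apply: le_trans (ler_normD _ _) _.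
  rewrite !normrM (ger0_norm h0) [X in X * _ + _]ger0_norm ?subr_ge0 //.
  rewrite [leRHS](_ : _ = (1 - h i) * M ^+ (k - 2) + h i * M ^+ (k - 2)); last ring.
  by rewrite lerD // ler_wpM2l // subr_ge0.
exists (\sum_i K i); split.
- by apply: cumulant_prod => i; have [] := HK i.
- by rewrite coef_sum big1 // => i _; have [] := HK i.
- by rewrite coef_sum big1 // => i _; have [] := HK i.
- by rewrite coef_sum; apply: eq_bigr => i _; have [_ _ _ ->] := HK i.
move=> k kN; rewrite coef_sum mulr_suml.
apply: le_trans (ler_norm_sum _ _ _) (ler_sum _ _) => i _.
by have [_ _ _ _ ->] := HK i.
Qed.

End BernoulliModel.

(** * Nearly Gaussian moments from bounds on cumulants *)

Lemma geometric_half (R : realFieldType) (y : R) n : 0 <= y <= 2^-1 ->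
  \sum_(i < n) y ^+ i <= 1 + 2 * y.
Proof.
move=> /andP[y0 y1]; have y2 : 0 < 1 - y by lra.
rewrite -(ler_pM2l y2).
have -> : (1 - y) * (\sum_(i < n) y ^+ i) = 1 - y ^+ n.
  rewrite -[in RHS](expr1n _ n) subrXX; congr (_ * _); apply: eq_bigr => i _.
  by rewrite expr1n mul1r.
have : 0 <= y ^+ n by rewrite exprn_ge0.
nra.
Qed.

Section GaussianMoments.
Variables (R : rcfType) (G : nat -> R).
Hypothesis G0 : G 0%N = 1.
Hypothesis G1 : 0 < G 1%N.
Hypothesis GS : forall j, j.+2%:R * G j.+2 = G j.

Lemma gauss_gt0 j : 0 < G j.
Proof.
suff : 0 < G j /\ 0 < G j.+1 by case.
elim: j => [|j [h1 h2]]; first by rewrite G0.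
by split=> //; rewrite -(pmulr_rgt0 _ (ltr0Sn R j.+1)) GS.
Qed.

Definition gauss_ratio : R := 1 + (G 1%N)^-1 + 2 * G 1%N.

Lemma gauss_ratio_ge1 : 1 <= gauss_ratio.
Proof. by have := gauss_gt0 1; rewrite /gauss_ratio -invr_gt0 => h; have := G1; lra. Qed.

(** By induction in steps of two, since [G j = (j + 2) * G (j + 2)] and
    [sqrt (j + 1) * sqrt (j + 3) <= j + 2]. *)
Lemma gauss_ratioP j : G j <= gauss_ratio * Num.sqrt j.+1%:R * G j.+1.
Proof.
set c := gauss_ratio; have c1 : 1 <= c := gauss_ratio_ge1.
have Vpos : 0 < (G 1%N)^-1 by rewrite invr_gt0.
suff : G j <= c * Num.sqrt j.+1%:R * G j.+1 /\
       G j.+1 <= c * Num.sqrt j.+2%:R * G j.+2 by case.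
elim: j => [|j [h1 h2]]; split=> //.
- rewrite G0 sqrtr1 mulr1 -(mulVf (lt0r_neq0 G1)) ler_wpM2r ?(ltW G1) //.
  by rewrite /c /gauss_ratio; have := G1; lra.
- have -> : G 2%N = 2^-1 by apply: (mulfI (lt0r_neq0 (ltr0Sn R 1))); rewrite GS G0 divff // pnatr_eq0.
  have : 1 <= Num.sqrt 2 :> R by rewrite -{1}sqrtr1 ler_wsqrtr // ler1n.
  rewrite /c /gauss_ratio; have := G1; nra.
set p := Num.sqrt j.+1%:R in h1; set q := Num.sqrt j.+3%:R.
have p0 : 0 <= p := sqrtr_ge0 _; have q0 : 0 <= q := sqrtr_ge0 _.
have p2 : p ^+ 2 = j.+1%:R by rewrite sqr_sqrtr.
have q2 : q ^+ 2 = j.+3%:R by rewrite sqr_sqrtr.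
have e3 : j.+3%:R = j.+1%:R + 2 :> R by rewrite -natrD addn2.
have e2 : j.+2%:R = j.+1%:R + 1 :> R by rewrite natr1.
have j0 : 0 <= j.+1%:R :> R by [].
have pq : p * q <= j.+2%:R.
  rewrite -ler_sqr ?nnegrE ?mulr_ge0 // exprMn p2 q2 e3 e2; nra.
rewrite -(ler_pM2l (ltr0Sn R j.+1)) GS.
apply: le_trans h1 _.
rewrite -(GS j.+1) -q2.
have g0 := ltW (gauss_gt0 j.+3).
have -> : c * p * (q ^+ 2 * G j.+3) = (p * q) * (c * q * G j.+3) by ring.
have -> : j.+2%:R * (c * q * G j.+3) = j.+2%:R * (c * q * G j.+3) by [].
by rewrite ler_wpM2r // !mulr_ge0 // (le_trans ler01).
Qed.

Lemma gauss_ratio_iter m i j : (i <= j)%N -> (j <= m)%N ->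
  G (j - i) <= (gauss_ratio * Num.sqrt m%:R) ^+ i * G j.
Proof.
elim: i j => [|i IH] j ij jm; first by rewrite subn0 expr0 mul1r.
case: j ij jm => // j ij jm; rewrite subSS.
apply: le_trans (IH j ij (ltnW jm)) _.
have c0 : 0 <= gauss_ratio by apply: le_trans gauss_ratio_ge1.
rewrite exprSr -mulrA ler_wpM2l ?exprn_ge0 ?mulr_ge0 ?sqrtr_ge0 //.
apply: le_trans (gauss_ratioP j) _.
rewrite ler_wpM2r ?(ltW (gauss_gt0 _)) // ler_wpM2l //.
by rewrite ler_wsqrtr // ler_nat.
Qed.

Variables (m : nat) (K a : nat -> R) (s M : R).
Hypothesis s0 : 0 < s.
Hypothesis M0 : 0 <= M.
Hypothesis a0 : a 0%N = 1.
Hypothesis a_rec : forall j, (j <= m)%N ->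
  j%:R * a j = \sum_(l < j.+1) K l * a (j - l)%N.
Hypothesis K0 : K 0%N = 0.
Hypothesis K1 : K 1%N = 0.
Hypothesis K2 : K 2%N = s ^+ 2.
Hypothesis Kb : forall k, (2 <= k <= m)%N -> `|K k| <= s ^+ 2 * M ^+ (k - 2).

Let eta : R := gauss_ratio * Num.sqrt m%:R * (M / s).
Hypothesis eta_half : eta <= 2^-1.

Let eta0 : 0 <= eta.
Proof.
rewrite /eta !mulr_ge0 ?sqrtr_ge0 ?invr_ge0 // ?(ltW s0) //.
exact: le_trans gauss_ratio_ge1.
Qed.

Let a_recS j : (j.+2 <= m)%N ->
  j.+2%:R * a j.+2 = \sum_(i < j.+1) K i.+2 * a (j - i)%N.
Proof.
move=> jm; rewrite a_rec // big_ord_recl K0 mul0r add0r big_ord_recl K1 mul0r.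
by rewrite add0r; apply: eq_bigr => i _; rewrite !lift0 !subSS.
Qed.

Let K_term j i b : (j.+2 <= m)%N -> (i <= j)%N ->
  `|a (j - i)%N| <= G (j - i) * s ^+ (j - i) * b ->
  `|K i.+2 * a (j - i)%N| <= s ^+ j.+2 * G j * b * eta ^+ i.
Proof.
move=> jm ij ab.
have b0 : 0 <= b.
  have := le_trans (normr_ge0 _) ab.
  by rewrite pmulr_rge0 // mulr_gt0 ?exprn_gt0 // gauss_gt0.
rewrite normrM; have i2 : (2 <= i.+2 <= m)%N by rewrite /= (leq_trans _ jm) // !ltnS.
apply: le_trans (ler_pM _ _ (Kb i2) ab) _ => //.
rewrite subSS subn1 /=.
have gi := gauss_ratio_iter ij (ltnW (ltnW jm)).
set r := gauss_ratio * Num.sqrt m%:R in gi *.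
have -> : s ^+ 2 * M ^+ i * (G (j - i) * s ^+ (j - i) * b) =
   (s ^+ 2 * M ^+ i * s ^+ (j - i) * b) * G (j - i) by ring.
have -> : s ^+ j.+2 * G j * b * eta ^+ i =
  (s ^+ 2 * M ^+ i * s ^+ (j - i) * b) * (r ^+ i * G j).
  have -> : eta ^+ i = r ^+ i * M ^+ i / s ^+ i.
    by rewrite /eta -/r !exprMn exprVn mulrA.
  have -> : s ^+ j.+2 = s ^+ 2 * s ^+ (j - i) * s ^+ i.
    by rewrite -!exprD; congr (_ ^+ _); lia.
  by field; rewrite expf_neq0 // lt0r_neq0.
by rewrite ler_wpM2l // !mulr_ge0 ?exprn_ge0 // ltW.
Qed.

(** Cumulants of order at least three cost a factor [1 + 2 eta] at each of the
    [m] steps of the recursion, so moments keep the Gaussian order of magnitude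
    as long as [m * eta] is bounded. *)
Lemma moment_size j : (j <= m)%N -> `|a j| <= G j * s ^+ j * (1 + 2 * eta) ^+ j.
Proof.
have e1 : 1 <= 1 + 2 * eta by rewrite lerDl mulr_ge0.
have [n] := ubnP j; elim: n j => // n IH [|[|j]] jn jm.
- by rewrite a0 G0 normr1 !expr0 !mulr1.
- have := a_rec jm; rewrite big_ord_recr big_ord1 /= K0 K1 !mul0r addr0 mul1r => ->.
  rewrite normr0 !mulr_ge0 ?exprn_ge0 ?(ltW (gauss_gt0 _)) ?(ltW s0) //.
  exact: le_trans e1.
rewrite -(ler_pM2l (ltr0Sn R j.+1)) -{1}[j.+2%:R]normr_nat -normrM a_recS //.
apply: le_trans (ler_norm_sum _ _ _) _.
apply: (@le_trans _ _ (\sum_(i < j.+1) s ^+ j.+2 * G j * (1 + 2 * eta) ^+ j * eta ^+ i)).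
  apply: ler_sum => i _; have ij : (i <= j)%N by rewrite -ltnS.
  apply: K_term => //; apply: le_trans (IH _ _ _) _.
  - by move: jn; lia.
  - by rewrite (leq_trans (leq_subr _ _)) // ltnW // ltnW.
  rewrite ler_wpM2l ?mulr_ge0 ?exprn_ge0 ?(ltW (gauss_gt0 _)) ?(ltW s0) //.
  by rewrite ler_weXn2l // leq_subr.
rewrite -mulr_sumr.
have -> : j.+2%:R * (G j.+2 * s ^+ j.+2 * (1 + 2 * eta) ^+ j.+2) =
  (s ^+ j.+2 * G j) * (1 + 2 * eta) ^+ j.+2 by rewrite -(GS j); ring.
rewrite -mulrA; apply: ler_wpM2l.
  by rewrite mulr_ge0 ?exprn_ge0 ?(ltW (gauss_gt0 _)) ?(ltW s0).
apply: (@le_trans _ _ ((1 + 2 * eta) ^+ j * (1 + 2 * eta))).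
  rewrite ler_wpM2l ?exprn_ge0 ?(le_trans ler01) //.
  by apply: geometric_half; rewrite eta0.
by rewrite -exprSr ler_weXn2l.
Qed.

(** The cumulant [K 2] alone reproduces the Gaussian recursion; the other ones
    contribute a geometric series in [eta] at each of the [j / 2] steps. *)
Lemma moment_asymp j : (j <= m)%N ->
  `|a j - (~~ odd j)%:R * G j * s ^+ j| <=
    j%:R * (2 * eta) * (1 + 2 * eta) ^+ m * (G j * s ^+ j).
Proof.
have e1 : 1 <= 1 + 2 * eta by rewrite lerDl mulr_ge0.
have [n] := ubnP j; elim: n j => // n IH [|[|j]] jn jm.
- by rewrite a0 G0 expr0 !mul1r subrr normr0 !mul0r.
- have := a_rec jm; rewrite big_ord_recr big_ord1 /= K0 K1 !mul0r addr0 mul1r => ->.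
  have x0 : 0 <= 2 * eta by rewrite mulr_ge0.
  rewrite subr0 normr0 mul1r mulr_ge0 //.
    by rewrite mulr_ge0 // exprn_ge0 // (le_trans ler01).
  by rewrite mulr_ge0 ?exprn_ge0 ?(ltW (gauss_gt0 _)) ?(ltW s0).
have jm' : (j <= m)%N by rewrite ltnW // ltnW.
set E := (1 + 2 * eta) ^+ m.
have E0 : 0 <= E by rewrite exprn_ge0 // (le_trans ler01).
rewrite -(ler_pM2l (ltr0Sn R j.+1)) -{1}[j.+2%:R]normr_nat -normrM mulrBr a_recS //.
rewrite big_ord_recl /= subn0 K2 negbK.
set r := \sum_(i < j) _.
have -> : s ^+ 2 * a j + r - j.+2%:R * ((~~ odd j)%:R * G j.+2 * s ^+ j.+2) =
  s ^+ 2 * (a j - (~~ odd j)%:R * G j * s ^+ j) + r.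
  by rewrite -(GS j) !exprS; ring.
have rb : `|r| <= s ^+ j.+2 * G j * E * (2 * eta).
  apply: le_trans (ler_norm_sum _ _ _) _.
  apply: (@le_trans _ _ (\sum_(i < j) s ^+ j.+2 * G j * E * eta ^+ i.+1)).
    apply: ler_sum => i _; apply: K_term => //.
    apply: le_trans (moment_size _) _; first by rewrite (leq_trans (leq_subr _ _)).
    rewrite ler_wpM2l ?mulr_ge0 ?exprn_ge0 ?(ltW (gauss_gt0 _)) ?(ltW s0) //.
    by rewrite ler_weXn2l // (leq_trans (leq_subr _ _)).
  rewrite -mulr_sumr; apply: ler_wpM2l.
    by rewrite mulr_ge0 // mulr_ge0 ?exprn_ge0 ?(ltW (gauss_gt0 _)) ?(ltW s0).
  have := @geometric_half R eta j.+1; rewrite big_ord_recl expr0 => /(_ _)/le_trans.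
  rewrite eta0 eta_half => /(_ _ isT) h.
  by have := h _ (lexx _); rewrite lerD2l.
apply: le_trans (ler_normD _ _) _.
have := IH j (ltnW jn) jm'; rewrite -/E => IHj.
rewrite normrM (ger0_norm (sqr_ge0 s)).
apply: le_trans (lerD (ler_wpM2l (sqr_ge0 s) IHj) rb) _.
have -> : s ^+ 2 * (j%:R * (2 * eta) * E * (G j * s ^+ j)) +
   s ^+ j.+2 * G j * E * (2 * eta) = j.+1%:R * (2 * eta * E * G j * s ^+ j.+2).
  by rewrite -[j.+1%:R]natr1 !exprS; ring.
have -> : j.+2%:R * (j.+2%:R * (2 * eta) * E * (G j.+2 * s ^+ j.+2)) =
  j.+2%:R * (2 * eta * E * G j * s ^+ j.+2) by rewrite -(GS j); ring.
have x0 : 0 <= 2 * eta by rewrite mulr_ge0.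
have g0 : 0 <= G j := ltW (gauss_gt0 j).
rewrite ler_wpM2r ?ler_nat // mulr_ge0 ?exprn_ge0 ?(ltW s0) //.
by rewrite mulr_ge0 // mulr_ge0.
Qed.

End GaussianMoments.

(** * Comparing and shifting moments *)

Section SignedMoments.
Variables (R : realFieldType) (I : finType) (f : I -> R) (v : {set I} -> R).
Variable M : R.
Hypothesis M0 : 0 <= M.
Hypothesis fM : forall i, `|f i| <= M.

Definition incl_weight (T : {set I}) : R := \sum_(Q : {set I} | T \subset Q) v Q.

(** Expanding the power, a product of [k] memberships is the inclusion of the
    image of the index map. *)
Lemma sum_power_incl k : \sum_(Q : {set I}) v Q * (\sum_(i in Q) f i) ^+ k =
  \sum_(phi : {ffun 'I_k -> I}) (\prod_l f (phi l)) * incl_weight (phi @: 'I_k).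
Proof.
transitivity (\sum_(Q : {set I}) \sum_(phi : {ffun 'I_k -> I})
    (\prod_l f (phi l)) * (if phi @: 'I_k \subset Q then v Q else 0)).
  apply: eq_bigr => Q _; rewrite big_mkcond /= -[k in _ ^+ k]card_ord -prodr_const.
  rewrite bigA_distr_bigA mulr_sumr; apply: eq_bigr => phi _.
  case: ifPn => [/fintype.subsetP TQ|/fintype.subsetPn[_ /imsetP[l _ ->] lQ]].
    rewrite mulrC; congr (_ * _); apply: eq_bigr => l _.
    by rewrite TQ // imset_f.
  by rewrite (bigD1 l) //= (negPf lQ) mul0r !mulr0.
rewrite exchange_big; apply: eq_bigr => phi _.
by rewrite -mulr_sumr -big_mkcond.
Qed.

Lemma sum_power_incl_le j k : (k <= j)%N ->
  `|\sum_Q v Q * (\sum_(i in Q) f i) ^+ k| <=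
    (M * j%:R) ^+ k * \sum_(T : {set I} | (#|T| <= j)%N) `|incl_weight T|.
Proof.
move=> kj; rewrite sum_power_incl.
apply: le_trans (ler_norm_sum _ _ _) _.
apply: (@le_trans _ _ (\sum_(phi : {ffun 'I_k -> I}) M ^+ k *
   `|incl_weight (phi @: 'I_k)|)).
  apply: ler_sum => phi _; rewrite normrM ler_wpM2r //.
  rewrite normr_prod -[k in leRHS]card_ord -prodr_const.
  by apply: ler_prod => l _; rewrite normr_ge0 fM.
rewrite -mulr_sumr exprMn -mulrA ler_wpM2l ?exprn_ge0 //.
rewrite (partition_big (fun phi : {ffun 'I_k -> I} => phi @: 'I_k)
  (fun T : {set I} => (#|T| <= j)%N)); last first.
  move=> phi _; apply: leq_trans (leq_imset_card _ _) _.
  by rewrite -[#|_|]/(#|'I_k|) card_ord.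
rewrite mulr_sumr; apply: ler_sum => T Tj.
rewrite (eq_bigr (fun=> `|incl_weight T|)) => [|phi /andP[_ /eqP->] //].
rewrite sumr_const -[leLHS]mulr_natl ler_wpM2r // -natrX ler_nat.
apply: (@leq_trans #|[pred phi : {ffun 'I_k -> I} | phi \in ffun_on T]|).
  apply: subset_leq_card; apply/fintype.subsetP => phi; rewrite unfold_in => TE0.
  have <- : phi @: 'I_k = T by apply/eqP.
  rewrite inE.
  by apply/ffun_onP => l; rewrite imset_f.
have -> : #|[pred phi : {ffun 'I_k -> I} | phi \in ffun_on T]| = (#|T| ^ k)%N.
  rewrite -[in RHS](card_ord k) -card_ffun_on; apply: eq_card => phi.
  by rewrite !inE.
by have [->|k0] := posnP k; [rewrite !expn0|rewrite leq_exp2r].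
Qed.

(** A power [j] of a sum over a random set only sees the inclusion weights of
    sets of size at most [j]. *)
Lemma signed_moment_le (mu : R) j :
  `|\sum_Q v Q * (\sum_(i in Q) f i - mu) ^+ j| <=
    (M * j%:R + `|mu|) ^+ j *
    \sum_(T : {set I} | (#|T| <= j)%N) `|incl_weight T|.
Proof.
set X := \sum_(T : {set I} | (#|T| <= j)%N) _.
have -> : \sum_Q v Q * (\sum_(i in Q) f i - mu) ^+ j =
  \sum_(i < j.+1) (- mu) ^+ i * 'C(j, i)%:R *
     (\sum_Q v Q * (\sum_(l in Q) f l) ^+ (j - i)).
  under eq_bigr => Q _ do rewrite exprDn mulr_sumr.
  rewrite exchange_big; apply: eq_bigr => i _; rewrite mulr_sumr.
  by apply: eq_bigr => Q _; rewrite -mulr_natr; ring.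
apply: le_trans (ler_norm_sum _ _ _) _.
rewrite exprDn mulr_suml; apply: ler_sum => i _.
rewrite !normrM normrX normrN normr_nat.
apply: (@le_trans _ _ (`|mu| ^+ i * 'C(j, i)%:R * ((M * j%:R) ^+ (j - i) * X))).
  by rewrite ler_wpM2l ?mulr_ge0 ?exprn_ge0 // sum_power_incl_le // leq_subr.
rewrite -[_ *+ 'C(j, i)]mulr_natr le_eqVlt; apply/orP; left; apply/eqP; ring.
Qed.

End SignedMoments.

Section Shift.
Variables (R : rcfType) (G : nat -> R).
Hypothesis G0 : G 0%N = 1.
Hypothesis G1 : 0 < G 1%N.
Hypothesis GS : forall j, j.+2%:R * G j.+2 = G j.
Variables (J : Type) (r : seq J) (P : pred J) (w S Y : J -> R).
Variables (m : nat) (s y B : R).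
Hypothesis w0 : forall i, P i -> 0 <= w i.
Hypothesis s0 : 0 < s.
Hypothesis Yy : forall i, P i -> `|Y i| <= y.
Hypothesis y0 : 0 <= y.
Hypothesis SB : forall j, (j <= m)%N ->
  \sum_(i <- r | P i) w i * S i ^+ j <= B * (j`!%:R * G j * s ^+ j).
Hypothesis B0 : 0 <= B.
Notation c := (gauss_ratio G).

(** Odd absolute moments are interpolated between the two neighbouring even
    ones, [2 |S|^j <= lam S^(j-1) + S^(j+1) / lam], with [lam] balanced. *)
Lemma abs_moment_le j : (j < m)%N ->
  \sum_(i <- r | P i) w i * `|S i| ^+ j <= c * B * (j`!%:R * G j * s ^+ j).
Proof.
move=> jm; have c1 := gauss_ratio_ge1 G0 G1 GS.
have g0 i : 0 <= G i := ltW (gauss_gt0 G0 G1 GS i).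
have [jodd|jeven] := boolP (odd j); last first.
  under eq_bigr => i _ do rewrite -normrX (ger0_norm (real_exprn_even_ge0 (num_real _) _)) //.
  apply: le_trans (SB (ltnW jm)) _; rewrite -[leRHS]mulrA ler_peMl //.
  by rewrite !mulr_ge0 ?exprn_ge0 // ltW.
case: j jodd jm => // j /= jeven jm.
set q := Num.sqrt j.+1%:R : R.
have q0 : 0 < q by rewrite sqrtr_gt0 ltr0n.
have q2 : q ^+ 2 = j.+1%:R by rewrite sqr_sqrtr.
set lam := s * q; have l0 : 0 < lam by rewrite mulr_gt0.
apply: (@le_trans _ _ (\sum_(i <- r | P i)
   (lam / 2 * (w i * S i ^+ j) + (2 * lam)^-1 * (w i * S i ^+ j.+2)))).
  apply: ler_sum => i Pi.
  have -> : lam / 2 * (w i * S i ^+ j) + (2 * lam)^-1 * (w i * S i ^+ j.+2) =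
    w i * (`|S i| ^+ j * (lam / 2 + (2 * lam)^-1 * `|S i| ^+ 2)).
    rewrite -normrX ger0_norm ?real_exprn_even_ge0 ?num_real //.
    rewrite -normrX (ger0_norm (sqr_ge0 _)) -[j.+2]addn2 exprD; ring.
  rewrite ler_wpM2l ?w0 // exprSr ler_wpM2l ?exprn_ge0 //.
  rewrite -subr_ge0 (_ : _ - _ = (2 * lam)^-1 * (lam - `|S i|) ^+ 2).
    by rewrite mulr_ge0 ?sqr_ge0 // invr_ge0 mulr_ge0 // ltW.
  by field; rewrite lt0r_neq0.
rewrite big_split -!mulr_sumr /=.
have l20 : 0 <= lam / 2 by rewrite mulr_ge0 ?invr_ge0 // ltW.
have l2V : 0 <= (2 * lam)^-1 by rewrite invr_ge0 mulr_ge0 // ltW.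
have jm' : (j <= m)%N by apply: ltnW; apply: ltnW.
apply: le_trans (lerD (ler_wpM2l l20 (SB jm')) (ler_wpM2l l2V (SB jm))) _.
have -> : lam / 2 * (B * (j`!%:R * G j * s ^+ j)) +
  (2 * lam)^-1 * (B * (j.+2`!%:R * G j.+2 * s ^+ j.+2)) =
  j`!%:R * B * s ^+ j.+1 * (G j * q).
  rewrite !factS !natrM -q2 -(GS j) !exprS /lam.
  by field; rewrite !lt0r_neq0.
have -> : c * B * (j.+1`!%:R * G j.+1 * s ^+ j.+1) =
   j`!%:R * B * s ^+ j.+1 * (c * q * G j.+1 * q).
  by rewrite factS natrM -q2; ring.
rewrite ler_wpM2l ?mulr_ge0 ?exprn_ge0 ?(ltW s0) // ler_wpM2r ?(ltW q0) //.
exact: gauss_ratioP.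
Qed.

(** Binomial expansion: the [k]-th term is [u ^ k / k!] times the main moment,
    by [gauss_ratio_iter] and [abs_moment_le]. *)
Lemma shifted_moment u : u = c * Num.sqrt m%:R * (y / s) ->
  `|\sum_(i <- r | P i) w i * (S i + Y i) ^+ m
    - \sum_(i <- r | P i) w i * S i ^+ m| <=
  c * B * (m`!%:R * G m * s ^+ m) * (u * \sum_(k < m) u ^+ k / k`!%:R).
Proof.
move=> uE; have c1 := gauss_ratio_ge1 G0 G1 GS.
have g0 i : 0 <= G i := ltW (gauss_gt0 G0 G1 GS i).
have u0 : 0 <= u.
  by rewrite uE !mulr_ge0 ?sqrtr_ge0 ?invr_ge0 ?(ltW s0) // (le_trans ler01).
have -> : \sum_(i <- r | P i) w i * (S i + Y i) ^+ m
    - \sum_(i <- r | P i) w i * S i ^+ m =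
  \sum_(i <- r | P i) \sum_(k < m)
    'C(m, k.+1)%:R * (w i * S i ^+ (m - k.+1)) * Y i ^+ k.+1.
  rewrite -sumrB; apply: eq_bigr => i _.
  rewrite exprDn big_ord_recl subn0 expr0 mulr1 bin0 mulr1n mulrDr addrC addKr.
  by rewrite mulr_sumr; apply: eq_bigr => k _; rewrite lift0 -mulr_natr; ring.
rewrite exchange_big /=; apply: le_trans (ler_norm_sum _ _ _) _.
rewrite mulr_sumr mulr_sumr; apply: ler_sum => k _.
have km : (m - k.+1 < m)%N by have := ltn_ord k; lia.
apply: le_trans (ler_norm_sum _ _ _) _.
apply: (@le_trans _ _ ('C(m, k.+1)%:R * y ^+ k.+1 *
    \sum_(i <- r | P i) w i * `|S i| ^+ (m - k.+1))).
  rewrite mulr_sumr; apply: ler_sum => i Pi.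
  rewrite !normrM !normrX normr_nat (ger0_norm (w0 Pi)).
  rewrite -[leRHS]mulrA [leRHS](_ : _ = 'C(m, k.+1)%:R *
     (w i * `|S i| ^+ (m - k.+1)) * y ^+ k.+1); last by ring.
  rewrite ler_wpM2l ?mulr_ge0 ?exprn_ge0 ?w0 //.
  by rewrite lerXn2r ?nnegrE ?Yy.
apply: le_trans (ler_wpM2l _ (abs_moment_le km)) _.
  by rewrite mulr_ge0 ?exprn_ge0.
have gi := gauss_ratio_iter G0 G1 GS (ltn_ord k) (leqnn m).
set q := c * Num.sqrt m%:R in gi *.
have f1 : (m - k.+1)`!%:R != 0 :> R by rewrite pnatr_eq0 -lt0n fact_gt0.
have f2 : k.+1`!%:R != 0 :> R by rewrite pnatr_eq0 -lt0n fact_gt0.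
have binE : 'C(m, k.+1)%:R = m`!%:R / (k.+1`!%:R * (m - k.+1)`!%:R) :> R.
  rewrite -(bin_fact (ltn_ord k)) natrM [(_ * (m - k.+1)`!)%:R]natrM mulfK //.
have f3 : k`!%:R != 0 :> R by rewrite pnatr_eq0 -lt0n fact_gt0.
have sE : s ^+ m = s ^+ (m - k.+1) * s ^+ k.+1.
  by rewrite -exprD subnK //; case: (k) => ? /=.
have sn : s ^+ k.+1 != 0 by rewrite expf_neq0 // lt0r_neq0.
apply: (@le_trans _ _ (c * B * m`!%:R * s ^+ (m - k.+1) * y ^+ k.+1 / k.+1`!%:R *
   (q ^+ k.+1 * G m))).
  rewrite [leLHS](_ : _ = c * B * m`!%:R * s ^+ (m - k.+1) * y ^+ k.+1 / k.+1`!%:R *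
    G (m - k.+1)); last by rewrite binE; field; rewrite f1 f2.
  rewrite ler_wpM2l // !mulr_ge0 ?invr_ge0 ?exprn_ge0 ?(ltW s0) //.
  exact: le_trans c1.
rewrite [leLHS](_ : _ = c * B * (m`!%:R * G m * s ^+ m) * u ^+ k.+1 / k.+1`!%:R).
  rewrite -[leLHS]mulrA; apply: ler_wpM2l.
    by rewrite !mulr_ge0 ?exprn_ge0 ?(ltW s0) // (le_trans ler01).
  rewrite mulrA -exprS ler_wpM2l ?exprn_ge0 //.
  by rewrite lef_pV2 ?posrE ?ltr0n ?fact_gt0 // ler_nat factS leq_pmull.
rewrite sE uE -/q !exprMn exprVn; field.
by rewrite f2.
Qed.

End Shift.

(** * Chebyshev and Mertens bounds for primes *)

Lemma prod_primes_dvd (s : seq nat) m :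
  uniq s -> all prime s -> all (dvdn^~ m) s -> (\prod_(p <- s) p %| m)%N.
Proof.
elim: s => [|p s IH]; first by rewrite big_nil dvd1n.
move=> /= /andP[ps us] /andP[pp sp] /andP[pm sm].
rewrite big_cons Gauss_dvd ?pm ?IH //.
rewrite big_seq; elim/big_rec : _ => [|q a qs pa]; first exact: coprimen1.
rewrite coprimeMr pa andbT prime_coprime //.
apply/negP => /(prime_nt_dvdP (allP sp q qs)) pq.
by move: ps; rewrite pq ?qs //; move: pp; case: (p) => [|[]].
Qed.

Lemma central_bin_le n : ('C(n.*2, n) <= 4 ^ n)%N.
Proof.
rewrite -[4%N]/(2 ^ 2)%N -expnM mul2n.
rewrite -[2%N in leqRHS]/(1 + 1)%N expnDn.
have nn : (n < n.*2.+1)%N by lia.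
rewrite (bigD1 (Ordinal nn)) //= !exp1n !muln1; exact: leq_addr.
Qed.

Lemma prime_dvd_central_bin n p : prime p -> (n < p <= n.*2)%N -> (p %| 'C(n.*2, n))%N.
Proof.
move=> pp /andP[np p2n].
have nn : (n <= n.*2)%N by lia.
have pf k : (k < p)%N -> ~~ (p %| k`!)%N.
  elim: k => [|k IH] kp; first by rewrite fact0 dvdn1; case: (p) pp => [|[]].
  rewrite factS Euclid_dvdM // negb_or IH ?(ltnW kp) // andbT.
  by rewrite gtnNdvd.
have : (p %| n.*2`!)%N by rewrite dvdn_fact // prime_gt0.
rewrite -(bin_fact nn) Euclid_dvdM // => /orP[//|].
have -> : (n.*2 - n = n)%N by lia.
by rewrite Euclid_dvdM // (negPf (pf n np)).
Qed.

Section MertensBounds.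
Variable R : realType.

(** Chebyshev: the product of the primes in [(n, 2n]] divides the central
    binomial coefficient. *)
Lemma chebyshev_block n :
  \sum_(n.+1 <= p < n.*2.+1 | prime p) ln p%:R <= n%:R * ln 4 :> R.
Proof.
set s := [seq p <- index_iota n.+1 n.*2.+1 | prime p].
have sp : all prime s by rewrite filter_all.
have -> : \sum_(n.+1 <= p < n.*2.+1 | prime p) ln p%:R = ln (\prod_(p <- s) p)%:R :> R.
  rewrite -[LHS]big_filter -/s; elim: s sp => [|p s IH]; first by rewrite !big_nil ln1.
  move=> /= /andP[pp sp]; rewrite !big_cons natrM lnM ?IH //.
    by rewrite posrE ltr0n prime_gt0.
  rewrite posrE ltr0n big_seq; apply: prodn_cond_gt0 => q.
  by move=> /(allP sp) /prime_gt0.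
have -> : n%:R * ln 4 = ln (4 ^ n)%:R :> R.
  by rewrite natrX lnXn // mulr_natl.
have s0 : (0 < \prod_(p <- s) p)%N.
  rewrite big_seq; apply: prodn_cond_gt0 => q.
  by move=> /(allP sp) /prime_gt0.
rewrite ler_ln ?posrE ?ltr0n ?expn_gt0 // ler_nat.
apply: leq_trans (central_bin_le n).
apply: dvdn_leq; first by rewrite bin_gt0; lia.
apply: prod_primes_dvd => //; first exact: filter_uniq (iota_uniq _ _).
apply/allP => p; rewrite mem_filter mem_index_iota => /andP[pp pn].
exact: prime_dvd_central_bin.
Qed.

Lemma sum_dyadic_split (F : nat -> R) k :
  (forall p, prime p -> 0 <= F p) ->
  \sum_(0 <= p < (2 ^ k.+1).+1 | prime p) F p =
  \sum_(0 <= p < (2 ^ k).+1 | prime p) F p +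
  \sum_((2 ^ k).+1 <= p < (2 ^ k).*2.+1 | prime p) F p.
Proof.
move=> F0; rewrite (big_cat_nat _ (n := (2 ^ k).+1)) //=.
  by rewrite expnS mul2n.
by rewrite ltnS leq_exp2l.
Qed.

Lemma dyadic_log_block k :
  \sum_((2 ^ k).+1 <= p < (2 ^ k).*2.+1 | prime p) ln p%:R / p%:R <= ln 4 :> R.
Proof.
have k0 : 0 < (2 ^ k)%:R :> R by rewrite ltr0n expn_gt0.
rewrite -(ler_pM2l k0); apply: le_trans (chebyshev_block _).
rewrite mulr_sumr big_nat_cond [leRHS]big_nat_cond; apply: ler_sum => p /andP[/andP[kp _] pp].
rewrite mulrCA ler_piMr ?ln_ge0 ?ler1n ?prime_gt0 //.
by rewrite ler_pdivrMr ?mul1r ?ler_nat ?ltr0n ?prime_gt0 // ltnW.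
Qed.

Lemma sum_log_dyadic k :
  \sum_(0 <= p < (2 ^ k).+1 | prime p) ln p%:R / p%:R <= k%:R * ln 4 :> R.
Proof.
elim: k => [|k IH].
  rewrite big_mkcond /=. by rewrite big_ltn // big_ltn // big_geq //= mul0r !addr0.
rewrite sum_dyadic_split; last first.
  by move=> p pp; rewrite divr_ge0 ?ln_ge0 ?ler1n ?prime_gt0.
rewrite -natr1 mulrDl mul1r; apply: lerD IH _; exact: dyadic_log_block.
Qed.

Lemma harmonic_le k : \sum_(0 <= i < k.+1) (i.+1%:R)^-1 <= 1 + ln k.+1%:R :> R.
Proof.
elim: k => [|k IH]; first by rewrite big_nat1 invr1 ln1 addr0.
rewrite big_nat_recr //=; apply: le_trans (lerD IH (lexx _)) _.
rewrite -addrA lerD2l -lerBrDl.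
have k2 : 0 < k.+2%:R :> R by [].
have k1 : 0 < k.+1%:R :> R by [].
have h : - 1 < - (k.+2%:R)^-1 :> R by rewrite ltrN2 invf_lt1 // ltr1n.
have := le_ln1Dx h.
have -> : 1 - (k.+2%:R)^-1 = k.+1%:R / k.+2%:R :> R.
  apply: (mulIf (lt0r_neq0 k2)); rewrite mulrBl mul1r mulVf ?divfK ?lt0r_neq0 //.
  by rewrite -[k.+2%:R]natr1 addrK.
by rewrite ln_div ?posrE // lerNr opprB.
Qed.

Lemma ln4E : ln 4 = 2 * ln 2 :> R.
Proof.
have -> : 4 = 2 ^+ 2 :> R by rewrite -natrX.
by rewrite lnXn // mulr_natl.
Qed.

Lemma ln2_gt0 : 0 < ln 2 :> R.
Proof. by rewrite ln_gt0 // ltr1n. Qed.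

Lemma ln2_ge_half : 2^-1 <= ln 2 :> R.
Proof.
have h : - 1 < - 2^-1 :> R by lra.
have := le_ln1Dx h.
have -> : 1 - 2^-1 = 2^-1 :> R by lra.
by rewrite lnV ?posrE //; lra.
Qed.

(** On a dyadic block the sum of [1 / p] is at most [ln 4 / ln (2 ^ k)], i.e.
    [2 / k]. *)
Lemma sum_recip_dyadic k :
  \sum_(0 <= p < (2 ^ k.+1).+1 | prime p) (p%:R)^-1 <= 3 + 2 * ln k.+1%:R :> R.
Proof.
suff : \sum_(0 <= p < (2 ^ k.+1).+1 | prime p) (p%:R)^-1 <=
    1 + 2 * \sum_(0 <= i < k) (i.+1%:R)^-1 :> R.
  have := harmonic_le k; rewrite big_nat_recr //=.
  have : 0 <= (k.+1%:R)^-1 :> R by rewrite invr_ge0.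
  set a := \sum_(_ <= _ < _) _; set b := \sum_(_ <= _ < _ | _) _.
  by move: (k.+1%:R^-1) (ln _) => c d h0 h1 h2; lra.
elim: k => [|k IH].
  rewrite (_ : (2 ^ 1).+1 = 3)%N // big_mkcond [X in 2 * X]big_geq //.
  rewrite big_ltn // big_ltn // big_ltn // big_geq //=; lra.
rewrite sum_dyadic_split; last by move=> p pp; rewrite invr_ge0.
rewrite [\sum_(0 <= i < k.+1) _]big_nat_recr //= mulrDr addrA; apply: lerD IH _.
have k1 : 0 < k.+1%:R :> R by [].
have l2 := ln2_gt0.
have kl : 0 < k.+1%:R * ln 2 :> R by rewrite mulr_gt0.
rewrite -(ler_pM2l kl).
apply: (@le_trans _ _ (ln 4)); last first.
  by rewrite ln4E le_eqVlt; apply/orP; left; apply/eqP; field; rewrite lt0r_neq0.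
apply: le_trans (dyadic_log_block k.+1).
rewrite mulr_sumr big_nat_cond [leRHS]big_nat_cond; apply: ler_sum => p /andP[/andP[kp _] pp].
rewrite ler_pM2r ?invr_gt0 ?ltr0n ?prime_gt0 //.
have -> : k.+1%:R * ln 2 = ln (2 ^ k.+1)%:R :> R by rewrite natrX lnXn // mulr_natl.
have p0 := prime_gt0 pp.
by rewrite ler_ln ?posrE ?ltr0n ?expn_gt0 // ler_nat ltnW.
Qed.

Lemma dyadic_cover N : (2 <= N)%N -> exists k,
  (N <= 2 ^ k.+1)%N /\ k.+1%:R * ln 2 <= 2 * ln N%:R :> R.
Proof.
move=> N2; exists (trunc_log 2 N); split; first by apply/ltnW/trunc_log_ltn.
have N0 : (0 < N)%N by rewrite (leq_trans _ N2).
have h : (2 ^ trunc_log 2 N <= N)%N by apply: trunc_logP.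
have : ln (2 ^ trunc_log 2 N)%:R <= ln N%:R :> R.
  by rewrite ler_ln ?posrE ?ltr0n ?expn_gt0 // ler_nat.
rewrite natrX lnXn // -[_ *+ _]mulr_natl => h1.
have h2 : ln 2 <= ln N%:R :> R by rewrite ler_ln ?posrE ?ltr0n // ler_nat.
rewrite -[_.+1%:R]natr1; lra.
Qed.

Lemma sum_prime_le (F : nat -> R) N N' : (forall p, prime p -> 0 <= F p) ->
  (N <= N')%N -> \sum_(0 <= p < N | prime p) F p <= \sum_(0 <= p < N' | prime p) F p.
Proof.
move=> F0 NN; rewrite (big_cat_nat _ (n := N) (p := N')) //= lerDl.
exact: sumr_ge0.
Qed.

Lemma mertens_log N : (2 <= N)%N ->
  \sum_(0 <= p < N.+1 | prime p) ln p%:R / p%:R <= 4 * ln N%:R :> R.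
Proof.
move=> N2; have [k [Nk hk]] := dyadic_cover N2.
apply: (@le_trans _ _ (k.+1%:R * ln 4)); last by rewrite ln4E; lra.
apply: le_trans (sum_log_dyadic k.+1); apply: sum_prime_le; last by rewrite ltnS.
by move=> p pp; rewrite divr_ge0 ?ln_ge0 ?ler1n ?prime_gt0.
Qed.

Lemma mertens_recip N : (2 <= N)%N ->
  \sum_(0 <= p < N.+1 | prime p) (p%:R)^-1 <= 9 + 2 * ln (ln N%:R) :> R.
Proof.
move=> N2; have [k [Nk hk]] := dyadic_cover N2.
have h2 := ln2_ge_half.
have lN : 0 < ln N%:R :> R by rewrite ln_gt0 // ltr1n.
have kN : k.+1%:R <= 4 * ln N%:R :> R.
  have : 0 <= k.+1%:R :> R by []. 
  nra.
have : ln k.+1%:R <= ln (4 * ln N%:R) :> R.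
  by rewrite ler_ln ?posrE ?mulr_gt0.
rewrite lnM ?posrE // => h3.
have h4 : ln 4 <= 3 :> R.
  by have := @le_ln1Dx R 3; rewrite (_ : 1 + 3 = 4 :> R); [apply; lra|lra].
apply: (@le_trans _ _ (3 + 2 * ln k.+1%:R)); last by lra.
apply: le_trans (sum_recip_dyadic k); apply: sum_prime_le; last by rewrite ltnS.
by move=> p pp; rewrite invr_ge0.
Qed.

End MertensBounds.

(** * Real powers and logarithms *)

Section RealBounds.
Variable R : realType.
Implicit Types a t v w x y : R.

Lemma powR_exp x a : 0 < x -> x `^ a = expR (a * ln x).
Proof. by move=> x0; rewrite /powR gt_eqF. Qed.

Lemma powR_ge1 x a : 1 <= x -> 0 <= a -> 1 <= x `^ a.
Proof. by move=> x1 a0; rewrite -(powRr0 x) ler_powR. Qed.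

Lemma ln_le_powR a x : 0 < a -> 0 < x -> a * ln x <= x `^ a.
Proof.
move=> a0 x0; rewrite powR_exp //; apply: le_trans (expR_ge1Dx _).
by rewrite lerDr.
Qed.

Lemma ln1D_ge v : 0 <= v -> v / (1 + v) <= ln (1 + v).
Proof.
move=> v0; have v1 : 0 < 1 + v by lra.
have e : 1 + - (v / (1 + v)) = (1 + v)^-1 by field; rewrite gt_eqF.
have h : - 1 < - (v / (1 + v)).
  by rewrite ltrN2 ltr_pdivrMr // mul1r; lra.
have := le_ln1Dx h; rewrite e lnV ?posrE //; lra.
Qed.

Lemma expR_taylor w : `|expR w - 1 - w| <= w ^+ 2 * expR `|w|.
Proof.
have h0 := expR_ge1Dx w; have hN := expR_ge1Dx (- w).
rewrite ger0_norm; last by lra.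
have e0 := expR_gt0 w.
have := expRxMexpNx_1 w; set e := expR w in h0 e0 *; set e' := expR (- w) in hN *.
move=> ee.
have [w0|w0] := leP 0 w.
  rewrite ger0_norm // -/e.
  have h1 : e - 1 <= w * e.
    have : e * (1 - w) <= 1 by rewrite -[leRHS]ee ler_wpM2l // ltW.
    nra.
  nra.
have h1 : 1 <= expR `|w| by rewrite -(expR0 R) ler_expR.
apply: (@le_trans _ _ (w ^+ 2)); last by have := sqr_ge0 w; nra.
have : e * (1 - w) <= 1 by rewrite -[leRHS]ee ler_wpM2l // ltW.
nra.
Qed.

Lemma powR1D_taylor a v : 0 <= v <= 1 ->
  `|(1 + v) `^ a - 1 - a * v| <= (a ^+ 2 * expR `|a| + `|a|) * v ^+ 2.
Proof.
move=> /andP[v0 v1]; have v10 : 0 < 1 + v by lra.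
have l1 : ln (1 + v) <= v by apply: le_ln1Dx; lra.
have l0 : 0 <= ln (1 + v) by rewrite ln_ge0 // lerDl.
have l2 : v - v ^+ 2 <= ln (1 + v).
  apply: le_trans (ln1D_ge v0); rewrite ler_pdivlMr //.
  have : 0 <= v ^+ 3 by rewrite exprn_ge0.
  have -> : (v - v ^+ 2) * (1 + v) = v - v ^+ 3 by ring.
  lra.
rewrite powR_exp //; set l := ln (1 + v) in l0 l1 l2 *; set w := a * l.
have -> : expR w - 1 - a * v = (expR w - 1 - w) + a * (l - v) by rewrite /w; ring.
apply: le_trans (ler_normD _ _) _; rewrite mulrDl; apply: lerD.
  apply: le_trans (expR_taylor w) _.
  have -> : a ^+ 2 * expR `|a| * v ^+ 2 = (a * v) ^+ 2 * expR `|a| by ring.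
  apply: ler_pM; rewrite ?sqr_ge0 ?expR_ge0 //.
    rewrite /w !exprMn ler_wpM2l ?sqr_ge0 // lerXn2r ?nnegrE //.
  rewrite ler_expR /w normrM ler_piMr // ger0_norm //; lra.
rewrite normrM ler_wpM2l // ler_norml; apply/andP; split; lra.
Qed.

(** Second order Taylor expansion of [t ^ a] over a step of length at most one,
    obtained by scaling from the expansion at [1]. *)
Lemma powR_increment a : exists2 C : R, 0 <= C & forall t h, 1 <= t -> 0 <= h <= 1 ->
  `|(t + h) `^ a - t `^ a - a * h * t `^ (a - 1)| <= C * t `^ (a - 2).
Proof.
exists (a ^+ 2 * expR `|a| + `|a|).
  by rewrite addr_ge0 // mulr_ge0 ?sqr_ge0 ?expR_ge0.
move=> t h t1 /andP[h0 h1]; have t0 : 0 < t by apply: lt_le_trans t1.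
set v := h / t.
have v01 : 0 <= v <= 1.
  rewrite /v divr_ge0 ?(ltW t0) //= ler_pdivrMr // mul1r; exact: le_trans t1.
have tn : t != 0 by rewrite gt_eqF.
have e1 : t `^ (a - 1) = t `^ a / t by rewrite powRB ?tn ?implybT // powRr1 // ltW.
have e2 : t `^ (a - 2) = t `^ a / t ^+ 2.
  by rewrite powRB ?tn ?implybT // powR_mulrn // ltW.
have -> : (t + h) `^ a - t `^ a - a * h * t `^ (a - 1) =
    t `^ a * ((1 + v) `^ a - 1 - a * v).
  have -> : t + h = t * (1 + v) by rewrite /v; field.
  rewrite powRM ?(ltW t0) //; last by have /andP[? _] := v01; lra.
  by rewrite e1 /v; field.
rewrite normrM ger0_norm ?powR_ge0 //.
apply: le_trans (ler_wpM2l (powR_ge0 _ _) (powR1D_taylor a v01)) _.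
rewrite mulrCA ler_wpM2l //; first by rewrite addr_ge0 // mulr_ge0 ?sqr_ge0 ?expR_ge0.
rewrite e2 ler_wpM2l ?powR_ge0 // /v expr_div_n ler_piMl ?invr_ge0 ?exprn_ge0 ?(ltW t0) //.
by rewrite expr_le1.
Qed.

Lemma powR_increment1 a : exists2 C : R, 0 <= C & forall t h, 1 <= t -> 0 <= h <= 1 ->
  `|(t + h) `^ a - t `^ a| <= C * t `^ (a - 1).
Proof.
have [C C0 HC] := powR_increment a; exists (C + `|a|) => [|t h t1 h01].
  exact: addr_ge0.
have := HC t h t1 h01 => H.
have -> : (t + h) `^ a - t `^ a =
  ((t + h) `^ a - t `^ a - a * h * t `^ (a - 1)) + a * h * t `^ (a - 1) by ring.
apply: le_trans (ler_normD _ _) _; rewrite mulrDl; apply: lerD.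
  apply: le_trans H _; rewrite ler_wpM2l // ler_powR //; lra.
rewrite !normrM (ger0_norm (powR_ge0 _ _)) ler_wpM2r ?powR_ge0 //.
by have /andP[h0 h1] := h01; rewrite ler_piMr // ger0_norm.
Qed.

(** Telescoping with [k ^ a - (k - 1) ^ a >= a / (1 + a) * k ^ (a - 1)]. *)
Lemma sum_powR_le a n : 0 < a ->
  \sum_(1 <= k < n.+1) k%:R `^ (a - 1) <= (1 + a) / a * n%:R `^ a.
Proof.
move=> a0; elim: n => [|n IH].
  by rewrite big_geq // powR0 ?gt_eqF // mulr0.
rewrite big_nat_recr //=; apply: le_trans (lerD IH (lexx _)) _.
have c0 : 0 < (1 + a) / a by rewrite divr_gt0 // addr_gt0.
rewrite -lerBrDl -mulrBr -ler_pdivrMl // invf_div.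
have n0 : 0 < n.+1%:R :> R by [].
set x := n.+1%:R in n0 *.
have xn : x != 0 by rewrite gt_eqF.
have e1 : x `^ (a - 1) = x `^ a * x^-1 by rewrite powRB ?xn ?implybT // powRr1 // ltW.
have -> : n%:R `^ a = x `^ a * (1 - x^-1) `^ a.
  rewrite -powRM ?(ltW n0) //; last by rewrite subr_ge0 invf_le1 // ler1n.
  by rewrite mulrBr mulfV // mulr1 /x -natr1 addrK.
rewrite e1 -[X in _ <= X - _]mulr1 -mulrBr mulrCA ler_wpM2l ?powR_ge0 //.
have x1 : 1 <= x by rewrite ler1n.
have v1 : x^-1 <= 1 by rewrite invf_le1.
have v0 : 0 < x^-1 by rewrite invr_gt0.
set v := x^-1 in v0 v1 *.
have av : 0 < 1 + a * v by rewrite addr_gt0 // mulr_gt0.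
suff h : (1 - v) `^ a <= (1 + a * v)^-1.
  apply: (@le_trans _ _ (1 - (1 + a * v)^-1)); last by lra.
  have -> : 1 - (1 + a * v)^-1 = a * v / (1 + a * v) by field; rewrite gt_eqF.
  rewrite mulrAC ler_wpM2l ?mulr_ge0 ?(ltW a0) ?(ltW v0) //.
  by rewrite lef_pV2 ?posrE ?(addr_gt0 ltr01 a0) // lerD2l ler_piMr // ltW.
have [->|vn] := eqVneq v 1.
  by rewrite subrr powR0 ?gt_eqF // mulr1 invr_ge0 addr_ge0 // ltW.
have v2 : 0 < 1 - v by rewrite subr_gt0 lt_neqAle vn.
rewrite powR_exp // -[leLHS]invrK -expRN lef_pV2 ?posrE ?expR_gt0 //.
apply: le_trans (expR_ge1Dx _); rewrite lerD2l -mulrN ler_wpM2l ?(ltW a0) //.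
by rewrite lerNr; apply: le_ln1Dx; rewrite ltrN2; lra.
Qed.

Lemma sum_powRN_le a n : 0 < a ->
  \sum_(1 <= k < n.+1) k%:R `^ (- 1 - a) <= 1 + a^-1.
Proof.
move=> a0; suff : \sum_(1 <= k < n.+2) k%:R `^ (- 1 - a) <=
    1 + a^-1 * (1 - n.+1%:R `^ (- a)).
  case: n => [_|n H]; first by rewrite big_geq // addr_ge0 // invr_ge0 ltW.
  rewrite big_nat_recr //= in H; apply: le_trans (le_trans _ H) _.
    by rewrite lerDl powR_ge0.
  rewrite lerD2l ler_piMr ?invr_ge0 ?(ltW a0) //.
elim: n => [|n IH].
  by rewrite big_nat1 !powR1 subrr mulr0 addr0.
rewrite big_nat_recr //=; apply: le_trans (lerD IH (lexx _)) _.
rewrite -addrA lerD2l -lerBrDl -mulrBr -ler_pdivrMl ?invr_gt0 // invrK.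
have n0 : 0 < n.+2%:R :> R by [].
have n10 : 0 < n.+1%:R :> R by [].
set x := n.+2%:R in n0 *; set y := n.+1%:R in n10 *.
have xy : x = y + 1 by rewrite /x /y natr1.
have xn : x != 0 by rewrite gt_eqF.
have -> : 1 - x `^ (- a) - (1 - y `^ (- a)) = y `^ (- a) - x `^ (- a) by ring.
have -> : x `^ (- 1 - a) = x `^ (- a) * x^-1.
  by rewrite addrC powRB ?xn ?implybT // powRr1 // ltW.
have -> : y `^ (- a) = x `^ (- a) * (y / x) `^ (- a).
  rewrite -powRM ?divr_ge0 ?(ltW n0) ?(ltW n10) //; congr (_ `^ _).
  by rewrite mulrCA mulfV ?mulr1.
rewrite -[X in _ <= _ - X]mulr1 -mulrBr mulrCA ler_wpM2l ?powR_ge0 //.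
have y1 : 0 < y / x by rewrite divr_gt0.
rewrite lerBrDl powR_exp //; apply: le_trans (expR_ge1Dx _); rewrite lerD2l mulNr -mulrN.
rewrite ler_wpM2l ?(ltW a0) // lerNr.
have -> : y / x = 1 + - x^-1.
  by apply: (mulIf xn); rewrite mulrDl mul1r mulNr mulVf ?divfK // xy addrK.
by apply: le_ln1Dx; rewrite ltrN2 invf_lt1 // ltr1n.
Qed.

Lemma ln1_mono x y : 1 <= x -> x <= y -> 1 + ln y <= (1 + ln x) * (y / x).
Proof.
move=> x1 xy; have x0 : 0 < x by apply: lt_le_trans x1.
have y0 : 0 < y by apply: lt_le_trans xy.
have u0 : 0 < y / x by rewrite divr_gt0.
have h1 : ln y = ln x + ln (y / x) by rewrite ln_div ?posrE // addrC subrK.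
have h2 : ln (y / x) <= y / x - 1.
  by have := @le_ln1Dx R (y / x - 1); rewrite addrCA subrr addr0; apply; lra.
have h3 : 0 <= ln x by rewrite ln_ge0.
have h4 : 1 <= y / x by rewrite ler_pdivlMr ?mul1r.
rewrite h1; nra.
Qed.

(** By [ln1_mono] the factor [1 + ln] grows at most linearly, and [A <= a]. *)
Lemma powR_ln_mono a A x y : 0 <= A <= a -> 1 <= x -> x <= y ->
  x `^ a / (1 + ln x) `^ A <= y `^ a / (1 + ln y) `^ A.
Proof.
move=> /andP[A0 Aa] x1 xy.
have x0 : 0 < x by apply: lt_le_trans x1.
have y0 : 0 < y by apply: lt_le_trans xy.
have lx : 0 < 1 + ln x by rewrite ltr_wpDr ?ln_ge0.
have ly : 0 < 1 + ln y by rewrite ltr_wpDr ?ln_ge0 // (le_trans x1).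
rewrite ler_pdivrMr ?powR_gt0 // mulrAC ler_pdivlMr ?powR_gt0 //.
have h4 : 1 <= y / x by rewrite ler_pdivlMr ?mul1r.
have h : (1 + ln y) `^ A <= (1 + ln x) `^ A * (y / x) `^ a.
  apply: (@le_trans _ _ (((1 + ln x) * (y / x)) `^ A)).
    by apply: ge0_ler_powR; rewrite ?nnegrE ?(ltW ly) ?(mulr_ge0 (ltW lx) (ltW _)) ?divr_gt0 // ln1_mono.
  rewrite powRM ?(ltW lx) ?divr_ge0 ?(ltW x0) ?(ltW y0) //.
  by rewrite ler_wpM2l ?powR_ge0 // ler_powR.
apply: le_trans (ler_wpM2l (powR_ge0 _ _) h) _.
rewrite mulrCA -powRM ?divr_ge0 ?(ltW x0) ?(ltW y0) // mulrCA mulfV ?gt_eqF // mulr1 mulrC.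
by [].
Qed.

End RealBounds.

(** * Prime sums of the weight by partial summation *)

Section ThetaAsymptotics.
Variables (R : realType) (alpha : nat -> R) (A0 beta sigma L : R).
Hypothesis A0_gt0 : 0 < A0.
Hypothesis beta_gt0 : 0 < beta.
Hypothesis sigma_gt0 : 0 < sigma.
Hypothesis alpha_primes : forall x : R, 2 <= x ->
  `| \sum_(0 <= p < (Num.truncn x).+1 | prime p)
        alpha p * ln p%:R / p%:R `^ (sigma - 1) - beta * x |
    <= L * (x / (ln x) `^ A0).

Definition theta (n : nat) : R :=
  \sum_(0 <= p < n.+1 | prime p) alpha p * ln p%:R.

(** The saving exponent is capped so that [error_gauge] is nondecreasing. *)
Definition saving : R := Num.min (Num.min A0 (sigma / 2)) 1.
Notation A := saving.

Lemma saving_bounds : [/\ 0 < A, A <= A0, A <= sigma / 2 & A <= 1].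
Proof.
split.
- by rewrite !lt_min A0_gt0 ltr01 divr_gt0.
- by rewrite !ge_min lexx.
- by rewrite !ge_min lexx orbT.
- by rewrite ge_min lexx orbT.
Qed.

Definition error_gauge (y : R) : R := y `^ sigma / (1 + ln y) `^ A.

Lemma ln1_gt0 (y : R) : 1 <= y -> 0 < 1 + ln y.
Proof. by move=> y1; rewrite ltr_wpDr ?ln_ge0. Qed.

Lemma gauge_ge0 (y : R) : 0 <= error_gauge y.
Proof. by rewrite divr_ge0 ?powR_ge0. Qed.

Lemma gauge_mono (x y : R) : 1 <= x -> x <= y -> error_gauge x <= error_gauge y.
Proof.
move=> x1 xy; have [A_gt0 _ A2 _] := saving_bounds.
apply: powR_ln_mono => //; rewrite (ltW A_gt0) /= (le_trans A2) // ler_pdivrMr //.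
have := sigma_gt0; lra.
Qed.

Lemma ln1_powR_le (y : R) : 1 <= y -> (1 + ln y) `^ A <= y.
Proof.
move=> y1; have [A_gt0 _ _ A1] := saving_bounds.
have h : 1 + ln y <= y.
  have y0 : 0 < y by apply: lt_le_trans y1.
  by have := @le_ln1Dx R (y - 1); rewrite addrCA subrr addr0 => h; have := h _; lra.
apply: le_trans (ler1_powR _ A1) _ => //.
by rewrite lerDl ln_ge0.
Qed.

Let err (n : nat) : R :=
  \sum_(0 <= p < n.+1 | prime p) alpha p * ln p%:R / p%:R `^ (sigma - 1) - beta * n%:R.

Let err_le : exists2 C : R, 0 <= C & forall n, (0 < n)%N ->
  `|err n| <= C * (n%:R / (1 + ln n%:R) `^ A).
Proof.
have [A_gt0 AA0 _ _] := saving_bounds.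
pose C := `|L| * 3 `^ A0 + beta.
exists C => [|n n0]; first by rewrite addr_ge0 ?mulr_ge0 ?powR_ge0 // ltW.
have n1 : 1 <= n%:R :> R by rewrite ler1n.
have l0 := ln1_gt0 n1.
have := n0; rewrite leq_eqVlt => /orP[/eqP <-|n2].
  rewrite ln1 addr0 powR1 divr1 mulr1 /err big_ltn_cond //= big_ltn_cond // big_geq //=.
  rewrite add0r mulr1 normrN ger0_norm ?(ltW beta_gt0) // /C lerDr.
  by rewrite mulr_ge0 // powR_ge0.
have x2 : 2 <= n%:R :> R by rewrite ler_nat.
have := alpha_primes x2; rewrite natrK -/(err n) => h.
have ln0 : 0 < ln n%:R :> R by rewrite ln_gt0 // ltr1n.
apply: le_trans h _.
have ln2n : 2^-1 <= ln n%:R :> R.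
  by apply: le_trans (ln2_ge_half R) _; rewrite ler_ln ?posrE ?ltr0n.
have key : (1 + ln n%:R) `^ A <= 3 `^ A0 * (ln n%:R) `^ A0 :> R.
  apply: (@le_trans _ _ ((1 + ln n%:R) `^ A0)).
    by rewrite ler_powR // lerDl ltW.
  rewrite -powRM ?(ltW ln0) //; apply: ge0_ler_powR; rewrite ?nnegrE ?(ltW A0_gt0) ?(ltW l0) //.
    by rewrite mulr_ge0 // ltW.
  lra.
apply: (@le_trans _ _ (`|L| * (n%:R / ln n%:R `^ A0))).
  by rewrite ler_wpM2r ?divr_ge0 ?powR_ge0 // ler_norm.
apply: (@le_trans _ _ (`|L| * 3 `^ A0 * (n%:R / (1 + ln n%:R) `^ A))); last first.
  by rewrite ler_wpM2r ?divr_ge0 ?powR_ge0 // lerDl ltW.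
rewrite -mulrA ler_wpM2l // mulrCA ler_wpM2l //.
by rewrite ler_pdivlMr ?powR_gt0 // mulrC ler_pdivrMr ?powR_gt0.
Qed.

Let sum_gauge n : \sum_(1 <= k < n.+1) k%:R `^ (sigma - 1) / (1 + ln k%:R) `^ A <=
  (1 + sigma / 2) / (sigma / 2) * error_gauge n%:R.
Proof.
have [A_gt0 _ A2 A1] := saving_bounds.
have s2 : 0 < sigma / 2 by rewrite divr_gt0.
pose W' (y : R) := y `^ (sigma / 2) / (1 + ln y) `^ A.
apply: (@le_trans _ _ (\sum_(1 <= k < n.+1) k%:R `^ (sigma / 2 - 1) * W' n%:R)).
  rewrite big_nat_cond [leRHS]big_nat_cond; apply: ler_sum => k /andP[/andP[k1 kn] _].
  have k0 : (k%:R : R) != 0 by rewrite pnatr_eq0 -lt0n.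
  have -> : sigma - 1 = (sigma / 2 - 1) + sigma / 2 by field.
  rewrite powRD ?k0 ?implybT // -mulrA ler_wpM2l ?powR_ge0 //.
  apply: powR_ln_mono; rewrite ?ler1n ?ler_nat //; first by rewrite (ltW A_gt0).
rewrite -mulr_suml; apply: le_trans (ler_wpM2r _ (sum_powR_le n s2)) _.
  by rewrite divr_ge0 ?powR_ge0.
rewrite -[leLHS]mulrA ler_wpM2l ?divr_ge0 ?addr_ge0 ?(ltW s2) ?(ltW sigma_gt0) //.
rewrite mulrA -powRD; last by rewrite gt_eqF // addr_gt0.
by rewrite -splitr.
Qed.

(** Abel summation against the error term of the prime sum. *)
Let abel n : theta n.+1 = n.+1%:R `^ (sigma - 1) * err n.+1
  - \sum_(1 <= k < n.+1) err k * (k.+1%:R `^ (sigma - 1) - k%:R `^ (sigma - 1))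
  + beta * \sum_(1 <= k < n.+2) k%:R `^ (sigma - 1).
Proof.
have th0 : theta 0 = 0 by rewrite /theta big_ltn_cond //= big_geq.
have er0 : err 0 = 0 by rewrite /err big_ltn_cond //= big_geq // mulr0 subrr.
have step k : theta k.+1 = theta k + k.+1%:R `^ (sigma - 1) * (err k.+1 - err k + beta).
  rewrite /theta /err [in LHS]big_mkcond big_nat_recr //= -big_mkcond /=.
  rewrite [X in X - beta * k.+1%:R]big_mkcond big_nat_recr //= -big_mkcond /=.
  congr (_ + _); set x := \sum_(_ <= _ < _ | _) _; rewrite -natr1.
  have -> : forall u, x + u - beta * (k%:R + 1) - (x - beta * k%:R) + beta = u by move=> u; ring.
  case: ifP => _; last by rewrite mulr0.
  by rewrite mulrCA mulfV ?mulr1 // gt_eqF // powR_gt0 // natr1.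
elim: n => [|n IH].
  by rewrite step th0 er0 big_geq // big_nat1; ring.
rewrite step IH [\sum_(1 <= k < n.+3) _]big_nat_recr //=.
rewrite [\sum_(1 <= k < n.+2) err k * _]big_nat_recr //=.
ring.
Qed.

Let sum_powR_asymp : exists2 C : R, 0 <= C & forall n, (0 < n)%N ->
  `|sigma * (\sum_(1 <= k < n.+1) k%:R `^ (sigma - 1)) - n%:R `^ sigma| <= C * error_gauge n%:R.
Proof.
have [A_gt0 _ A2 A1] := saving_bounds.
have [C C0 HC] := powR_increment sigma.
pose D := (1 + sigma / 2) / (sigma / 2).
have D0 : 0 <= D.
  by rewrite divr_ge0 ?addr_ge0 // divr_ge0 // ltW.
exists (C * D + sigma + 1) => [|n n0].
  exact: addr_ge0 (addr_ge0 (mulr_ge0 C0 D0) (ltW sigma_gt0)) ler01.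
have wn k : (0 < k)%N -> k%:R `^ (sigma - 1) <= error_gauge k%:R.
  move=> k0; have k1 : 1 <= k%:R :> R by rewrite ler1n.
  have kn : k%:R != 0 :> R by rewrite pnatr_eq0 -lt0n.
  rewrite /error_gauge powRB ?kn ?implybT // powRr1 // ler_wpM2l ?powR_ge0 //.
  by rewrite lef_pV2 ?posrE ?powR_gt0 ?ln1_gt0 ?ltr0n // ln1_powR_le.
have w1 k : (0 < k)%N -> 1 <= error_gauge k%:R.
  move=> k0; have k1 : 1 <= k%:R :> R by rewrite ler1n.
  have := @gauge_mono 1 k%:R (lexx _) k1.
  by rewrite {1}/error_gauge powR1 ln1 addr0 powR1 divr1.
case: n n0 => // n _.
have -> : n.+1%:R `^ sigma = 1 + \sum_(1 <= k < n.+1) (k.+1%:R `^ sigma - k%:R `^ sigma) :> R.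
  rewrite telescope_sumr // powR1; ring.
rewrite big_nat_recr //= mulrDr mulr_sumr.
set a := \sum_(_ <= _ < _) _; set b := \sum_(_ <= _ < _) _.
have -> : a + sigma * n.+1%:R `^ (sigma - 1) - (1 + b) =
  - (b - a) + sigma * n.+1%:R `^ (sigma - 1) - 1 by ring.
apply: le_trans (ler_normB _ _) _; rewrite normr1 !mulrDl mul1r; apply: lerD; last exact: w1.
apply: le_trans (ler_normD _ _) _; apply: lerD; last first.
  by rewrite ger0_norm ?mulr_ge0 ?powR_ge0 ?(ltW sigma_gt0) // ler_wpM2l ?(ltW sigma_gt0) // wn.
rewrite normrN /a /b -sumrB; apply: le_trans (ler_norm_sum _ _ _) _.
rewrite -mulrA; apply: le_trans (_ : C * (D * error_gauge n%:R) <= _); last first.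
  rewrite !ler_wpM2l // ; case: (n) => [|k].
    by rewrite /error_gauge powR0 ?gt_eqF // mul0r gauge_ge0.
  by apply: gauge_mono; rewrite ?ler1n ?ler_nat.
apply: le_trans (ler_wpM2l C0 (sum_gauge n)).
rewrite mulr_sumr big_nat_cond [leRHS]big_nat_cond; apply: ler_sum => k /andP[/andP[k1 kn] _].
have k1' : 1 <= k%:R :> R by rewrite ler1n.
have k0 : k%:R != 0 :> R by rewrite pnatr_eq0 -lt0n.
have := @HC k%:R 1 k1'; rewrite ler01 lexx => /(_ isT).
rewrite natr1 mulr1 => /le_trans; apply.
rewrite ler_wpM2l //.
have -> : sigma - 2 = sigma - 1 - 1 by ring.
rewrite [leLHS]powRB ?k0 ?implybT // powRr1 // ler_wpM2l ?powR_ge0 //.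
by rewrite lef_pV2 ?posrE ?powR_gt0 ?ln1_gt0 ?ltr0n // ln1_powR_le.
Qed.

(** The prime number estimate, transported by partial summation from
    [alpha p / p ^ (sigma - 1)] to [alpha p]. *)
Lemma theta_asymp : exists2 C : R, 0 <= C & forall y : R, 1 <= y ->
  `|theta (Num.truncn y) - beta / sigma * y `^ sigma| <= C * error_gauge y.
Proof.
have [Ce Ce0 HCe] := err_le.
have [Cs Cs0 HCs] := sum_powR_asymp.
have [Ci Ci0 HCi] := powR_increment1 (sigma - 1).
have [Cy Cy0 HCy] := powR_increment1 sigma.
pose D := (1 + sigma / 2) / (sigma / 2).
have D0 : 0 <= D by rewrite divr_ge0 ?addr_ge0 // divr_ge0 // ltW.
pose kappa := beta / sigma.
have kappa0 : 0 <= kappa by rewrite divr_ge0 ?ltW.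
pose C := (Ce + Ce * Ci * D + kappa * Cs) + kappa * Cy.
exists C => [|y y1].
  exact: addr_ge0 (addr_ge0 (addr_ge0 Ce0 (mulr_ge0 (mulr_ge0 Ce0 Ci0) D0))
    (mulr_ge0 kappa0 Cs0)) (mulr_ge0 kappa0 Cy0).
have y0 : 0 <= y by apply: le_trans y1.
have := truncn_itv y0; set n := Num.truncn y => /andP[ny yn].
have n0 : (0 < n)%N by rewrite truncn_gt0.
have n1 : 1 <= n%:R :> R by rewrite ler1n.
have wny : error_gauge n%:R <= error_gauge y by exact: gauge_mono.
have -> : theta n - beta / sigma * y `^ sigma =
  (theta n - kappa * n%:R `^ sigma) - kappa * (y `^ sigma - n%:R `^ sigma) by rewrite /kappa; ring.
apply: le_trans (ler_normB _ _) _; rewrite mulrDl; apply: lerD; last first.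
  rewrite normrM (ger0_norm kappa0) -mulrA ler_wpM2l //.
  have yE : y = n%:R + (y - n%:R) by ring.
  have h01 : 0 <= y - n%:R <= 1.
    rewrite subr_ge0 ny /= lerBlDr addrC natr1; exact: ltW.
  have := HCy _ _ n1 h01; rewrite -yE => /le_trans; apply.
  rewrite ler_wpM2l //; apply: le_trans wny.
  have nn : n%:R != 0 :> R by rewrite pnatr_eq0 -lt0n.
  rewrite /error_gauge powRB ?nn ?implybT // powRr1 // ler_wpM2l ?powR_ge0 //.
  by rewrite lef_pV2 ?posrE ?powR_gt0 ?ln1_gt0 ?ltr0n // ln1_powR_le.
apply: le_trans (_ : (Ce + Ce * Ci * D + kappa * Cs) * error_gauge n%:R <= _); last first.
  apply: ler_wpM2l wny.
  exact: addr_ge0 (addr_ge0 Ce0 (mulr_ge0 (mulr_ge0 Ce0 Ci0) D0)) (mulr_ge0 kappa0 Cs0).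
rewrite -(prednK n0) in n1 *; move: (n.-1) n1 => k k1 {n0 ny yn wny}.
rewrite abel; set e := err _; set S2 := \sum_(_ <= _ < _) _; set S1 := \sum_(_ <= _ < _) _.
have -> : k.+1%:R `^ (sigma - 1) * e - S1 + beta * S2 - kappa * k.+1%:R `^ sigma =
  (k.+1%:R `^ (sigma - 1) * e - S1) + kappa * (sigma * S2 - k.+1%:R `^ sigma).
  by rewrite /kappa; field; rewrite gt_eqF.
apply: le_trans (ler_normD _ _) _; rewrite mulrDl; apply: lerD; last first.
  by rewrite normrM (ger0_norm kappa0) -mulrA ler_wpM2l // HCs.
apply: le_trans (ler_normB _ _) _; rewrite mulrDl; apply: lerD.
  rewrite normrM (ger0_norm (powR_ge0 _ _)).
  apply: le_trans (ler_wpM2l (powR_ge0 _ _) (HCe k.+1 isT)) _.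
  rewrite mulrCA ler_wpM2l // mulrA ler_wpM2r ?invr_ge0 ?powR_ge0 //.
  by rewrite mulrC mulr_powRB1.
apply: le_trans (ler_norm_sum _ _ _) _.
apply: le_trans (_ : Ce * Ci * (D * error_gauge k%:R) <= _); last first.
  rewrite -[leRHS]mulrA; apply: ler_wpM2l (mulr_ge0 Ce0 Ci0) _ _ _.
  apply: ler_wpM2l D0 _ _ _; case: (k) => [|l].
    by rewrite /error_gauge powR0 ?gt_eqF // mul0r gauge_ge0.
  by apply: gauge_mono; rewrite ?ler1n ?ler_nat.
apply: le_trans (ler_wpM2l _ (sum_gauge k)); last exact: mulr_ge0.
rewrite mulr_sumr big_nat_cond [leRHS]big_nat_cond; apply: ler_sum => l /andP[/andP[l1 lk] _].
have l1' : 1 <= l%:R :> R by rewrite ler1n.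
have l0 : l%:R != 0 :> R by rewrite pnatr_eq0 -lt0n.
have := @HCi l%:R 1 l1'; rewrite ler01 lexx => /(_ isT); rewrite natr1 => h.
rewrite normrM; apply: le_trans (ler_pM _ _ (HCe l l1) h) _ => //.
rewrite mulrACA ler_wpM2l ?mulr_ge0 //.
rewrite mulrAC ler_wpM2r ?invr_ge0 ?powR_ge0 //.
by rewrite powRB ?l0 ?implybT // powRr1 // mulrCA mulfV // mulr1.
Qed.

End ThetaAsymptotics.

(** * Convolution identities for the logarithmic sum *)

Section PadicSplit.
Variables (R : realType) (p : nat).
Hypothesis pp : prime p.

Lemma padic_class (N nu : nat) (F : nat -> R) :
  \sum_(1 <= n < N.+1 | logn p n == nu) F n =
  \sum_(1 <= m < (N %/ p ^ nu).+1 | ~~ (p %| m)%N) F (p ^ nu * m)%N.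
Proof.
have pn0 : (0 < p ^ nu)%N by rewrite expn_gt0 prime_gt0.
rewrite -big_filter -[RHS]big_filter -[RHS](big_map (muln (p ^ nu)) xpredT F).
apply: perm_big; apply: uniq_perm; first exact: filter_uniq (iota_uniq _ _).
  rewrite map_inj_uniq; first exact: filter_uniq (iota_uniq _ _).
  by move=> a b /eqP; rewrite eqn_pmul2l // => /eqP.
move=> n; rewrite mem_filter mem_index_iota; apply/idP/mapP.
  move=> /andP[/eqP ln /andP[n1 nN]]; exists (n %/ p ^ nu)%N; last first.
    by rewrite mulnC divnK // -ln pfactor_dvdnn.
  have dn : (p ^ nu %| n)%N by rewrite -ln pfactor_dvdnn.
  rewrite mem_filter mem_index_iota ltnS leq_div2r // divn_gt0 // dvdn_leq // andbT.
  apply/andP; split => //; apply/negP => pd.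
  have : (p ^ nu.+1 %| n)%N by rewrite -(divnK dn) expnS dvdn_mul.
  by rewrite pfactor_dvdn // ln ltnn.
case=> m; rewrite mem_filter mem_index_iota => /andP[pm /andP[m1 mN]] ->.
have h : (p ^ nu * m <= N)%N by rewrite mulnC -leq_divRL // -ltnS.
rewrite lognM // pfactorK // ltnS h muln_gt0 m1 pn0 /=.
by rewrite logn_coprime ?addn0 ?eqxx // prime_coprime.
Qed.

(** Sorting the integers up to [N] by their exact power of [p]. *)
Lemma padic_split (N K : nat) (F : nat -> R) : (N < p ^ K)%N ->
  \sum_(1 <= n < N.+1) F n =
  \sum_(0 <= nu < K) \sum_(1 <= m < (N %/ p ^ nu).+1 | ~~ (p %| m)%N) F (p ^ nu * m)%N.
Proof.
move=> NK; under [RHS]eq_bigr => nu _ do rewrite -padic_class.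
rewrite big_mkord; under [RHS]eq_bigr => nu _ do rewrite big_mkcond.
rewrite exchange_big [LHS]big_nat_cond [RHS]big_nat_cond /=.
apply: eq_bigr => n /andP[/andP[n1 nN] _].
have lK : (logn p n < K)%N.
  rewrite -(ltn_exp2l _ _ (prime_gt1 pp)); apply: leq_ltn_trans NK.
  by apply: leq_trans (_ : (n <= _)%N); rewrite // dvdn_leq // pfactor_dvdnn.
rewrite -big_mkcond (big_pred1 (Ordinal lK)) //.
Qed.

End PadicSplit.

Lemma ln_prime_decomp (R : realType) (n N : nat) : (0 < n)%N -> (n <= N)%N ->
  ln n%:R = \sum_(0 <= p < N.+1 | prime p) (logn p n)%:R * ln p%:R :> R.
Proof.
move=> n0 nN.
rewrite -{1}(partnT n0) (widen_partn _ nN).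
have -> : (\prod_(0 <= p < N.+1 | p \in predT) p ^ logn p n =
    \prod_(0 <= p < N.+1 | prime p) p ^ logn p n)%N.
  rewrite big_mkcond [RHS]big_mkcond; apply: eq_bigr => p _.
  by case: ifPn => //= pp; rewrite lognE (negPf pp).
have : forall s : seq nat, ln (\prod_(p <- s | prime p) p ^ logn p n)%N%:R =
    \sum_(p <- s | prime p) (logn p n)%:R * ln p%:R :> R.
  elim=> [|p s IH]; first by rewrite !big_nil ln1.
  rewrite !big_cons; case: ifP => // pp; rewrite natrM lnM ?IH.
  - by rewrite natrX lnXn ?ltr0n ?prime_gt0 // mulr_natl.
  - by rewrite posrE ltr0n expn_gt0 prime_gt0.
  - by rewrite posrE ltr0n prodn_cond_gt0 // => q qp; rewrite expn_gt0 prime_gt0.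
by apply.
Qed.

(** Both sides sum [u d * v m] over the pairs with [d * m <= N]. *)
Lemma hyperbola (R : realType) (N : nat) (P : pred nat) (u v : nat -> R) :
  \sum_(1 <= d < N.+1 | P d) u d * (\sum_(1 <= m < (N %/ d).+1) v m) =
  \sum_(1 <= m < N.+1) v m * (\sum_(1 <= d < (N %/ m).+1 | P d) u d).
Proof.
have widen (w : nat -> R) (Q : pred nat) d : (0 < d)%N ->
  \sum_(1 <= m < (N %/ d).+1 | Q m) w m = \sum_(1 <= m < N.+1 | Q m && (d * m <= N)%N) w m.
  move=> d0; rewrite (big_nat_widen 1 (N %/ d).+1 N.+1) ?ltnS ?leq_div //.
  by apply: eq_bigl => m; rewrite ltnS leq_divRL // mulnC.
transitivity (\sum_(1 <= d < N.+1) \sum_(1 <= m < N.+1)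
    (if P d && (d * m <= N)%N then u d * v m else 0)).
  rewrite big_mkcond big_nat_cond [RHS]big_nat_cond; apply: eq_bigr => d /andP[/andP[d1 _] _].
  case: ifP => Pd /=; last by rewrite big1.
  by rewrite widen // mulr_sumr -big_mkcond.
rewrite exchange_big big_nat_cond [RHS]big_nat_cond; apply: eq_bigr => m /andP[/andP[m1 _] _].
rewrite widen // mulr_sumr [RHS]big_mkcond; apply: eq_bigr => d _.
by rewrite mulnC; case: ifP => // _; rewrite mulrC.
Qed.

Section LogSum.
Variables (R : realType) (alpha : nat -> R).
Hypothesis alpha_ge0 : forall n, (0 < n)%N -> 0 <= alpha n.
Hypothesis alpha_mul : Defs.multiplicative alpha.

Definition coprime_sum (q N : nat) : R := \sum_(1 <= n < N.+1 | coprime n q) alpha n.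

Lemma coprime_sum_ge0 q N : 0 <= coprime_sum q N.
Proof.
by rewrite /coprime_sum big_nat_cond sumr_ge0 // => n /andP[/andP[n1 _] _]; apply: alpha_ge0.
Qed.

Lemma coprime_sum1 N : coprime_sum 1 N = \sum_(1 <= n < N.+1) alpha n.
Proof. by apply: eq_bigl => n; rewrite coprimen1. Qed.

Lemma coprime_sum_split (p q N K : nat) : prime p -> coprime p q -> (N < p ^ K)%N ->
  coprime_sum q N = \sum_(0 <= nu < K) alpha (p ^ nu)%N * coprime_sum (p * q) (N %/ p ^ nu).
Proof.
move=> pp pq NK; rewrite /coprime_sum big_mkcond (padic_split pp _ NK).
apply: eq_bigr => nu _; rewrite mulr_sumr.
rewrite [RHS](eq_bigl (fun m => ~~ (p %| m)%N && coprime m q)); last first.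
  by move=> m; rewrite coprimeMr coprime_sym prime_coprime.
rewrite [RHS]big_mkcondr /= big_nat_cond [RHS]big_nat_cond.
apply: eq_bigr => m /andP[/andP[m1 _] pm].
rewrite coprimeMl coprimeXl //=; case: ifP => // _.
by rewrite alpha_mul.2 // ?expn_gt0 ?prime_gt0 // coprimeXl // prime_coprime.
Qed.

Definition higher_term (p nu : nat) : R :=
  (nu%:R * alpha (p ^ nu)%N + alpha p * alpha (p ^ nu.-1)%N) * ln p%:R.

(** The weighted prime powers neglected when [alpha n * logn p n] is replaced
    by its main term [alpha p] times a sum over the multiples of [p]. *)
Definition higher_sum (K Y : nat) : R :=
  \sum_(0 <= p < K | prime p) \sum_(2 <= nu < K | (p ^ nu <= Y)%N) higher_term p nu.

Let Sn := coprime_sum 1.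

Lemma coprime_sum_le q N : coprime_sum q N <= Sn N.
Proof.
rewrite /Sn coprime_sum1 /coprime_sum [leLHS]big_mkcond big_nat_cond [leRHS]big_nat_cond.
by apply: ler_sum => n /andP[/andP[n1 _] _]; case: ifP => // _; apply: alpha_ge0.
Qed.

Lemma pow_bound p N : prime p -> (N < p ^ N.+2)%N.
Proof.
by move=> pp; apply: ltn_trans (ltn_expl _ (prime_gt1 pp)) _; rewrite ltn_exp2l ?prime_gt1.
Qed.

(** The multiples of [p] are sorted by their exact power of [p]; the term of
    exponent one is compared with the sum without coprimality condition. *)
Lemma local_log_sum p N : prime p ->
  `|\sum_(1 <= n < N.+1) alpha n * (logn p n)%:R - alpha p * Sn (N %/ p)| <=
  \sum_(2 <= nu < N.+3) (nu%:R * alpha (p ^ nu)%N + alpha p * alpha (p ^ nu.-1)%N) *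
     Sn (N %/ p ^ nu).
Proof.
move=> pp; have p0 := prime_gt0 pp.
have ap k : 0 <= alpha (p ^ k)%N by apply: alpha_ge0; rewrite expn_gt0 p0.
pose cp := coprime_sum p.
have -> : \sum_(1 <= n < N.+1) alpha n * (logn p n)%:R =
    \sum_(0 <= nu < N.+2) nu%:R * alpha (p ^ nu)%N * cp (N %/ p ^ nu)%N.
  rewrite (padic_split pp _ (pow_bound N pp)); apply: eq_bigr => nu _.
  rewrite /cp /coprime_sum mulr_sumr.
  rewrite (eq_bigl (fun m => coprime m p)); last by move=> m; rewrite coprime_sym prime_coprime.
  rewrite big_nat_cond [RHS]big_nat_cond; apply: eq_bigr => m /andP[/andP[m1 _] pm].
  have pm' : coprime (p ^ nu) m by rewrite coprimeXl // coprime_sym.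
  rewrite alpha_mul.2 // ?expn_gt0 ?p0 // lognM // ?expn_gt0 ?p0 // pfactorK //.
  by rewrite logn_coprime ?addn0 1?coprime_sym //; ring.
rewrite big_ltn // !mul0r add0r big_ltn // mul1r expn1.
have Ssplit : Sn (N %/ p) = cp (N %/ p)%N +
    \sum_(2 <= nu < N.+3) alpha (p ^ nu.-1)%N * cp (N %/ p ^ nu)%N.
  have h : (N %/ p < p ^ N.+2)%N by apply: leq_ltn_trans (leq_div _ _) (pow_bound N pp).
  rewrite /Sn (@coprime_sum_split p 1 _ N.+2) ?coprimen1 // big_ltn // expn0 divn1 muln1.
  rewrite alpha_mul.1 mul1r; congr (_ + _).
  rewrite [RHS]big_add1 /=; apply: eq_bigr => nu _.
  by rewrite -divnMA expnS.
have rest0 : 0 <= \sum_(2 <= nu < N.+3) alpha (p ^ nu.-1)%N * cp (N %/ p ^ nu)%N.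
  by apply: sumr_ge0 => nu _; rewrite mulr_ge0 // coprime_sum_ge0.
set r := \sum_(2 <= nu < N.+2) _; set t := \sum_(2 <= nu < N.+3) alpha _ * _ in Ssplit rest0.
have r0 : 0 <= r by apply: sumr_ge0 => nu _; rewrite !mulr_ge0 // coprime_sum_ge0.
have -> : alpha p * cp (N %/ p)%N + r - alpha p * Sn (N %/ p) = r - alpha p * t.
  by rewrite Ssplit; ring.
have a1 : 0 <= alpha p by rewrite -(expn1 p).
apply: (@le_trans _ _ (r + alpha p * t)).
  by rewrite ler_norml; apply/andP; split; have := mulr_ge0 a1 rest0; lra.
under [leRHS]eq_bigr => nu _ do rewrite mulrDl.
rewrite big_split /=; apply: lerD.
  rewrite [leRHS]big_nat_recr //= ler_wpDr //.
    by rewrite !mulr_ge0 // coprime_sum_ge0.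
  by apply: ler_sum => nu _; rewrite ler_wpM2l ?mulr_ge0 // coprime_sum_le.
rewrite /t mulr_sumr; apply: ler_sum => nu _.
by rewrite -mulrA !ler_wpM2l // coprime_sum_le.
Qed.

(** [sum alpha n ln n] is the convolution of [alpha] with [alpha p ln p], up to
    the contribution of proper prime powers. *)
Lemma log_sum_approx N :
  `|\sum_(1 <= n < N.+1) alpha n * ln n%:R
    - \sum_(1 <= m < N.+1) alpha m * theta alpha (N %/ m)| <=
  \sum_(1 <= m < N.+1) alpha m * higher_sum N.+3 (N %/ m).
Proof.
have -> : \sum_(1 <= n < N.+1) alpha n * ln n%:R =
    \sum_(0 <= p < N.+1 | prime p) (\sum_(1 <= n < N.+1) alpha n * (logn p n)%:R) * ln p%:R.
  rewrite big_nat_cond (eq_bigr (fun n => \sum_(0 <= p < N.+1 | prime p)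
      alpha n * (logn p n)%:R * ln p%:R)); last first.
    move=> n /andP[/andP[n1 nN] _]; rewrite (ln_prime_decomp R n1 nN) mulr_sumr.
    by apply: eq_bigr => p _; rewrite mulrA.
  rewrite -big_nat_cond exchange_big; apply: eq_bigr => p _.
  by rewrite mulr_suml.
have -> : \sum_(1 <= m < N.+1) alpha m * theta alpha (N %/ m) =
    \sum_(0 <= p < N.+1 | prime p) (alpha p * Sn (N %/ p)) * ln p%:R.
  rewrite [RHS]big_ltn_cond //= -[RHS]/(\sum_(1 <= p < N.+1 | prime p) _).
  rewrite [RHS](eq_bigr (fun p => (alpha p * ln p%:R) *
    (\sum_(1 <= m < (N %/ p).+1) alpha m))); last first.
    by move=> p _; rewrite /Sn coprime_sum1; ring.
  rewrite hyperbola; apply: eq_bigr => m _; congr (_ * _).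
  by rewrite /theta big_ltn_cond.
rewrite -sumrB; apply: le_trans (ler_norm_sum _ _ _) _.
apply: (@le_trans _ _ (\sum_(0 <= p < N.+3 | prime p) \sum_(2 <= nu < N.+3)
    higher_term p nu * Sn (N %/ p ^ nu))).
  apply: (@le_trans _ _ (\sum_(0 <= p < N.+1 | prime p) \sum_(2 <= nu < N.+3)
    higher_term p nu * Sn (N %/ p ^ nu))).
    apply: ler_sum => p pp; rewrite -mulrBl normrM (ger0_norm (ln_ge0 _)); last first.
      by rewrite ler1n prime_gt0.
    apply: le_trans (ler_wpM2r _ (local_log_sum N pp)) _.
      by rewrite ln_ge0 // ler1n prime_gt0.
    rewrite mulr_suml; apply: ler_sum => nu _.
    by rewrite /higher_term mulrAC.
  apply: sum_prime_le; last by lia.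
  move=> p pp; apply: sumr_ge0 => nu _; rewrite mulr_ge0 ?coprime_sum_ge0 //.
  have p0 := prime_gt0 pp.
  rewrite mulr_ge0 ?ln_ge0 ?ler1n // addr_ge0 ?mulr_ge0 //; apply: alpha_ge0; rewrite ?expn_gt0 ?p0 //.
rewrite le_eqVlt; apply/orP; left; apply/eqP.
under [RHS]eq_bigr => m _ do rewrite /higher_sum mulr_sumr.
rewrite [RHS]exchange_big; apply: eq_bigr => p pp.
under [RHS]eq_bigr => m _ do rewrite mulr_sumr big_mkcond.
rewrite [RHS]exchange_big; apply: eq_bigr => nu _.
have pn0 : (0 < p ^ nu)%N by rewrite expn_gt0 prime_gt0.
rewrite /Sn coprime_sum1 mulr_sumr.
rewrite (big_nat_widen 1 (N %/ p ^ nu).+1 N.+1) ?ltnS ?leq_div //.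
rewrite big_mkcond big_nat_cond [RHS]big_nat_cond; apply: eq_bigr => m /andP[/andP[m1 _] _].
by rewrite ltnS !leq_divRL //= mulnC; case: ifP => // _; rewrite mulrC.
Qed.

End LogSum.

(** * The contribution of proper prime powers *)

Section HigherPowers.
Variables (R : realType) (alpha : nat -> R) (sigma rho0 r L : R).
Hypothesis sigma_gt0 : 0 < sigma.
Hypothesis rho0_01 : 0 <= rho0 < 1.
Hypothesis r01 : 0 < r < 1.
Hypothesis alpha_ge0 : forall n, (0 < n)%N -> 0 <= alpha n.
Hypothesis alpha_pow : forall p k, prime p -> (0 < k)%N ->
  alpha (p ^ k)%N <= L * p%:R `^ ((rho0 + sigma - 1) * k%:R).

Let chi := r + sigma - 1.

(** Otherwise [alpha] would be negative at prime powers. *)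
Lemma prime_power_bound_ge0 : 0 <= L.
Proof.
have := alpha_pow (p := 2) isT (isT : (0 < 1)%N) => h.
have h0 : 0 <= alpha (2 ^ 1)%N by apply: alpha_ge0.
by have := le_trans h0 h; rewrite pmulr_lge0 // powR_gt0.
Qed.

Lemma mul_expN_le (R' : realType) (a u : R') : 0 < a -> u * expR (- (a * u)) <= a^-1.
Proof.
move=> a0; rewrite -(ler_pM2l a0) mulfV ?gt_eqF // mulrA.
have := expR_ge1Dx (a * u); have := expRxMexpNx_1 (a * u).
have := expR_gt0 (- (a * u)); set e := expR (- _); set e' := expR _; set w := a * u.
move=> e0 ee h; rewrite -ee mulrC [leRHS]mulrC ler_wpM2l ?(ltW e0) //; lra.
Qed.

(** The power of [Y] saved on proper prime powers: half of the room left by the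
    pointwise bound, by the exponent of the convergent series and by [sigma]. *)
Definition power_room : R := Num.min sigma (Num.min (1 - r) (1 - rho0)) / 2.
Notation tau := power_room.

Lemma power_room_bounds :
  [/\ 0 < tau, tau <= sigma / 2, tau <= (1 - r) / 2 & tau <= (1 - rho0) / 2].
Proof.
move: rho0_01 r01 => /andP[_ h1] /andP[_ h2]; rewrite /power_room; split.
- by rewrite divr_gt0 // !lt_min sigma_gt0 !subr_gt0 h1 h2.
- by rewrite ler_pM2r // ge_min lexx.
- by rewrite ler_pM2r // !ge_min lexx orbT.
- by rewrite ler_pM2r // !ge_min lexx !orbT.
Qed.

Let local_sum (K p : nat) : R :=
  \sum_(2 <= nu < K) higher_term alpha p nu * expR (- (nu%:R * ln p%:R * (sigma - tau))).

Let powE p a k : prime p -> (p%:R : R) `^ (a * k%:R) = expR (k%:R * ln p%:R * a).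
Proof.
by move=> pp; rewrite powR_exp ?ltr0n ?prime_gt0 //; congr expR; ring.
Qed.

Let lnp_ge0 p : prime p -> 0 <= ln p%:R :> R.
Proof. by move=> pp; rewrite ln_ge0 // ler1n prime_gt0. Qed.

Let local_sum_bounded : exists2 C : R, 0 <= C &
  forall K p, prime p -> local_sum K p <= C.
Proof.
have [t0 ts tr tr0] := power_room_bounds.
have L0 := prime_power_bound_ge0.
have d0 : 0 < 1 - rho0 by rewrite subr_gt0; case/andP: rho0_01.
set d := 1 - rho0 in d0 tr0.
pose y : R := expR (- (ln 2 * (d / 4))).
have ln20 := ln2_gt0 R.
have y1 : y < 1 by rewrite expR_lt1 oppr_lt0 mulr_gt0 // divr_gt0.
have y0 : 0 < y := expR_gt0 _.
pose c := (L + L ^+ 2) * (d / 4)^-1.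
have c0 : 0 <= c.
  by apply: mulr_ge0; [rewrite addr_ge0 ?sqr_ge0|rewrite invr_ge0 divr_ge0 // ltW].
exists (c * (1 - y)^-1) => [|K p pp].
  by apply: mulr_ge0 => //; rewrite invr_ge0 subr_ge0 ltW.
have lp0 := lnp_ge0 pp.
apply: (@le_trans _ _ (\sum_(2 <= nu < K) c * y ^+ nu)).
  rewrite /local_sum big_nat_cond [leRHS]big_nat_cond; apply: ler_sum => nu /andP[/andP[n2 _] _].
  have n0 : (0 < nu)%N by apply: leq_trans n2.
  set u := nu%:R * ln p%:R.
  have u0 : 0 <= u by rewrite mulr_ge0.
  pose e := expR (u * (rho0 + sigma - 1)).
  have a1 : alpha (p ^ nu)%N <= L * e by rewrite /e -powE //; exact: alpha_pow.
  have a2 : alpha p * alpha (p ^ nu.-1)%N <= L ^+ 2 * e.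
    have -> : L ^+ 2 * e = (L * p%:R `^ ((rho0 + sigma - 1) * 1%:R)) *
        (L * p%:R `^ ((rho0 + sigma - 1) * nu.-1%:R)).
      rewrite !powE // /e /u -{1}(prednK n0) -natr1 mulrACA -expRD; congr (_ * expR _); ring.
    have p0 := prime_gt0 pp.
    have h1 := alpha_pow pp (isT : (0 < 1)%N).
    have n1 : (0 < nu.-1)%N by rewrite -subn1 subn_gt0.
    by apply: ler_pM; rewrite ?alpha_ge0 ?expn_gt0 ?p0 // ?alpha_pow // -{1}(expn1 p).
  have hb : higher_term alpha p nu <= (L + L ^+ 2) * e * u.
    rewrite /higher_term.
    apply: (@le_trans _ _ ((nu%:R * (L * e) + nu%:R * (L ^+ 2 * e)) * ln p%:R)).
      rewrite ler_wpM2r // lerD //; first by rewrite ler_wpM2l.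
      by apply: le_trans a2 _; rewrite ler_peMl ?ler1n // mulr_ge0 ?sqr_ge0 // expR_ge0.
    by rewrite le_eqVlt; apply/orP; left; apply/eqP; rewrite /u; ring.
  apply: le_trans (ler_wpM2r (expR_ge0 _) hb) _.
  have -> : (L + L ^+ 2) * e * u * expR (- (u * (sigma - tau))) =
    (L + L ^+ 2) * (u * expR (- (u * (d - tau)))).
    have -> : expR (- (u * (d - tau))) = e * expR (- (u * (sigma - tau))).
      by rewrite /e -expRD; congr expR; rewrite /d; ring.
    ring.
  rewrite /c -mulrA; apply: ler_wpM2l; first by rewrite addr_ge0 ?sqr_ge0.
  apply: (@le_trans _ _ (u * expR (- (d / 4 * u)) * expR (- (d / 4 * u)))).
    rewrite -mulrA -expRD ler_wpM2l // ler_expR; nra.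
  apply: ler_pM; rewrite ?mulr_ge0 ?expR_ge0 //.
    by apply: mul_expN_le; rewrite divr_gt0.
  rewrite /y -expRM_natl ler_expR mulrN lerN2 /u.
  have h2 : ln 2 <= ln p%:R :> R.
    by rewrite ler_ln ?posrE ?ltr0n ?prime_gt0 // ler_nat prime_gt1.
  have nn : 0 <= nu%:R :> R by [].
  have d4 : 0 <= d / 4 by rewrite divr_ge0 // ltW.
  have -> : d / 4 * (nu%:R * ln p%:R) = nu%:R * (ln p%:R * (d / 4)) by ring.
  by rewrite ler_wpM2l // ler_wpM2r.
rewrite -mulr_sumr ler_wpM2l //.
rewrite -(ler_pM2l (_ : 0 < 1 - y)) ?subr_gt0 // mulfV ?subr_eq0 1?eq_sym ?lt_eqF //.
apply: (@le_trans _ _ ((1 - y) * \sum_(0 <= nu < K) y ^+ nu)).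
  rewrite ler_wpM2l ?subr_ge0 ?(ltW y1) //.
  case: (leqP K 2) => K2; first by rewrite big_geq // sumr_ge0 // => i _; rewrite exprn_ge0 // ltW.
  rewrite [leRHS](big_cat_nat _ (n := 2)) //= ?(ltnW K2) // lerDr.
  by rewrite sumr_ge0 // => i _; rewrite exprn_ge0 // ltW.
rewrite big_mkord.
have -> : (1 - y) * (\sum_(i < K) y ^+ i) = 1 - y ^+ K.
  rewrite -[in RHS](expr1n _ K) subrXX; congr (_ * _); apply: eq_bigr => i _.
  by rewrite expr1n mul1r.
by rewrite lerBlDr lerDl exprn_ge0 // ltW.
Qed.

Let series_term (K p : nat) : R := alpha p ^+ 2 / p%:R `^ (2 * chi)
  + \sum_(2 <= k < K) alpha (p ^ k)%N / p%:R `^ (chi * k%:R).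

Let local_sum_le : exists2 C : R, 0 <= C &
  forall K p, prime p -> local_sum K p <= C * series_term K p.
Proof.
have [t0 ts tr tr0] := power_room_bounds.
have L0 := prime_power_bound_ge0.
have e0 : 0 < 1 - r by rewrite subr_gt0; case/andP: r01.
set e := 1 - r in e0 tr.
pose c := (e / 2)^-1.
have c0 : 0 <= c by rewrite invr_ge0 divr_ge0 // ltW.
exists (c * (1 + L)) => [|K p pp].
  by apply: mulr_ge0 => //; exact: addr_ge0.
have p0 := prime_gt0 pp.
have ap k : 0 <= alpha (p ^ k)%N by apply: alpha_ge0; rewrite expn_gt0 p0.
have lp0 := lnp_ge0 pp.
have chiE : sigma - tau = chi + (e - tau) by rewrite /chi /e; ring.
have main k : (0 < k)%N ->
    k%:R * ln p%:R * expR (- (k%:R * ln p%:R * (sigma - tau))) <= c / p%:R `^ (chi * k%:R).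
  move=> k0; rewrite powE // -expRN chiE.
  set u := k%:R * ln p%:R.
  have u0 : 0 <= u by rewrite mulr_ge0.
  have -> : - (u * (chi + (e - tau))) = - (u * (e - tau)) - u * chi by ring.
  rewrite expRD mulrA ler_wpM2r ?expR_ge0 //.
  apply: le_trans (@mul_expN_le R (e / 2) u _); last by rewrite divr_gt0.
  by rewrite ler_wpM2l // ler_expR; nra.
have lnle k : (0 < k)%N ->
    ln p%:R * expR (- (k%:R * ln p%:R * (sigma - tau))) <= c / p%:R `^ (chi * k%:R).
  move=> k0; apply: le_trans (main k k0).
  rewrite ler_wpM2r ?expR_ge0 // ler_peMl // ler1n //.
pose S k := alpha (p ^ k)%N / p%:R `^ (chi * k%:R).
have S0 k : 0 <= S k by rewrite divr_ge0 // powR_ge0.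
have t1 nu : (2 <= nu)%N -> nu%:R * alpha (p ^ nu)%N * ln p%:R *
    expR (- (nu%:R * ln p%:R * (sigma - tau))) <= c * S nu.
  move=> n2; have -> : c * S nu = alpha (p ^ nu)%N * (c / p%:R `^ (chi * nu%:R)).
    by rewrite /S; ring.
  apply: le_trans (_ : alpha (p ^ nu)%N * (nu%:R * ln p%:R * expR (- (nu%:R * ln p%:R * (sigma - tau)))) <= _).
    by rewrite le_eqVlt; apply/orP; left; apply/eqP; ring.
  by rewrite ler_wpM2l // main // ltnW.
have t2 nu : (3 <= nu)%N -> alpha p * alpha (p ^ nu.-1)%N * ln p%:R *
    expR (- (nu%:R * ln p%:R * (sigma - tau))) <= c * L * S nu.-1.
  move=> n3; have n2 : (0 < nu.-1)%N by case: nu n3 => [|[]].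
  have a1 : alpha p * expR (- (ln p%:R * (sigma - tau))) <= L.
    have := alpha_pow pp (isT : (0 < 1)%N); rewrite expn1 powE // mul1r => h.
    apply: le_trans (ler_wpM2r (expR_ge0 _) h) _.
    rewrite -mulrA -expRD ler_piMr // expR_le1.
    have : tau <= 1 - rho0 by have := rho0_01; lra.
    nra.
  have nE : nu%:R = nu.-1%:R + 1 :> R by rewrite natr1 prednK //; case: nu n3 n2.
  have -> : alpha p * alpha (p ^ nu.-1)%N * ln p%:R *
    expR (- (nu%:R * ln p%:R * (sigma - tau))) =
    (alpha p * expR (- (ln p%:R * (sigma - tau)))) *
    (alpha (p ^ nu.-1)%N * (ln p%:R * expR (- (nu.-1%:R * ln p%:R * (sigma - tau))))).
    have -> : - (nu%:R * ln p%:R * (sigma - tau)) =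
      - (ln p%:R * (sigma - tau)) - nu.-1%:R * ln p%:R * (sigma - tau) by rewrite nE; ring.
    rewrite expRD; ring.
  have -> : c * L * S nu.-1 = L * (alpha (p ^ nu.-1)%N * (c / p%:R `^ (chi * nu.-1%:R))).
    by rewrite /S; ring.
  apply: ler_pM => //.
  - by rewrite mulr_ge0 ?expR_ge0 // -(expn1 p).
  - by rewrite mulr_ge0 // mulr_ge0 // expR_ge0.
  - by rewrite ler_wpM2l // lnle.
have a1 : 0 <= alpha p by rewrite -(expn1 p).
have sq0 : 0 <= alpha p ^+ 2 / p%:R `^ (2 * chi) by rewrite divr_ge0 ?sqr_ge0 ?powR_ge0.
have t3 : alpha p * alpha p * ln p%:R * expR (- (2 * ln p%:R * (sigma - tau))) <=
    c * (alpha p ^+ 2 / p%:R `^ (2 * chi)).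
  have := lnle 2%N isT; rewrite [chi * _]mulrC => h.
  have -> : c * (alpha p ^+ 2 / p%:R `^ (2 * chi)) = alpha p ^+ 2 * (c / p%:R `^ (2 * chi)).
    by ring.
  by rewrite -expr2 -mulrA ler_wpM2l ?sqr_ge0.
have Ssum0 : 0 <= \sum_(2 <= k < K) S k by rewrite sumr_ge0.
rewrite /local_sum /series_term -/(\sum_(2 <= k < K) S k).
under eq_bigr => nu _ do rewrite /higher_term !mulrDl.
rewrite big_split /=.
have s1 : \sum_(2 <= nu < K) nu%:R * alpha (p ^ nu)%N * ln p%:R *
    expR (- (nu%:R * ln p%:R * (sigma - tau))) <= c * \sum_(2 <= k < K) S k.
  rewrite mulr_sumr big_nat_cond [leRHS]big_nat_cond; apply: ler_sum => nu /andP[/andP[n2 _] _].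
  exact: t1.
have s2 : \sum_(2 <= nu < K) alpha p * alpha (p ^ nu.-1)%N * ln p%:R *
    expR (- (nu%:R * ln p%:R * (sigma - tau))) <=
    c * (alpha p ^+ 2 / p%:R `^ (2 * chi)) + c * L * \sum_(2 <= k < K) S k.
  case: K Ssum0 {s1} => [|[|[|K]]] Ssum0.
  - by rewrite !big_geq // mulr0 addr0 mulr_ge0.
  - by rewrite !big_geq // mulr0 addr0 mulr_ge0.
  - by rewrite !big_geq // mulr0 addr0 mulr_ge0.
  rewrite big_ltn //= expn1; apply: lerD t3 _.
  rewrite big_add1 /= mulr_sumr.
  apply: le_trans (_ : \sum_(2 <= nu < K.+2) c * L * S nu <= _).
    rewrite big_nat_cond [leRHS]big_nat_cond; apply: ler_sum => nu /andP[/andP[n2 _] _].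
    exact: (t2 nu.+1).
  by rewrite [leRHS]big_nat_recr //= lerDl mulr_ge0 // mulr_ge0.
apply: le_trans (lerD s1 s2) _.
have : 0 <= c * L * (alpha p ^+ 2 / p%:R `^ (2 * chi)) by rewrite mulr_ge0 // mulr_ge0.
move: (alpha p ^+ 2 / _) (\sum_(2 <= k < K) S k) => A B; lra.
Qed.

Variable E : seq nat.
Hypothesis alpha_series :
  (\sum_(0 <= p <oo | prime p && (p \notin E))
     ((alpha p ^+ 2 / p%:R `^ (2 * (r + sigma - 1)))%:E
      + \sum_(2 <= k <oo)
          (alpha (p ^ k)%N / p%:R `^ ((r + sigma - 1) * k%:R))%:E)
   <= L%:E)%E.

Let series_finite K : \sum_(0 <= p < K | prime p && (p \notin E)) series_term K p <= L.
Proof.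
have ap p k : prime p -> 0 <= alpha (p ^ k)%N.
  by move=> pp; apply: alpha_ge0; rewrite expn_gt0 prime_gt0.
rewrite -lee_fin; apply: le_trans alpha_series.
apply: le_trans (nneseries_lim_ge K _); last first.
  move=> p _ /andP[pp _]; rewrite adde_ge0 ?lee_fin ?divr_ge0 ?sqr_ge0 ?powR_ge0 //.
  by apply: nneseries_ge0 => k _ _; rewrite lee_fin divr_ge0 ?powR_ge0 ?ap.
rewrite -sumEFin; apply: lee_sum => p /andP[pp _].
rewrite EFinD leeD2l //.
apply: le_trans (nneseries_lim_ge K _); last first.
  by move=> k _ _; rewrite lee_fin divr_ge0 ?powR_ge0 ?ap.
by rewrite -sumEFin.
Qed.

(** Proper prime powers save a fixed power of [Y]: away from a finite set of
    primes by the convergent series, at each remaining prime by the pointwise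
    bound. *)
Lemma higher_sum_le : exists2 C : R, 0 <= C & forall K Y, (0 < Y)%N ->
  higher_sum alpha K Y <= C * Y%:R `^ (sigma - tau).
Proof.
have [C1 C10 H1] := local_sum_bounded.
have [C2 C20 H2] := local_sum_le.
have L0 := prime_power_bound_ge0.
have [t0 ts _ _] := power_room_bounds.
exists (C1 * (size E)%:R + C2 * L) => [|K Y Y0].
  by rewrite addr_ge0 // mulr_ge0.
have st : 0 <= sigma - tau by have := sigma_gt0; lra.
have ap p k : prime p -> 0 <= alpha (p ^ k)%N.
  by move=> pp; apply: alpha_ge0; rewrite expn_gt0 prime_gt0.
have ht0 p nu : prime p -> 0 <= higher_term alpha p nu.
  move=> pp; rewrite mulr_ge0 ?lnp_ge0 // addr_ge0 // mulr_ge0 ?ap //.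
  by rewrite -(expn1 p) ap.
have Yp : 0 < Y%:R :> R by rewrite ltr0n.
apply: (@le_trans _ _ (Y%:R `^ (sigma - tau) * \sum_(0 <= p < K | prime p) local_sum K p)).
  rewrite /higher_sum mulr_sumr; apply: ler_sum => p pp.
  rewrite /local_sum mulr_sumr big_mkcond /=; apply: ler_sum => nu _.
  have rhs0 : 0 <= Y%:R `^ (sigma - tau) *
     (higher_term alpha p nu * expR (- (nu%:R * ln p%:R * (sigma - tau)))).
    exact: mulr_ge0 (powR_ge0 _ _) (mulr_ge0 (ht0 _ _ pp) (expR_ge0 _)).
  case: ifP => // pY; rewrite mulrCA ler_peMr ?ht0 //.
  rewrite powR_exp // -expRD -[leLHS]expR0 ler_expR.
  have : nu%:R * ln p%:R <= ln Y%:R :> R.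
    have p0 := prime_gt0 pp.
    rewrite mulr_natl -lnXn ?ltr0n // -natrX ler_ln ?posrE ?ltr0n ?expn_gt0 ?p0 //.
    by rewrite ler_nat.
  move=> h; rewrite subr_ge0 mulrC ler_wpM2l //.
rewrite mulrC ler_wpM2r ?powR_ge0 //.
rewrite (bigID (fun p => p \in E)) /=; apply: lerD.
  apply: (@le_trans _ _ (\sum_(0 <= p < K | prime p && (p \in E)) C1)).
    by apply: ler_sum => p /andP[pp _]; exact: H1.
  rewrite big_const_seq iter_addr_0 -[leLHS]mulr_natr ler_wpM2l // ler_nat.
  rewrite -size_filter; apply: uniq_leq_size; first exact: filter_uniq (iota_uniq _ _).
  by move=> p; rewrite mem_filter => /andP[/andP[_ ->]].
apply: le_trans (ler_wpM2l C20 (series_finite K)).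
by rewrite mulr_sumr; apply: ler_sum => p /andP[pp _]; exact: H2.
Qed.

End HigherPowers.

(** * Regular variation of the summatory function *)

Section Regularity.
Variables (R : realType) (alpha : nat -> R) (A0 sigma kappa tau Ct Ch : R).
Hypothesis A0_gt0 : 0 < A0.
Hypothesis sigma_gt0 : 0 < sigma.
Hypothesis kappa_gt0 : 0 < kappa.
Hypothesis tau_bounds : 0 < tau <= sigma.
Hypothesis Ct0 : 0 <= Ct.
Hypothesis Ch0 : 0 <= Ch.
Hypothesis alpha_ge0 : forall n, (0 < n)%N -> 0 <= alpha n.
Hypothesis alpha_mul : Defs.multiplicative alpha.
Notation A := (saving A0 sigma).
Notation gauge := (error_gauge A0 sigma).
Hypothesis theta_bound : forall y : R, 1 <= y ->
  `|theta alpha (Num.truncn y) - kappa * y `^ sigma| <= Ct * gauge y.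
Hypothesis higher_bound : forall K Y, (0 < Y)%N ->
  higher_sum alpha K Y <= Ch * Y%:R `^ (sigma - tau).

Notation S := (summatory alpha).
(** The density of [alpha] on a logarithmic scale; it varies slowly. *)
Definition log_mean (x : R) : R :=
  \sum_(1 <= n < (Num.truncn x).+1) alpha n * n%:R `^ (- sigma).
Notation T := log_mean.
Definition error_sum (x : R) : R :=
  \sum_(1 <= m < (Num.truncn x).+1) alpha m * gauge (x / m%:R).
Notation Err := error_sum.

Lemma ln2_le1 : ln 2 <= 1 :> R.
Proof. by have := @le_ln1Dx R 1; rewrite (_ : 1 + 1 = 2 :> R); [apply; lra|lra]. Qed.

Lemma truncn_div (x : R) m : 0 <= x -> (0 < m)%N ->
  Num.truncn (x / m%:R) = (Num.truncn x %/ m)%N.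
Proof.
move=> x0 m0; have m0' : 0 < m%:R :> R by rewrite ltr0n.
have /andP[h1 h2] := truncn_itv x0.
apply/eqP; rewrite truncn_eq ?divr_ge0 //; apply/andP; split.
  rewrite ler_pdivlMr // -natrM; apply: le_trans h1; rewrite ler_nat; exact: leq_divM.
rewrite ltr_pdivrMr // -natrM; apply: lt_le_trans h2 _; rewrite ler_nat.
by rewrite ltn_ceil.
Qed.

Lemma summatory_ge0 (x : R) : 0 <= S x.
Proof.
by rewrite /summatory big_nat_cond sumr_ge0 // => n /andP[/andP[n1 _] _]; exact: alpha_ge0.
Qed.

Lemma log_mean_mono (x y : R) : x <= y -> T x <= T y.
Proof.
move=> xy; have h : (Num.truncn x <= Num.truncn y)%N by exact: le_truncn.
rewrite /T [leRHS](big_cat_nat _ (n := (Num.truncn x).+1)) //= lerDl.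
rewrite big_nat_cond sumr_ge0 // => n /andP[/andP[n1 _] _].
by rewrite mulr_ge0 ?powR_ge0 // alpha_ge0 // (leq_trans _ n1).
Qed.

Lemma alpha1 : alpha 1 = 1. Proof. exact: alpha_mul.1. Qed.

Lemma log_mean_ge1 (x : R) : 1 <= x -> 1 <= T x.
Proof.
move=> x1; apply: le_trans (log_mean_mono x1).
by rewrite /T truncn1 big_nat1 alpha1 powR1 mulr1.
Qed.

Lemma gauge_le (y : R) : 1 <= y -> gauge y <= y `^ sigma.
Proof.
move=> y1; have [A_gt0 _ _ _] := saving_bounds A0_gt0 sigma_gt0.
rewrite ler_pdivrMr ?powR_gt0 ?ln1_gt0 // ler_peMr ?powR_ge0 //.
by rewrite powR_ge1 ?(ltW A_gt0) // lerDl ln_ge0.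
Qed.

Let in_range (x : R) m : 1 <= x -> (0 < m)%N -> (m < (Num.truncn x).+1)%N ->
  [/\ 0 < m%:R :> R, m%:R <= x & 1 <= x / m%:R].
Proof.
move=> x1 m0; rewrite ltnS => mx.
have m0' : 0 < m%:R :> R by rewrite ltr0n.
have mx' : m%:R <= x by rewrite -truncn_ge_nat // (le_trans ler01).
by split => //; rewrite ler_pdivlMr // mul1r.
Qed.

Let sum_ratio (x : R) : 1 <= x ->
  \sum_(1 <= m < (Num.truncn x).+1) alpha m * (x / m%:R) `^ sigma = x `^ sigma * T x.
Proof.
move=> x1; rewrite /T mulr_sumr big_nat_cond [RHS]big_nat_cond.
apply: eq_bigr => m /andP[/andP[m1 mx] _].
have x0 : 0 <= x by apply: le_trans x1.
have -> : m%:R `^ (- sigma) = m%:R^-1 `^ sigma by rewrite -powR_inv1 // -powRrM mulN1r.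
by rewrite powRM ?invr_ge0 //; ring.
Qed.

Lemma error_sum_le (x : R) : 1 <= x -> Err x <= x `^ sigma * T x.
Proof.
move=> x1; rewrite -sum_ratio // /Err big_nat_cond [leRHS]big_nat_cond.
apply: ler_sum => m /andP[/andP[m1 mx] _]; have [m0 _ xm] := in_range x1 m1 mx.
by rewrite ler_wpM2l ?alpha_ge0 // gauge_le.
Qed.

(** Powers of logarithms are absorbed by any power of [y]. *)
Let log_le_powR (y a : R) : 0 < a -> 1 <= y -> 1 + ln y <= (1 + a^-1) * y `^ a.
Proof.
move=> a0 y1; have y0 : 0 < y by apply: lt_le_trans y1.
have h1 := ln_le_powR a0 y0; have h2 := powR_ge1 y1 (ltW a0).
have : ln y <= a^-1 * y `^ a by rewrite -ler_pdivrMl ?invr_gt0 // invrK.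
by rewrite mulrDl mul1r => h3; lra.
Qed.

Let ln1_powA (y : R) : 1 <= y -> (1 + ln y) `^ A <= 1 + ln y.
Proof.
move=> y1; have [_ _ _ A1] := saving_bounds A0_gt0 sigma_gt0.
by apply: ler1_powR A1; rewrite lerDl ln_ge0.
Qed.

Let power_le_gauge : exists2 C : R, 0 <= C &
  forall y : R, 1 <= y -> y `^ (sigma - tau) <= C * gauge y.
Proof.
have /andP[t0 ts] := tau_bounds.
exists (1 + tau^-1) => [|y y1]; first by rewrite addr_ge0 // invr_ge0 ltW.
have y0 : 0 < y by apply: lt_le_trans y1.
rewrite /error_gauge mulrA ler_pdivlMr ?powR_gt0 ?ln1_gt0 //.
have -> : (1 + tau^-1) * y `^ sigma = y `^ (sigma - tau) * ((1 + tau^-1) * y `^ tau).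
  rewrite mulrCA -powRD ?subrK // gt_eqF ?implybT //.
rewrite ler_wpM2l ?powR_ge0 //.
exact: le_trans (ln1_powA y1) (log_le_powR t0 y1).
Qed.

Let ln_le_gauge : exists2 C : R, 0 <= C &
  forall y : R, 1 <= y -> ln y <= C * gauge y.
Proof.
have s2 : 0 < sigma / 2 by rewrite divr_gt0.
exists ((1 + (sigma / 2)^-1) ^+ 2) => [|y y1]; first exact: sqr_ge0.
have y0 : 0 < y by apply: lt_le_trans y1.
rewrite /error_gauge mulrA ler_pdivlMr ?powR_gt0 ?ln1_gt0 //.
have h := log_le_powR s2 y1.
have l0 := ln_ge0 y1.
apply: (@le_trans _ _ ((1 + ln y) ^+ 2)).
  rewrite expr2; apply: ler_pM; rewrite ?powR_ge0 ?ln1_powA //; lra.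
have -> : y `^ sigma = (y `^ (sigma / 2)) ^+ 2.
  by rewrite -powR_mulrn ?powR_ge0 // -powRrM divfK.
rewrite -exprMn; apply: lerXn2r; rewrite ?nnegrE //; first exact: addr_ge0.
exact: le_trans (addr_ge0 ler01 l0) h.
Qed.

(** [S x ln x = kappa x ^ sigma T x] up to the convolution of [alpha] with the
    error term of the prime number estimate. *)
Lemma summatory_log : exists2 C : R, 0 <= C & forall x : R, 1 <= x ->
  `|S x * ln x - kappa * (x `^ sigma * T x)| <= C * Err x.
Proof.
have [Cw Cw0 HCw] := power_le_gauge.
have [Cl Cl0 HCl] := ln_le_gauge.
have /andP[t0 ts] := tau_bounds.
exists (Ch * Cw + Ct + Cl) => [|x x1]; first by rewrite !addr_ge0 // mulr_ge0.
set N := Num.truncn x.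
have x0 : 0 < x by apply: lt_le_trans x1.
pose U := \sum_(1 <= n < N.+1) alpha n * ln n%:R.
pose V := \sum_(1 <= m < N.+1) alpha m * theta alpha (N %/ m).
pose W := \sum_(1 <= m < N.+1) alpha m * ln (x / m%:R).
have -> : S x * ln x = U + W.
  rewrite /S /summatory mulr_suml -big_split /= big_nat_cond [RHS]big_nat_cond.
  apply: eq_bigr => m /andP[/andP[m1 mx] _]; have [m0 _ xm] := in_range x1 m1 mx.
  by rewrite ln_div ?posrE // -mulrDr addrC subrK.
have -> : U + W - kappa * (x `^ sigma * T x) =
  (U - V) + (V - kappa * (x `^ sigma * T x)) + W by ring.
rewrite !mulrDl; apply: le_trans (ler_normD _ _) _; apply: lerD.
  apply: le_trans (ler_normD _ _) _; apply: lerD.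
    apply: le_trans (log_sum_approx alpha_ge0 alpha_mul N) _.
    rewrite /Err mulr_sumr big_nat_cond [leRHS]big_nat_cond.
    apply: ler_sum => m /andP[/andP[m1 mx] _]; have [m0 mx' xm] := in_range x1 m1 mx.
    have Nm : (0 < N %/ m)%N by rewrite divn_gt0.
    rewrite mulrCA ler_wpM2l ?alpha_ge0 //.
    apply: le_trans (higher_bound N.+3 Nm) _; rewrite -mulrA ler_wpM2l //.
    apply: le_trans (HCw _ xm); apply: ge0_ler_powR; rewrite ?subr_ge0 ?nnegrE ?divr_ge0 ?(ltW x0) //.
    by rewrite -truncn_ge_nat ?divr_ge0 ?(ltW x0) // truncn_div // ltW.
  rewrite -sum_ratio // mulr_sumr /V -sumrB.
  apply: le_trans (ler_norm_sum _ _ _) _.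
  rewrite /Err mulr_sumr big_nat_cond [leRHS]big_nat_cond.
  apply: ler_sum => m /andP[/andP[m1 mx] _]; have [m0 _ xm] := in_range x1 m1 mx.
  rewrite mulrCA -mulrBr normrM ger0_norm ?alpha_ge0 // mulrCA ler_wpM2l ?alpha_ge0 //.
  by rewrite /N -truncn_div ?(ltW x0) //; exact: theta_bound.
rewrite /Err mulr_sumr; apply: le_trans (ler_norm_sum _ _ _) _.
rewrite big_nat_cond [leRHS]big_nat_cond.
apply: ler_sum => m /andP[/andP[m1 mx] _]; have [m0 _ xm] := in_range x1 m1 mx.
rewrite normrM !ger0_norm ?alpha_ge0 ?ln_ge0 // mulrCA ler_wpM2l ?alpha_ge0 //.
exact: HCl.
Qed.

(** [error_gauge] is dominated by the pure power, so the error in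
    [summatory_log] is at most a constant times the main term. *)
Lemma summatory_upper : exists2 C : R, 0 <= C & forall x : R, 1 <= x ->
  S x * ln x <= C * (x `^ sigma * T x).
Proof.
have [C C0 HC] := summatory_log.
exists (C + kappa) => [|x x1]; first by rewrite addr_ge0 // ltW.
have := HC x x1; have := ler_wpM2l C0 (error_sum_le x1).
move: (S x * ln x) (x `^ sigma * T x) => a b h1; rewrite ler_norml => /andP[_ h2].
rewrite mulrDl; lra.
Qed.

Let log_mean_block : exists2 C : R, 0 <= C & forall x y : R, 2 <= y -> y <= x -> x <= 2 * y ->
  T x - T y <= C * (T x / ln y).
Proof.
have [C C0 HC] := summatory_upper.
exists (C * 2 `^ sigma) => [|x y y2 yx xy]; first by rewrite mulr_ge0 ?powR_ge0.
have y1 : 1 <= y by lra.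
have y0 : 0 < y by lra.
have x1 : 1 <= x by lra.
have ly : 0 < ln y by rewrite ln_gt0 //; lra.
have lxy : ln y <= ln x by rewrite ler_ln ?posrE //; lra.
have h : (Num.truncn y <= Num.truncn x)%N by exact: le_truncn.
have step1 : T x - T y <= y `^ (- sigma) * S x.
  rewrite /T (big_cat_nat _ (n := (Num.truncn y).+1)) //= addrAC subrr add0r.
  apply: (@le_trans _ _ (\sum_((Num.truncn y).+1 <= n < (Num.truncn x).+1) y `^ (- sigma) * alpha n)).
    rewrite big_nat_cond [leRHS]big_nat_cond; apply: ler_sum => n /andP[/andP[ny _] _].
    rewrite mulrC ler_wpM2r ?alpha_ge0 // ?(leq_trans _ ny) //.
    have yn : y <= n%:R.
      have /andP[_ /ltW h2] := truncn_itv (ltW y0); apply: le_trans h2 _; by rewrite ler_nat.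
    rewrite !powRN lef_pV2 ?posrE ?powR_gt0 // ?(lt_le_trans y0) //.
    by apply: ge0_ler_powR; rewrite ?nnegrE ?(ltW sigma_gt0) ?(ltW y0).
  rewrite -mulr_sumr ler_wpM2l ?powR_ge0 // /S /summatory.
  rewrite [leRHS](big_cat_nat _ (n := (Num.truncn y).+1)) //= lerDr.
  by rewrite big_nat_cond sumr_ge0 // => n /andP[/andP[n1 _] _]; exact: alpha_ge0.
apply: le_trans step1 _.
have T0 : 0 <= T x by apply: le_trans (log_mean_ge1 x1).
have step2 : S x <= C * (x `^ sigma * T x) / ln y.
  rewrite ler_pdivlMr //; apply: le_trans (HC x x1).
  by rewrite ler_wpM2l // summatory_ge0.
apply: le_trans (ler_wpM2l (powR_ge0 _ _) step2) _.
have xs : x `^ sigma <= 2 `^ sigma * y `^ sigma.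
  rewrite -powRM ?(ltW y0) //.
  by apply: ge0_ler_powR; rewrite ?nnegrE ?mulr_ge0 ?(ltW sigma_gt0) ?(ltW y0) //; lra.
have yN : y `^ (- sigma) * y `^ sigma = 1.
  by rewrite powRN mulVf // gt_eqF // powR_gt0.
have -> : y `^ (- sigma) * (C * (x `^ sigma * T x) / ln y) =
  (C * (T x / ln y)) * (y `^ (- sigma) * x `^ sigma) by ring.
have -> : C * 2 `^ sigma * (T x / ln y) =
  (C * (T x / ln y)) * (y `^ (- sigma) * (2 `^ sigma * y `^ sigma)).
  by rewrite [y `^ _ * _]mulrCA yN mulr1; ring.
apply: ler_wpM2l; first by rewrite mulr_ge0 // divr_ge0 // ltW.
by apply: ler_wpM2l => //; exact: powR_ge0.
Qed.

(** Dyadic blocks: between [y] and [2 y] the increment of [T] is at most a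
    constant times [S (2 y) / y ^ sigma], which [summatory_upper] bounds by
    [T x / ln y]. *)
Lemma log_mean_slow : exists2 C : R, 0 <= C & forall x y : R, 2 <= y -> y <= x ->
  T x - T y <= C * (T x * (1 + ln (x / y)) / ln y).
Proof.
have [C C0 HC] := log_mean_block.
have blocks k : forall x y : R, 2 <= y -> y <= x -> x <= 2 ^+ k * y ->
    T x - T y <= k%:R * (C * (T x / ln y)).
  elim: k => [|k IH] x y y2 yx xy.
    by rewrite expr0 mul1r in xy; rewrite mul0r subr_le0 log_mean_mono.
  have ly : 0 < ln y by rewrite ln_gt0 //; lra.
  have T0 : 0 <= T x by apply: le_trans (log_mean_ge1 (_ : 1 <= x)); lra.
  have B0 : 0 <= C * (T x / ln y) by rewrite mulr_ge0 // divr_ge0 // ltW.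
  have [x2y|x2y] := leP x (2 * y).
    apply: le_trans (HC x y y2 yx x2y) _.
    by rewrite ler_peMl // ler1n.
  have h1 : T x - T (2 * y) <= k%:R * (C * (T x / ln y)).
    apply: le_trans (IH x (2 * y) _ (ltW x2y) _) _; first by lra.
      by rewrite mulrA -exprSr.
    rewrite ler_wpM2l // ler_wpM2l // ler_wpM2l // lef_pV2 ?posrE //.
      by rewrite ler_ln ?posrE; lra.
    by rewrite ln_gt0; lra.
  have h2 : T (2 * y) - T y <= C * (T x / ln y).
    have := HC (2 * y) y y2 => /(_ _ (lexx _)) h; apply: le_trans (h _) _; first by lra.
    rewrite ler_wpM2l // ler_wpM2r ?invr_ge0 ?(ltW ly) //.
    exact/log_mean_mono/ltW.
  rewrite -natr1 mulrDl mul1r; lra.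
exists (2 * C) => [|x y y2 yx]; first exact: mulr_ge0.
have x0 : 0 < x by lra.
have y0 : 0 < y by lra.
have ly : 0 < ln y by rewrite ln_gt0 //; lra.
have T0 : 0 <= T x by apply: le_trans (log_mean_ge1 (_ : 1 <= x)); lra.
have B0 : 0 <= C * (T x / ln y) by rewrite mulr_ge0 // divr_ge0 // ltW.
have xy1 : 1 <= x / y by rewrite ler_pdivlMr // mul1r.
have l0 : 0 <= ln (x / y) := ln_ge0 xy1.
have l2 := ln2_ge_half R.
have l20 := ln2_gt0 R.
have q0 : 0 <= ln (x / y) / ln 2 by rewrite divr_ge0 // ltW.
set k := (Num.truncn (ln (x / y) / ln 2)).+1.
have kl : k%:R <= 2 * (1 + ln (x / y)).
  have /andP[h _] := truncn_itv q0.
  rewrite /k -natr1.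
  have : ln (x / y) / ln 2 <= 2 * ln (x / y) by rewrite ler_pdivrMr //; nra.
  lra.
apply: le_trans (blocks k x y y2 yx _) _.
  have /andP[_ /ltW h] := truncn_itv q0.
  rewrite -/k ler_pdivrMr // mulr_natl -lnXn // in h.
  rewrite ler_ln ?posrE ?divr_gt0 ?exprn_gt0 // in h.
  by rewrite -ler_pdivrMr.
apply: le_trans (ler_wpM2r B0 kl) _.
by rewrite le_eqVlt; apply/orP; left; apply/eqP; ring.
Qed.

(** Half of the saving on primes, because the convolution is split at
    [exp (sqrt (ln x))]. *)
Definition log_saving : R := A / 2.
Notation c := log_saving.

Lemma log_saving_bounds : 0 < c <= 2^-1.
Proof.
have [A_gt0 _ _ A1] := saving_bounds A0_gt0 sigma_gt0.
by rewrite /log_saving divr_gt0 //= ler_pdivrMr // mulVf.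
Qed.

(** Splitting the convolution at [x / exp (sqrt (ln x))]: small [m] gain from
    the error term, large [m] lie in a short logarithmic range. *)
Let error_sum_small : exists2 C : R, 0 <= C & forall x : R, 4 <= ln x ->
  Err x <= C * (x `^ sigma * T x * (ln x) `^ (- c)).
Proof.
have [C C0 HC] := log_mean_slow.
have /andP[c0 c1] := log_saving_bounds.
exists (1 + 4 * C) => [|x x4]; first by rewrite addr_ge0 // mulr_ge0.
set l := ln x in x4 *; set q := Num.sqrt l.
have x1 : 1 <= x.
  rewrite leNgt; apply/negP => /ltW /ln_le0; rewrite -/l; lra.
have x0 : 0 < x by lra.
have q2 : q ^+ 2 = l by rewrite sqr_sqrtr //; lra.
have qge : 2 <= q.
  rewrite -(@ler_pXn2r _ 2) ?nnegrE ?sqrtr_ge0 // q2; lra.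
pose y := x / expR q.
have y0 : 0 < y by rewrite divr_gt0 // expR_gt0.
have ly : ln y = l - q by rewrite ln_div ?posrE ?expR_gt0 // expRK.
have yx : y <= x.
  rewrite ler_pdivrMr ?expR_gt0 // ler_peMr ?(ltW x0) //.
  by apply: le_trans (expR_ge1Dx _); lra.
have lq : l / 2 <= l - q by nra.
have y2 : 2 <= y.
  rewrite -ler_ln ?posrE // ly.
  have := @le_ln1Dx R 1; rewrite (_ : 1 + 1 = 2 :> R); last by lra.
  move=> h; have := h _; lra.
have T0 : 0 <= T x by apply: le_trans (log_mean_ge1 x1).
have xs0 : 0 <= x `^ sigma := powR_ge0 _ _.
have [A_gt0 _ _ A1] := saving_bounds A0_gt0 sigma_gt0.
have l0 : 0 < l by lra.
have lA : l `^ (- c) = (q `^ A)^-1.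
  rewrite /q -powR12_sqrt ?(ltW l0) // -powRrM powRN /log_saving.
  by congr (powR _ _)^-1; ring.
have qA : q^-1 <= l `^ (- c).
  rewrite lA lef_pV2 ?posrE ?powR_gt0 //; [|lra|lra].
  apply: le_trans (ler1_powR _ A1) _; lra.
have part1 : \sum_(1 <= m < (Num.truncn y).+1) alpha m * gauge (x / m%:R) <=
    x `^ sigma * T x * l `^ (- c).
  apply: (@le_trans _ _ (\sum_(1 <= m < (Num.truncn y).+1)
      (alpha m * (x / m%:R) `^ sigma) * l `^ (- c))).
    rewrite big_nat_cond [leRHS]big_nat_cond; apply: ler_sum => m /andP[/andP[m1 my] _].
    have y1 : 1 <= y by lra.
    have [m0 my' _] := in_range y1 m1 my.
    rewrite -mulrA ler_wpM2l ?alpha_ge0 // /error_gauge ler_wpM2l ?powR_ge0 //.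
    have xm : q <= ln (x / m%:R).
      rewrite -(expRK q) ler_ln ?posrE ?divr_gt0 ?expR_gt0 //.
      by rewrite ler_pdivlMr // mulrC -ler_pdivlMr ?expR_gt0.
    rewrite lA lef_pV2 ?posrE ?powR_gt0 //; [|lra|lra].
    by apply: ge0_ler_powR; rewrite ?nnegrE ?(ltW A_gt0) //; lra.
  rewrite -mulr_suml ler_wpM2r ?powR_ge0 //.
  rewrite -sum_ratio // [leRHS](big_cat_nat _ (n := (Num.truncn y).+1)) //=; last first.
    by rewrite ltnS le_truncn.
  rewrite lerDl big_nat_cond sumr_ge0 // => n /andP[/andP[n1 _] _].
  by rewrite mulr_ge0 ?powR_ge0 // alpha_ge0 // (leq_trans _ n1).
have part2 : \sum_((Num.truncn y).+1 <= m < (Num.truncn x).+1) alpha m * gauge (x / m%:R) <=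
    x `^ sigma * (T x - T y).
  have -> : T x - T y = \sum_((Num.truncn y).+1 <= m < (Num.truncn x).+1) alpha m * m%:R `^ (- sigma).
    rewrite /T [X in X - _](big_cat_nat _ (n := (Num.truncn y).+1)) //=; last first.
      by rewrite ltnS le_truncn.
    by rewrite addrAC subrr add0r.
  rewrite mulr_sumr big_nat_cond [leRHS]big_nat_cond; apply: ler_sum => m /andP[/andP[m1 mx] _].
  have m0 : (0 < m)%N by apply: leq_trans m1.
  have [m0' mx' xm] := in_range x1 m0 mx.
  rewrite [leRHS]mulrCA ler_wpM2l ?alpha_ge0 //.
  apply: le_trans (gauge_le xm) _.
  rewrite powRM ?invr_ge0 ?(ltW x0) //.
  by rewrite -[m%:R^-1]powR_inv1 // -powRrM mulN1r.
have -> : Err x = \sum_(1 <= m < (Num.truncn y).+1) alpha m * gauge (x / m%:R) +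
    \sum_((Num.truncn y).+1 <= m < (Num.truncn x).+1) alpha m * gauge (x / m%:R).
  by rewrite /Err (big_cat_nat _ (n := (Num.truncn y).+1)) //= ltnS le_truncn.
rewrite mulrDl mul1r; apply: lerD part1 _; apply: le_trans part2 _.
have := HC x y y2 yx; rewrite ly.
have -> : ln (x / y) = q.
  by rewrite /y invf_div mulrC divfK ?gt_eqF // expRK.
move=> h; have l00 : 0 < l - q by nra.
have frac : (1 + q) / (l - q) <= 4 * q^-1.
  rewrite ler_pdivrMr // mulrAC ler_pdivlMr; last by lra.
  rewrite -q2; nra.
have h2 : T x - T y <= C * (T x * (4 * l `^ (- c))).
  apply: le_trans h _; rewrite ler_wpM2l // -mulrA ler_wpM2l //.
  by apply: le_trans frac _; rewrite ler_wpM2l.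
apply: le_trans (ler_wpM2l xs0 h2) _.
by rewrite le_eqVlt; apply/orP; left; apply/eqP; ring.
Qed.

Let summatory_asymp : exists2 C : R, 0 <= C & forall x : R, 4 <= ln x ->
  `|S x * x `^ (- sigma) * ln x - kappa * T x| <= C * (T x * (ln x) `^ (- c)).
Proof.
have [C1 C10 H1] := summatory_log.
have [C2 C20 H2] := error_sum_small.
exists (C1 * C2) => [|x x4]; first exact: mulr_ge0.
have x1 : 1 <= x.
  rewrite leNgt; apply/negP => /ltW /ln_le0; lra.
have x0 : 0 < x by lra.
have xN : x `^ (- sigma) * x `^ sigma = 1.
  by rewrite powRN mulVf // gt_eqF // powR_gt0.
have -> : S x * x `^ (- sigma) * ln x - kappa * T x =
  x `^ (- sigma) * (S x * ln x - kappa * (x `^ sigma * T x)).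
  transitivity (S x * x `^ (- sigma) * ln x - kappa * T x * (x `^ (- sigma) * x `^ sigma)).
    by rewrite xN mulr1.
  ring.
rewrite normrM (ger0_norm (powR_ge0 _ _)).
apply: le_trans (ler_wpM2l (powR_ge0 _ _) (H1 x x1)) _.
apply: le_trans (ler_wpM2l (powR_ge0 _ _) (ler_wpM2l C10 (H2 x x4))) _.
have -> : x `^ (- sigma) * (C1 * (C2 * (x `^ sigma * T x * ln x `^ (- c)))) =
  (x `^ (- sigma) * x `^ sigma) * (C1 * C2 * (T x * ln x `^ (- c))) by ring.
by rewrite xN mul1r.
Qed.

(** By [summatory_asymp] the ratio [S y / y ^ sigma] is governed by [T y / ln y],
    and [T] varies slowly by [log_mean_slow].  When [y] is much smaller than
    [x], crude bounds suffice thanks to the factor [(x / y) ^ tau0]. *)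
Lemma summatory_regular (tau0 : R) : 0 < tau0 <= 1 ->
  exists C X : R, [/\ 0 <= C, 1 <= X & forall x y : R, X <= x -> 0 < y -> y <= x ->
    `|S y - (y / x) `^ sigma * S x| <=
      C * (ln x) `^ (- c) * ((y / x) `^ sigma * S x) * (x / y) `^ tau0].
Proof.
move=> /andP[t0 t1].
have [C1 C10 H1] := summatory_asymp.
have [C2 C20 H2] := summatory_upper.
have [C3 C30 H3] := log_mean_slow.
have /andP[c0 c12] := log_saving_bounds.
have c1 : c <= 1 by lra.
pose D := 2 / kappa * (3 * C1 + 2 * C2 + 2 * kappa * C3).
pose Cu := 1 + tau0^-1.
pose Cm := (1 + 2 / kappa) * (16 / tau0 ^+ 2).
have k0 := kappa_gt0.
have tV : 0 < tau0^-1 by rewrite invr_gt0.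
have D0 : 0 <= D.
  by rewrite /D mulr_ge0 ?divr_ge0 ?(ltW k0) // !addr_ge0 ?mulr_ge0 ?(ltW k0).
have Cu0 : 0 <= Cu by rewrite /Cu; lra.
have Cm0 : 0 <= Cm.
  by rewrite /Cm mulr_ge0 ?addr_ge0 ?divr_ge0 ?sqr_ge0 ?(ltW k0).
pose l1 := (2 * C1 / kappa + 1) `^ c^-1.
pose L1 := Num.max 8 l1.
exists (tau0^-1 + Cm + D * Cu), (expR L1); split.
- exact: addr_ge0 (addr_ge0 (ltW tV) Cm0) (mulr_ge0 D0 Cu0).
- by rewrite -(expR0 R) ler_expR le_max; apply/orP; left.
move=> x y xX y0 yx.
have x0 : 0 < x by apply: lt_le_trans xX; exact: expR_gt0.
set l := ln x.
have lL : L1 <= l by rewrite -(expRK L1) ler_ln ?posrE ?expR_gt0.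
have l8 : 8 <= l by apply: le_trans lL; rewrite le_max lexx.
have ll1 : l1 <= l by apply: le_trans lL; rewrite le_max lexx orbT.
have l0 : 0 < l by lra.
have x1 : 1 <= x.
  by apply: le_trans xX; rewrite -(expR0 R) ler_expR le_max; apply/orP; left.
set g := l `^ (- c).
have g0 : 0 < g := powR_gt0 _ l0.
have C1g : C1 * g <= kappa / 2.
  have e0 : 0 <= 2 * C1 / kappa + 1 by rewrite addr_ge0 // divr_ge0 ?mulr_ge0 // ltW.
  have h : 2 * C1 / kappa + 1 <= l `^ c.
    have -> : 2 * C1 / kappa + 1 = l1 `^ c.
      by rewrite /l1 -powRrM mulVf ?gt_eqF // powRr1.
    by apply: ge0_ler_powR; rewrite ?nnegrE ?powR_ge0 ?(ltW l0) ?(ltW c0).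
  rewrite /g powRN ler_pdivrMr ?powR_gt0 //.
  have h2 : 2 * C1 / kappa <= l `^ c by lra.
  rewrite ler_pdivrMr // in h2; lra.
have gl : l^-1 <= g.
  by rewrite -powR_inv1 ?(ltW l0) // ler_powR; lra.
set w := (x / y) `^ tau0.
pose s z := S z * z `^ (- sigma).
have sE z : 0 < z -> S z = z `^ sigma * s z.
  by move=> z0; rewrite /s mulrCA powRN mulfV ?mulr1 // gt_eqF // powR_gt0.
have s_ge0 z : 0 <= s z by rewrite mulr_ge0 ?powR_ge0 ?summatory_ge0.
have NE : (y / x) `^ sigma * S x = y `^ sigma * s x.
  by rewrite powRM ?invr_ge0 ?(ltW x0) ?(ltW y0) // -[x^-1]powR_inv1 ?(ltW x0) // -powRrM mulN1r /s; ring.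
rewrite NE.
set C := tau0^-1 + Cm + D * Cu.
suff key : `|s y - s x| <= C * g * s x * w.
  rewrite (sE y y0) -mulrBr normrM (ger0_norm (powR_ge0 _ _)).
  apply: le_trans (ler_wpM2l (powR_ge0 _ _) key) _.
  by rewrite le_eqVlt; apply/orP; left; apply/eqP; ring.
have sx0 := s_ge0 x.
have T1 := log_mean_ge1 x1.
have Tx : T x <= 2 / kappa * (s x * l).
  have := H1 x; rewrite -/l -/(s x) -/g => /(_ _)/ler_normlP[|h _]; first by lra.
  have hh : T x * (C1 * g) <= T x * (kappa / 2) by rewrite ler_wpM2l //; lra.
  rewrite mulrAC ler_pdivlMr //; nra.
have w0 : 0 < w by rewrite powR_gt0 // divr_gt0.
have xy1 : 1 <= x / y by rewrite ler_pdivlMr // mul1r.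
have w1 : 1 <= w by rewrite powR_ge1 // ltW.
have lxy : ln (x / y) = l - ln y by rewrite ln_div ?posrE.
have wE : w = expR (tau0 * (l - ln y)) by rewrite /w powR_exp ?divr_gt0 // lxy.
have gw0 : 0 < g * w by rewrite mulr_gt0.
(* the target splits over the three ranges of y *)
have split1 : tau0^-1 * (g * w) * s x <= C * g * s x * w.
  have -> : C * g * s x * w = C * (g * w) * s x by ring.
  rewrite ler_wpM2r // ler_wpM2r ?(ltW gw0) // /C; have := mulr_ge0 D0 Cu0; lra.
have split2 : Cm * (g * w) * s x <= C * g * s x * w.
  have -> : C * g * s x * w = C * (g * w) * s x by ring.
  rewrite ler_wpM2r // ler_wpM2r ?(ltW gw0) // /C; have := mulr_ge0 D0 Cu0; lra.
have split3 : D * Cu * (g * w) * s x <= C * g * s x * w.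
  have -> : C * g * s x * w = C * (g * w) * s x by ring.
  rewrite ler_wpM2r // ler_wpM2r ?(ltW gw0) // /C; lra.
have [y1|y1] := ltP y 1.
  have -> : s y = 0.
    rewrite /s /summatory; have -> : Num.truncn y = 0%N.
      by apply/eqP; rewrite truncn_eq ?(ltW y0) // y1.
    by rewrite big_geq // mul0r.
  rewrite sub0r normrN ger0_norm //; apply: le_trans split1; rewrite ler_peMl //.
  have wx : tau0 * l <= w.
    apply: le_trans (ln_le_powR t0 x0) _; apply: ge0_ler_powR; rewrite ?nnegrE ?(ltW t0) ?divr_ge0 ?(ltW x0) ?(ltW y0) //.
    by rewrite ler_pdivlMr // ler_piMr ?(ltW x0) // ltW.
  have h : l^-1 * (tau0 * l) <= g * w.
    by apply: ler_pM; rewrite ?invr_ge0 ?mulr_ge0 ?(ltW l0) ?(ltW t0).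
  rewrite mulrCA mulVf ?gt_eqF // mulr1 in h.
  by rewrite -ler_pdivrMl ?invr_gt0 // invrK mulr1.
have ly0 : 0 <= ln y by rewrite ln_ge0.
have Tyx : T y <= T x := log_mean_mono yx.
have T1y := log_mean_ge1 y1.
have sT : s y <= T y.
  rewrite /s /T /summatory mulr_suml big_nat_cond [leRHS]big_nat_cond.
  apply: ler_sum => m /andP[/andP[m1 my] _]; have [m0 my' _] := in_range y1 m1 my.
  rewrite ler_wpM2l ?alpha_ge0 // !powRN lef_pV2 ?posrE ?powR_gt0 //.
  by apply: ge0_ler_powR; rewrite ?nnegrE ?(ltW sigma_gt0) ?(ltW y0) ?(ltW m0).
have [ysmall|ybig] := ltP (ln y) (l / 2).
  have wl : (tau0 * l / 4) ^+ 2 <= w.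
    have e1 : tau0 * l / 4 <= expR (tau0 * l / 4).
      by apply: le_trans (expR_ge1Dx _); lra.
    have e2 : 0 <= tau0 * l / 4 by rewrite divr_ge0 // mulr_ge0 // ltW.
    apply: (@le_trans _ _ (expR (tau0 * l / 4) ^+ 2)).
      by apply: lerXn2r; rewrite ?nnegrE ?expR_ge0.
    rewrite wE -expRM_natl ler_expR; nra.
  have h1 : tau0 ^+ 2 / 16 * l <= g * w.
    have : l^-1 * (tau0 * l / 4) ^+ 2 <= g * w.
      by apply: ler_pM; rewrite ?invr_ge0 ?sqr_ge0 ?(ltW l0).
    have -> : l^-1 * (tau0 * l / 4) ^+ 2 = tau0 ^+ 2 / 16 * l by field; rewrite gt_eqF.
    by [].
  have h2 : l <= 16 / tau0 ^+ 2 * (g * w).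
    have t2 : 0 < tau0 ^+ 2 / 16 by rewrite divr_gt0 // exprn_gt0.
    by rewrite -ler_pdivlMl // invf_div in h1.
  apply: le_trans split2; apply: (@le_trans _ _ (T x + s x)).
    apply: le_trans (ler_normB _ _) _; rewrite !ger0_norm // lerD2r.
    exact: le_trans sT Tyx.
  apply: (@le_trans _ _ ((1 + 2 / kappa) * l * s x)); last first.
    by rewrite /Cm ler_wpM2r // -!mulrA ler_wpM2l ?addr_ge0 ?divr_ge0 ?(ltW k0) // mulrA.
  have : s x <= l * s x by rewrite ler_peMl //; lra.
  rewrite mulrDl mul1r mulrDl; move: Tx; rewrite [s x * l]mulrC mulrA; lra.
have ly4 : 4 <= ln y by lra.
have lyp : 0 < ln y by lra.
have y2 : 2 <= y.
  rewrite -ler_ln ?posrE //; apply: le_trans (ln2_le1) _.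
  by apply: le_trans ly4; rewrite ler1n.
set u := 1 + ln (x / y).
have u1 : 1 <= u by rewrite lerDl ln_ge0.
have uw : u <= Cu * w by exact: log_le_powR.
apply: le_trans split3; apply: (@le_trans _ _ (D * (u * g * s x))); last first.
  have -> : D * Cu * (g * w) * s x = D * (Cu * w * g * s x) by ring.
  by rewrite ler_wpM2l // ler_wpM2r // ler_wpM2r // ltW.
have T0 : 0 <= T x by apply: le_trans T1.
have u0 : 0 <= u by apply: le_trans u1.
have gl2 : 2 / l <= 2 * g by rewrite ler_wpM2l.
have lyl : ln y <= l by rewrite ler_ln ?posrE.
have ly2 : (ln y)^-1 <= 2 / l.
  by rewrite -[2 / l]invf_div lef_pV2 ?posrE ?divr_gt0.
have E1 : `|s y * ln y - kappa * T y| <= T x * (2 * C1 * g).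
  have := H1 y ly4; rewrite -/(s y) => /le_trans; apply.
  have gy : ln y `^ (- c) <= 2 * g.
    have h : (l / 2) `^ c <= ln y `^ c.
      by apply: ge0_ler_powR; rewrite ?nnegrE ?(ltW c0) ?divr_ge0 ?(ltW l0) ?(ltW lyp).
    have h' : ln y `^ (- c) <= (l / 2) `^ (- c).
      by rewrite !powRN lef_pV2 ?posrE ?powR_gt0 ?divr_gt0.
    apply: le_trans h' _; rewrite powRM ?invr_ge0 ?(ltW l0) // -/g mulrC ler_wpM2r ?(ltW g0) //.
    by rewrite -[2^-1]powR_inv1 // -powRrM mulrNN mul1r -[leRHS]powRr1 // ler_powR // ler1n.
  apply: (@le_trans _ _ (C1 * (T x * (2 * g)))); last by rewrite le_eqVlt; apply/orP; left; apply/eqP; ring.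
  by rewrite ler_wpM2l //; apply: ler_pM; rewrite ?powR_ge0 //; lra.
have E2 : T x - T y <= T x * (2 * C3 * u * g).
  apply: le_trans (H3 x y y2 yx) _; rewrite -/u.
  apply: (@le_trans _ _ (C3 * (T x * u * (2 / l)))).
    by rewrite ler_wpM2l // ler_wpM2l // mulr_ge0.
  apply: (@le_trans _ _ (C3 * (T x * u * (2 * g)))); last by rewrite le_eqVlt; apply/orP; left; apply/eqP; ring.
  by rewrite ler_wpM2l // ler_wpM2l // mulr_ge0.
have E3 : s y * (l - ln y) <= T x * (2 * C2 * u * g).
  have h1 : s y <= C2 * T x * (2 / l).
    apply: (@le_trans _ _ (C2 * T x / ln y)); last by rewrite ler_wpM2l // mulr_ge0.
    rewrite ler_pdivlMr //; have := H2 y y1; rewrite (sE y y0) => h.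
    have ys : 0 < y `^ sigma by rewrite powR_gt0.
    have h' : s y * ln y <= C2 * T y.
      by rewrite -(ler_pM2l ys); apply: le_trans (le_trans h _); rewrite le_eqVlt; apply/orP; left; apply/eqP; ring.
    by apply: le_trans h' _; rewrite ler_wpM2l.
  have h2 : l - ln y <= u by rewrite -lxy /u lerDr.
  apply: (@le_trans _ _ (C2 * T x * (2 / l) * u)).
    by apply: ler_pM => //; rewrite subr_ge0.
  apply: (@le_trans _ _ (C2 * T x * (2 * g) * u)); last by rewrite le_eqVlt; apply/orP; left; apply/eqP; ring.
  by rewrite ler_wpM2r // ler_wpM2l // mulr_ge0.
have E4 : `|s x * l - kappa * T x| <= T x * (C1 * g).
  by have := H1 x; rewrite -/l -/(s x) -/g mulrCA; apply; lra.
have F : (s y - s x) * l = (s y * ln y - kappa * T y) + s y * (l - ln y)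
    - kappa * (T x - T y) - (s x * l - kappa * T x) by ring.
have Ebound : `|(s y - s x) * l| <= T x * ((3 * C1 + 2 * C2 + 2 * kappa * C3) * (u * g)).
  rewrite F; apply: le_trans (ler_normB _ _) _.
  apply: le_trans (lerD (ler_normB _ _) E4) _.
  have K3 : `|kappa * (T x - T y)| <= T x * (2 * kappa * C3 * u * g).
    rewrite normrM (gtr0_norm k0) ger0_norm; last by rewrite subr_ge0.
    apply: le_trans (ler_wpM2l (ltW k0) E2) _.
    by rewrite le_eqVlt; apply/orP; left; apply/eqP; ring.
  have K2 : `|s y * (l - ln y)| <= T x * (2 * C2 * u * g).
    by rewrite ger0_norm // mulr_ge0 // subr_ge0.
  apply: le_trans (lerD (lerD (le_trans (ler_normD _ _) (lerD E1 K2)) K3) (lexx _)) _.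
  rewrite -!mulrDr; apply: ler_wpM2l T0 _ _ _.
  have : C1 * g <= C1 * (u * g) by rewrite ler_wpM2l // ler_peMl // ltW.
  lra.
have l00 : 0 <= l by apply: ltW.
rewrite -(ler_pM2r l0) -{1}(ger0_norm l00) -normrM; apply: le_trans Ebound _.
have ug : 0 <= u * g by rewrite mulr_ge0 // ltW.
have D' : 0 <= 3 * C1 + 2 * C2 + 2 * kappa * C3.
  by rewrite !addr_ge0 ?mulr_ge0 ?(ltW k0).
apply: le_trans (ler_wpM2r (mulr_ge0 D' ug) Tx) _.
by rewrite le_eqVlt; apply/orP; left; apply/eqP; rewrite /D; ring.
Qed.

End Regularity.

(** * Sums over integers prime to a modulus *)

Section CoprimeSums.
Variables (R : realType) (alpha : nat -> R) (sigma rho0 L : R).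
Hypothesis sigma_gt0 : 0 < sigma.
Hypothesis rho0_01 : 0 <= rho0 < 1.
Hypothesis alpha_ge0 : forall n, (0 < n)%N -> 0 <= alpha n.
Hypothesis alpha_mul : Defs.multiplicative alpha.
Hypothesis alpha_pow : forall p k, prime p -> (0 < k)%N ->
  alpha (p ^ k)%N <= L * p%:R `^ ((rho0 + sigma - 1) * k%:R).

(** The exponent by which the comparison of [S y] with [S x] may deteriorate
    for small [y] while the sums over prime powers still converge. *)
Definition tilt : R := (1 - rho0) / 2.

Lemma tilt_bounds : 0 < tilt <= 1.
Proof. by rewrite /tilt; move: rho0_01 => /andP[h1 h2]; apply/andP; split; lra. Qed.

Definition local_mass (K p : nat) : R :=
  \sum_(1 <= nu < K) alpha (p ^ nu)%N * (p ^ nu)%:R `^ (- sigma).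

Let L0 : 0 <= L.
Proof. exact: prime_power_bound_ge0 alpha_ge0 alpha_pow. Qed.

Let ap p k : prime p -> 0 <= alpha (p ^ k)%N.
Proof. by move=> pp; apply: alpha_ge0; rewrite expn_gt0 prime_gt0. Qed.

Lemma local_mass_ge0 K p : prime p -> 0 <= local_mass K p.
Proof. by move=> pp; apply: sumr_ge0 => nu _; rewrite mulr_ge0 ?ap ?powR_ge0. Qed.

(** By the pointwise bound on prime powers this is at most a geometric series. *)
Lemma tilted_mass_le K p : prime p -> 2 <= p%:R `^ tilt ->
  \sum_(1 <= nu < K) alpha (p ^ nu)%N * (p ^ nu)%:R `^ (tilt - sigma) <=
    2 * L * p%:R `^ (- tilt).
Proof.
move=> pp pt.
have p0 : 0 < p%:R :> R by rewrite ltr0n prime_gt0.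
set y := p%:R `^ (- tilt).
have y0 : 0 < y := powR_gt0 _ p0.
have y2 : y <= 2^-1 by rewrite /y powRN lef_pV2 ?posrE ?powR_gt0.
apply: (@le_trans _ _ (\sum_(1 <= nu < K) L * y ^+ nu)).
  rewrite big_nat_cond [leRHS]big_nat_cond; apply: ler_sum => nu /andP[/andP[n1 _] _].
  have -> : L * y ^+ nu = (L * p%:R `^ ((rho0 + sigma - 1) * nu%:R)) *
     (p ^ nu)%:R `^ (tilt - sigma).
    rewrite natrX -[p%:R ^+ nu]powR_mulrn ?(ltW p0) // -[(p%:R `^ _) `^ _]powRrM -mulrA -powRD; last first.
      by apply/implyP => _; rewrite gt_eqF.
    rewrite /y -powR_mulrn ?powR_ge0 // -powRrM; congr (_ * _ `^ _).
    by rewrite /tilt; field.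
  by rewrite ler_wpM2r ?powR_ge0 // alpha_pow.
rewrite -mulr_sumr [2 * L]mulrC -mulrA; apply: ler_wpM2l L0 _ _ _.
case: K => [|K]; first by rewrite big_geq // mulr_ge0 // ltW.
rewrite big_add1 /= big_mkord.
under eq_bigr => i _ do rewrite exprS.
rewrite -mulr_sumr mulrC ler_wpM2r ?(ltW y0) //.
have y1 : 0 < 1 - y by lra.
rewrite -(ler_pM2l y1).
have -> : (1 - y) * (\sum_(i < K) y ^+ i) = 1 - y ^+ K.
  rewrite -[in RHS](expr1n _ K) subrXX; congr (_ * _); apply: eq_bigr => i _.
  by rewrite expr1n mul1r.
have : 0 <= y ^+ K by rewrite exprn_ge0 // ltW.
lra.
Qed.

Lemma local_mass_le K p : prime p -> 2 <= p%:R `^ tilt ->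
  local_mass K p <= 2 * L * p%:R `^ (- tilt).
Proof.
move=> pp pt; apply: le_trans (tilted_mass_le K pp pt).
apply: ler_sum => nu _; rewrite ler_wpM2l ?ap //.
have p1 : 1 <= (p ^ nu)%:R :> R by rewrite ler1n expn_gt0 prime_gt0.
by rewrite ler_powR //; have /andP[? _] := tilt_bounds; lra.
Qed.

Variables (x eta : R) (K : nat).
Hypothesis x1 : 1 <= x.
Hypothesis eta0 : 0 <= eta.
Hypothesis xK : forall p, prime p -> (Num.truncn x < p ^ K)%N.
Notation S := (summatory alpha).
Let N (y : R) : R := (y / x) `^ sigma * S x.
Hypothesis S_regular : forall y, 0 < y -> y <= x ->
  `|S y - N y| <= eta * N y * (x / y) `^ tilt.

Definition good_prime (p : nat) : Prop :=
  [/\ prime p, 2 <= p%:R `^ tilt & 4 * L <= p%:R `^ tilt].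

(** The proportion of the weight carried by the integers prime to [s]: an
    Euler product truncated at exponents that no integer up to [x] reaches. *)
Definition mean_factor (s : seq nat) : R := \prod_(p <- s) (1 + local_mass K p)^-1.

Let tilted_half p : good_prime p ->
  \sum_(1 <= nu < K) alpha (p ^ nu)%N * (p ^ nu)%:R `^ (tilt - sigma) <= 2^-1.
Proof.
move=> [pp p2 p4]; apply: le_trans (tilted_mass_le K pp p2) _.
have p0 : 0 < p%:R :> R by rewrite ltr0n prime_gt0.
rewrite powRN ler_pdivrMr ?powR_gt0 //; lra.
Qed.

Let mean_factor_bounds s : (forall p, p \in s -> prime p) -> 0 <= mean_factor s <= 1.
Proof.
elim: s => [|p s IH] ps; first by rewrite /mean_factor big_nil ler01 lexx.
have /andP[h0 h1] : 0 <= mean_factor s <= 1.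
  by apply: IH => q qs; apply: ps; rewrite in_cons qs orbT.
rewrite /mean_factor big_cons -/(mean_factor s).
have m0 := local_mass_ge0 K (ps p (mem_head _ _)).
have v1 : (1 + local_mass K p)^-1 <= 1 by rewrite invf_le1; lra.
have v0 : 0 <= (1 + local_mass K p)^-1 by rewrite invr_ge0; lra.
by rewrite mulr_ge0 //= mulr_ile1.
Qed.

Let N0 y : 0 <= N y.
Proof. by rewrite mulr_ge0 ?powR_ge0 // summatory_ge0. Qed.

Let summatoryE y : S y = coprime_sum alpha 1 (Num.truncn y).
Proof. by rewrite coprime_sum1. Qed.

(** Removing one prime at a time: the error at [y] is controlled by the previous
    error at [y] and by the new error at [y / p ^ nu], which closes on itself
    because the tilted local mass is at most one half. *)
Lemma coprime_sum_asymp (s : seq nat) : uniq s -> (forall p, p \in s -> good_prime p) ->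
  forall y, 0 < y -> y <= x ->
  `|coprime_sum alpha (\prod_(p <- s) p) (Num.truncn y) - mean_factor s * N y| <=
    2 ^+ size s * (eta * N y * (x / y) `^ tilt).
Proof.
elim: s => [|p s IH] us gs y y0 yx.
  by rewrite /mean_factor !big_nil mul1r expr0 mul1r -summatoryE; exact: S_regular.
have x0 : 0 < x by apply: lt_le_trans x1.
move: us => /= /andP[ps us].
have gs' q : q \in s -> good_prime q by move=> qs; apply: gs; rewrite in_cons qs orbT.
have {}IH := IH us gs'.
have gp := gs p (mem_head _ _).
have pp : prime p by case: gp.
have p0 := prime_gt0 pp.
set q := \prod_(j <- s) j in IH.
have prq : coprime p q.
  rewrite /q big_seq; elim/big_rec : _ => [|j a js pa]; first exact: coprimen1.
  rewrite coprimeMr pa andbT prime_coprime //.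
  have [pj _ _] := gs' j js; rewrite dvdn_prime2 //.
  by apply: contraNneq ps => ->.
rewrite big_cons -/q /=.
set k := size s in IH *.
set pi' := mean_factor (p :: s).
set ap1 := 1 + local_mass K p.
have m0 := local_mass_ge0 K pp.
have ap1_gt0 : 0 < ap1 by rewrite /ap1; lra.
have piE : mean_factor s = pi' * ap1.
  by rewrite /pi' /mean_factor big_cons mulrAC mulVf ?mul1r // gt_eqF.
have pi01 : 0 <= pi' <= 1.
  apply: mean_factor_bounds => j js; by have [] := gs j js.
pose w y := (x / y) `^ tilt.
pose e y := coprime_sum alpha (p * q) (Num.truncn y) - pi' * N y.
rewrite -/(e y) -/(w y).
have w_ge0 z : 0 <= w z by exact: powR_ge0.
have [n] := ubnP (Num.truncn y); elim: n y y0 yx => // n IHn y y0 yx yn.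
have [y1|y1] := ltP y 1.
  have ty : Num.truncn y = 0%N by apply/eqP; rewrite truncn_eq ?(ltW y0) // y1.
  have h := S_regular y0 yx.
  rewrite summatoryE ty /coprime_sum big_geq // sub0r normrN ger0_norm // in h.
  rewrite /e ty /coprime_sum big_geq // sub0r normrN ger0_norm; last first.
    by rewrite mulr_ge0 //; case/andP: pi01.
  apply: (@le_trans _ _ (N y)); first by rewrite ler_piMl //; case/andP: pi01.
  apply: le_trans h _; rewrite ler_peMl ?exprn_ege1 ?ler1n //.
  exact: mulr_ge0 (mulr_ge0 eta0 (N0 y)) (w_ge0 y).
have P0 nu : 0 < (p ^ nu)%:R :> R by rewrite ltr0n expn_gt0 p0.
have NP nu : N (y / (p ^ nu)%:R) = (p ^ nu)%:R `^ (- sigma) * N y.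
  rewrite /N mulrAC [(y / x / _) `^ _]powRM ?invr_ge0 ?divr_ge0 ?(ltW (P0 _)) ?(ltW y0) ?(ltW x0) //.
  by rewrite -[(_%:R)^-1]powR_inv1 ?(ltW (P0 _)) // -powRrM mulN1r; ring.
have wP nu : w (y / (p ^ nu)%:R) = (p ^ nu)%:R `^ tilt * w y.
  by rewrite /w invf_div mulrCA [(_ * (x / y)) `^ _]powRM ?divr_ge0 ?(ltW (P0 _)) ?(ltW y0) ?(ltW x0).
have tx : (Num.truncn y < p ^ K)%N.
  by apply: leq_ltn_trans (xK pp); exact: le_truncn.
have K0 : (0 < K)%N.
  by case: (K) (xK pp) => [|//]; rewrite expn0 ltnS leqNgt truncn_gt0 x1.
have split_e : coprime_sum alpha q (Num.truncn y) - mean_factor s * N y =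
    e y + \sum_(1 <= nu < K) alpha (p ^ nu)%N * e (y / (p ^ nu)%:R).
  rewrite (coprime_sum_split alpha_mul pp prq tx) big_ltn // expn0 divn1 alpha_mul.1 mul1r.
  rewrite piE /ap1 mulrDr mulr1 mulrDl /local_mass.
  have -> : \sum_(1 <= nu < K) alpha (p ^ nu)%N * e (y / (p ^ nu)%:R) =
    \sum_(1 <= nu < K) alpha (p ^ nu)%N * coprime_sum alpha (p * q) (Num.truncn y %/ p ^ nu)
    - pi' * (\sum_(1 <= nu < K) alpha (p ^ nu)%N * (p ^ nu)%:R `^ (- sigma)) * N y.
    rewrite mulr_sumr mulr_suml -sumrB; apply: eq_bigr => nu _.
    rewrite /e NP truncn_div ?(ltW y0) ?expn_gt0 ?p0 //; ring.
  by rewrite /e; ring.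
have eE : e y = (coprime_sum alpha q (Num.truncn y) - mean_factor s * N y) -
    \sum_(1 <= nu < K) alpha (p ^ nu)%N * e (y / (p ^ nu)%:R) by rewrite split_e; ring.
rewrite eE; apply: le_trans (ler_normB _ _) _.
have main : `|\sum_(1 <= nu < K) alpha (p ^ nu)%N * e (y / (p ^ nu)%:R)| <=
    2^-1 * (2 ^+ k.+1 * (eta * N y * w y)).
  apply: le_trans (ler_norm_sum _ _ _) _.
  apply: (@le_trans _ _ (\sum_(1 <= nu < K) (alpha (p ^ nu)%N * (p ^ nu)%:R `^ (tilt - sigma)) *
     (2 ^+ k.+1 * (eta * N y * w y)))).
    rewrite big_nat_cond [leRHS]big_nat_cond; apply: ler_sum => nu /andP[/andP[n1 _] _].
    rewrite normrM ger0_norm ?ap // -mulrA ler_wpM2l ?ap //.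
    have P1 : 1 <= (p ^ nu)%:R :> R by rewrite ler1n expn_gt0 p0.
    have yP : y / (p ^ nu)%:R <= y by rewrite ler_pdivrMr // ler_peMr // ltW.
    have ht : (Num.truncn (y / (p ^ nu)%:R) < n)%N.
      rewrite truncn_div ?(ltW y0) ?expn_gt0 ?p0 //.
      have ty : (0 < Num.truncn y)%N by rewrite truncn_gt0.
      have p1n : (1 < p ^ nu)%N by rewrite -(expn0 p) ltn_exp2l // prime_gt1.
      have := ltn_Pdiv p1n ty; move: yn; rewrite ltnS => yn' h.
      exact: leq_trans h yn'.
    have := IHn _ (divr_gt0 y0 (P0 nu)) (le_trans yP yx) ht => /le_trans; apply.
    rewrite NP wP le_eqVlt; apply/orP; left; apply/eqP.
    rewrite [tilt - sigma]addrC powRD; last by apply/implyP => _; rewrite gt_eqF.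
    by ring.
  rewrite -mulr_suml ler_wpM2r ?tilted_half //.
  by apply: mulr_ge0; [exact: exprn_ge0|exact: mulr_ge0 (mulr_ge0 eta0 (N0 y)) (w_ge0 y)].
apply: le_trans (lerD (IH y y0 yx) main) _.
rewrite -/(w y) exprS; move: (2 ^+ k) (eta * N y * w y) => a b; lra.
Qed.

End CoprimeSums.

(** * Zeros of a polynomial to squarefree moduli *)

Section PolynomialValues.
Variable g : {poly rat}.
Hypothesis g_nonconst : (1 < size g)%N.
Hypothesis g0 : g.[0] != 0.
Hypothesis g_pos : maps_pos_to_pos g.

Lemma cden_gt0 : (0 < cden g)%N.
Proof. by rewrite /cden; case: ex_minnP => c /andP[]. Qed.

Lemma cleared_horner (z : int) :
  (cleared g).[z]%:~R = (cden g)%:R * g.[z%:~R] :> rat.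
Proof. by rewrite -horner_map /= map_cleared hornerZ. Qed.

Lemma size_cleared : size (cleared g) = size g.
Proof.
rewrite -(size_map_inj_poly (f := intr : int -> rat)) //; last exact: intr_inj.
by rewrite map_cleared size_scale // pnatr_eq0 -lt0n cden_gt0.
Qed.

Lemma natvalP n : (0 < n)%N ->
  (0 < natval g n)%N /\ (cleared g).[n%:Z] = (cden g * natval g n)%N%:Z.
Proof.
move=> n0; have [k k0 gk] := g_pos n0.
have -> : natval g n = k by rewrite /natval gk natrK.
split=> //; apply: (@intr_inj rat).
rewrite cleared_horner gk.
by rewrite PoszM intrM.
Qed.

Lemma natval_gt0 n : (0 < n)%N -> (0 < natval g n)%N.
Proof. by move=> /natvalP[]. Qed.

(** Beyond this bound no prime divides the denominator, the leading
    coefficient or the constant term of the cleared polynomial. *)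
Definition bad_bound : nat :=
  (cden g + `|lead_coef (cleared g)| + `|(cleared g).[0]|)%N.+1.

Lemma lead_cleared_neq0 : lead_coef (cleared g) != 0.
Proof. by rewrite lead_coef_eq0 -size_poly_eq0 size_cleared; case: (size g) g_nonconst. Qed.

Lemma cleared0_neq0 : (cleared g).[0] != 0.
Proof.
apply: contraNneq g0 => e; have := cleared_horner 0; rewrite e.
by move/esym/eqP; rewrite mulf_eq0 pnatr_eq0 -(negbK (cden g == 0)%N) -lt0n cden_gt0.
Qed.

Lemma dvdn_bad p k : (bad_bound <= p)%N -> (0 < k)%N ->
  (k <= cden g + `|lead_coef (cleared g)| + `|(cleared g).[0]|)%N -> ~~ (p %| k)%N.
Proof.
move=> bp k0 kb; apply/negP => /(dvdn_leq k0) pk.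
by move: (leq_trans bp (leq_trans pk kb)); rewrite /bad_bound ltnn.
Qed.

Lemma coprime_cden p : prime p -> (bad_bound <= p)%N -> coprime p (cden g).
Proof.
move=> pp bp; rewrite prime_coprime //; apply: dvdn_bad => //; first exact: cden_gt0.
by rewrite -addnA leq_addr.
Qed.

Lemma ndvd_cleared0 p : (bad_bound <= p)%N -> ~~ (p %| `|(cleared g).[0]|)%N.
Proof.
move=> bp; apply: dvdn_bad => //; first by rewrite absz_gt0 cleared0_neq0.
by rewrite leq_addl.
Qed.

Lemma horner_sub_dvd (P : {poly int}) (x y : int) : (x - y %| P.[x] - P.[y])%Z.
Proof.
elim/poly_ind: P => [|P a IH]; first by rewrite !horner0 subrr dvdz0.
rewrite !hornerMXaddC.
have -> : P.[x] * x + a - (P.[y] * y + a) = (P.[x] - P.[y]) * x + P.[y] * (x - y).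
  by ring.
by apply: rpredD; [apply: dvdz_mulr|apply: dvdz_mull].
Qed.

Lemma horner_mod (P : {poly int}) (q n : nat) :
  (q%:Z %| P.[n%:Z])%Z = (q%:Z %| P.[(n %% q)%N%:Z])%Z.
Proof.
have d : (q%:Z %| P.[n%:Z] - P.[(n %% q)%N%:Z])%Z.
  apply: dvdz_trans (horner_sub_dvd _ _ _).
  rewrite {1}(divn_eq n q) PoszD PoszM addrK; exact: dvdz_mull.
by rewrite -[P.[n%:Z]](subrK (P.[(n %% q)%N%:Z])) rpredDl.
Qed.

(** The cleared polynomial does not vanish modulo [p], so it has at most as
    many roots in the prime field as its degree. *)
Lemma rho_le p : prime p -> (bad_bound <= p)%N -> (rho g p <= (size g).-1)%N.
Proof.
move=> pp bp; rewrite /rho coprime_cden //.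
set A := [set i : 'I_p | _]%SET.
have ch := pchar_Fp pp.
pose P : {poly 'F_p} := map_poly intr (cleared g).
have Pn : P != 0.
  apply/eqP => /(congr1 (fun P : {poly 'F_p} => P`_(size (cleared g)).-1)).
  rewrite coef_map coef0 => /eqP; rewrite -/(lead_coef (cleared g)) -(dvdz_pcharf ch).
  rewrite dvdzE; apply/negP; apply: dvdn_bad => //.
    by rewrite absz_gt0 lead_cleared_neq0.
  by rewrite addnAC leq_addl.
pose rs : seq 'F_p := [seq (nat_of_ord i)%:R | i <- enum A].
have sz : size rs = #|A| by rewrite size_map -cardE.
have lt : (size rs < size P)%N.
  apply: max_poly_roots => //.
    apply/allP => _ /mapP[i iA ->]; rewrite /root.
    rewrite -[_%:R]/((i : nat)%:Z%:~R) horner_map /= -(dvdz_pcharf ch).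
    by move: iA; rewrite mem_enum inE.
  rewrite map_inj_uniq ?enum_uniq // => i j /(congr1 val) /=.
  by rewrite !val_Fp_nat // !modn_small // => /val_inj.
rewrite -sz -ltnS (leq_trans lt) //.
by rewrite prednK ?(ltn_trans _ g_nonconst) // -size_cleared size_poly.
Qed.

Definition zero_class (q n : nat) : bool :=
  [&& coprime q (cden g), coprime n q & (q%:Z %| (cleared g).[n%:Z])%Z].

Lemma zero_class_mod q n : zero_class q (n %% q) = zero_class q n.
Proof. by rewrite /zero_class coprime_modl -horner_mod. Qed.

Lemma zero_class_mul q1 q2 n : coprime q1 q2 ->
  zero_class (q1 * q2) n = zero_class q1 n && zero_class q2 n.
Proof.
move=> co; rewrite /zero_class coprimeMl coprimeMr PoszM Gauss_dvdz ?coprimezE //.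
by case: (coprime q1 _); case: (coprime q2 _); case: (coprime n q1);
   case: (coprime n q2); rewrite /= ?andbF.
Qed.

Lemma card_ZstarE q : #|Zstar g q| = (\sum_(a < q) zero_class q a)%N.
Proof. by rewrite /Zstar cardsE -sum1_card big_mkcond. Qed.

(** Chinese remainder theorem. *)
Lemma card_Zstar_mul q1 q2 : coprime q1 q2 -> (0 < q1)%N -> (0 < q2)%N ->
  #|Zstar g (q1 * q2)| = (#|Zstar g q1| * #|Zstar g q2|)%N.
Proof.
move=> co q10 q20; rewrite !card_ZstarE.
have n0 : (0 < q1 * q2)%N by rewrite muln_gt0 q10.
pose in_mod k (k0 : (k > 0)%N) d := Ordinal (ltn_pmod d k0).
pose h (d : 'I_(q1 * q2)) := (in_mod _ q10 d, in_mod _ q20 d).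
pose h' (d : 'I_q1 * 'I_q2) := in_mod _ n0 (chinese q1 q2 d.1 d.2).
rewrite big_distrlr /= pair_big /= (reindex_onto h h') => [|[d d'] _].
  rewrite [RHS]big_mkcond [LHS]big_mkcond; apply: eq_bigr => -[d ltd] _ /=.
  rewrite -val_eqE /= -chinese_mod // modn_small // eqxx.
  by rewrite !zero_class_mod zero_class_mul //; do 2 case: zero_class.
apply/eqP; rewrite /eq_op /= /eq_op /= !modn_dvdm ?(dvdn_mulr _ (dvdnn _)) ?(dvdn_mull _ (dvdnn _)) //.
by rewrite chinese_modl // chinese_modr // !modn_small ?eqxx ?ltn_ord.
Qed.

(** A zero divisible by [p] would force [p] to divide the constant term. *)
Lemma zero_class_prime p n : prime p -> (bad_bound <= p)%N ->
  zero_class p n = (p%:Z %| (cleared g).[n%:Z])%Z.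
Proof.
move=> pp bp; rewrite /zero_class coprime_cden //=.
case: (boolP (coprime n p)) => //=; rewrite coprime_sym prime_coprime // negbK.
move=> pn; rewrite horner_mod (eqP (_ : (n %% p == 0)%N)) //.
by rewrite dvdzE /= (negbTE (ndvd_cleared0 bp)).
Qed.

Lemma card_Zstar_prime p : prime p -> (bad_bound <= p)%N -> #|Zstar g p| = rho g p.
Proof.
move=> pp bp; rewrite /rho coprime_cden //; apply: eq_card => i.
by rewrite !inE -/(zero_class p i) zero_class_prime.
Qed.

Definition large_primes (s : seq nat) : bool :=
  uniq s && all (fun p => prime p && (bad_bound <= p)%N) s.

Lemma coprime_prod_primes p s : prime p -> p \notin s -> all prime s ->
  coprime p (\prod_(i <- s) i).
Proof.
move=> pp; elim: s => [|a s IH]; first by rewrite big_nil coprimen1.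
rewrite inE negb_or => /andP[pa ps] /= /andP[ap sp].
by rewrite big_cons coprimeMr IH // andbT prime_coprime // dvdn_prime2.
Qed.

Lemma large_primes_cons a s : large_primes (a :: s) ->
  [/\ prime a, (bad_bound <= a)%N, coprime a (\prod_(i <- s) i) & large_primes s].
Proof.
rewrite /large_primes /= => /andP[/andP[as_ us] /andP[/andP[ap ab] sp]].
split=> //; last by rewrite us.
by apply: coprime_prod_primes => //; apply/allP => i /(allP sp) /andP[].
Qed.

Lemma large_primes_prod_gt0 s : large_primes s -> (0 < \prod_(p <- s) p)%N.
Proof.
move=> /andP[_ /allP sp]; rewrite big_seq; apply: prodn_cond_gt0 => i /sp /andP[ip _].
exact: prime_gt0.
Qed.

Lemma card_Zstar_prod s : large_primes s ->
  #|Zstar g (\prod_(p <- s) p)%N| = (\prod_(p <- s) rho g p)%N.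
Proof.
elim: s => [|a s IH].
  move=> _; rewrite !big_nil card_ZstarE big_ord1 /zero_class /= coprime1n /=.
  by rewrite dvd1z.
move=> als; have [ap ab co ls] := large_primes_cons als.
rewrite !big_cons card_Zstar_mul ?(prime_gt0 ap) ?large_primes_prod_gt0 //.
by rewrite card_Zstar_prime // IH.
Qed.

Lemma totient_prod s : large_primes s ->
  totient (\prod_(p <- s) p)%N = (\prod_(p <- s) p.-1)%N.
Proof.
elim: s => [|a s IH] als; first by rewrite !big_nil.
have [ap ab co ls] := large_primes_cons als.
by rewrite !big_cons totient_coprime // IH // totient_prime.
Qed.

(** The conditions on the residue of [n] are local, and for a large prime [p]
    they amount to [p] dividing [g n], since [p] does not divide the
    denominator. *)
Lemma zero_class_prod s n : large_primes s -> (0 < n)%N ->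
  zero_class (\prod_(p <- s) p)%N n = (\prod_(p <- s) p %| natval g n)%N.
Proof.
move=> + n0; elim: s => [|a s IH] als.
  by rewrite !big_nil /zero_class coprime1n coprimen1 !dvd1n dvd1z.
have [ap ab co ls] := large_primes_cons als.
rewrite !big_cons zero_class_mul // Gauss_dvd // IH // zero_class_prime //.
have [_ ->] := natvalP n0.
by rewrite dvdzE /= Gauss_dvdr // coprime_cden.
Qed.

Lemma sum_divisible (R : realType) (F : nat -> R) s N : large_primes s ->
  \sum_(1 <= n < N | (\prod_(p <- s) p %| natval g n)%N) F n =
  \sum_(a in Zstar g (\prod_(p <- s) p)%N)
    \sum_(1 <= n < N | (n%:Z == (a : nat)%:Z %[mod (\prod_(p <- s) p)%N%:Z])%Z) F n.
Proof.
move=> ls; set q := (\prod_(p <- s) p)%N.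
have q0 : (0 < q)%N := large_primes_prod_gt0 ls.
under [RHS]eq_bigr => a _ do rewrite big_mkcond.
rewrite exchange_big /= big_mkcond big_nat_cond [RHS]big_nat_cond.
apply: eq_bigr => n /andP[/andP[n1 _] _].
have inZ (a : 'I_q) : (a \in Zstar g q) = zero_class q a by rewrite inE.
have eqm (a : 'I_q) : (n%:Z == (a : nat)%:Z %[mod q%:Z])%Z = (a == Ordinal (ltn_pmod n q0)).
  by rewrite !modz_nat eqz_nat eq_sym modn_small // ; exact: val_eqE.
under eq_bigr => a _ do rewrite eqm.
rewrite -big_mkcondr /= big_mkcond (bigD1 (Ordinal (ltn_pmod n q0))) //= big1 ?addr0.
  by rewrite inZ eqxx andbT /= zero_class_mod zero_class_prod.
by move=> i /negbTE ->; rewrite andbF.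
Qed.

End PolynomialValues.

(** * Prime factors of polynomial values and the level sum *)

Lemma natval_le g n : maps_pos_to_pos g -> (0 < n)%N ->
  (natval g n)%:Z <= (\sum_(i < size (cleared g)) `|(cleared g)`_i|) * n%:Z ^+ size (cleared g).
Proof.
move=> gp n0; have [_ E] := natvalP gp n0.
apply: (@le_trans _ _ `|(cleared g).[n%:Z]|).
  by rewrite E PoszM normrM ger0_norm // ger0_norm // ler_peMl // lez_nat cden_gt0.
rewrite horner_coef; apply: le_trans (ler_norm_sum _ _ _) _; rewrite mulr_suml.
apply: ler_sum => i _; rewrite normrM ler_wpM2l // normrX ger0_norm //.
by apply: ler_weXn2l => //; exact: ltnW.
Qed.

Lemma strongly_additive_prod (R : realType) (f : nat -> R) (s : seq nat) (e : nat -> nat) :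
  strongly_additive f -> uniq s -> all prime s -> {in s, forall p, (0 < e p)%N} ->
  f (\prod_(p <- s) p ^ e p)%N = \sum_(p <- s) f p.
Proof.
move=> [fM fp] ; elim: s => [|a s IH].
  move=> _ _ _; rewrite !big_nil.
  have := fM 1%N 1%N isT isT (coprime1n 1); rewrite muln1 => /eqP.
  by rewrite -subr_eq0 opprD addNKr oppr_eq0 => /eqP.
move=> /= /andP[as_ us] /andP[ap sp] e0; rewrite !big_cons.
have pr i : i \in s -> prime i by move=> /(allP sp).
rewrite fM ?expn_gt0 ?(prime_gt0 ap) //; last 2 first.
- by rewrite big_seq; apply: prodn_cond_gt0 => i /pr ip; rewrite expn_gt0 prime_gt0.
- rewrite coprimeXl // big_seq; apply: (big_ind (coprime a)); first exact: coprimen1.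
    by move=> x y xa ya; rewrite coprimeMr xa.
  move=> i is_; apply: coprimeXr; rewrite prime_coprime // dvdn_prime2 ?(pr i is_) //.
  by apply/eqP => ai; move: as_; rewrite ai is_.
rewrite fp ?(e0 _ (mem_head _ _)) // IH // => i is_; apply: e0.
by rewrite inE is_ orbT.
Qed.

Lemma strongly_additiveE (R : realType) (f : nat -> R) k :
  strongly_additive f -> (0 < k)%N -> f k = \sum_(p <- primes k) f p.
Proof.
move=> fa k0; rewrite {1}(prod_prime_decomp k0) prime_decompE big_map /=.
apply: strongly_additive_prod => //; first exact: primes_uniq.
  by apply/allP => p; rewrite mem_primes => /andP[].
by move=> p; rewrite logn_gt0.
Qed.

Lemma logn_prod_primes s p : uniq s -> all prime s -> prime p ->
  logn p (\prod_(i <- s) i)%N = (p \in s).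
Proof.
move=> + + pp; elim: s => [|a s IH]; first by rewrite big_nil logn1.
move=> /= /andP[as_ us] /andP[ap sp]; rewrite big_cons lognM ?(prime_gt0 ap) //.
  rewrite IH // logn_prime // inE.
  case: eqVneq => [->|]; first by rewrite (negbTE as_).
  by rewrite add0n.
by rewrite big_seq; apply: prodn_cond_gt0 => i /(allP sp); apply: prime_gt0.
Qed.

(** The product of these primes divides [k] and exceeds [z ^ size s]. *)
Lemma prime_count_le (R : realType) (s : seq nat) (k : nat) (z : R) :
  1 <= z -> uniq s -> all prime s -> all (fun p => (p %| k)%N) s ->
  all (fun p : nat => z < p%:R) s -> (0 < k)%N ->
  (size s)%:R * ln z <= ln (k%:R : R).
Proof.
move=> z1 us sp sk sz k0.
have z0 : 0 < z by lra.
apply: (@le_trans _ _ (ln ((\prod_(p <- s) p)%N%:R : R))); last first.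
  rewrite ler_ln ?posrE ?ltr0n //; last first.
    by rewrite big_seq; apply: prodn_cond_gt0 => i /(allP sp); apply: prime_gt0.
  by rewrite ler_nat dvdn_leq // prod_primes_dvd.
rewrite mulr_natl -lnXn // ler_ln ?posrE ?exprn_gt0 // ?ltr0n; last first.
  by rewrite big_seq; apply: prodn_cond_gt0 => i /(allP sp); apply: prime_gt0.
elim: s sz {us sp sk} => [|a s IH] /=; first by rewrite big_nil expr0.
move=> /andP[za sz]; rewrite big_cons natrM exprS; apply: ler_pM => //; try lra.
- by rewrite exprn_ge0 // ltW.
- exact: IH.
Qed.

Lemma sum_subset_le (R : realType) (s t : seq nat) (F : nat -> R) :
  uniq s -> uniq t -> {subset s <= t} -> (forall n, 0 <= F n) ->
  \sum_(n <- s) F n <= \sum_(n <- t) F n.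
Proof.
move=> us ut st F0; rewrite [leRHS](bigID (mem s)) /= -[leLHS]addr0 lerD ?sumr_ge0 //.
rewrite -[leRHS]big_filter le_eqVlt; apply/orP; left; apply/eqP/perm_big.
apply: uniq_perm => //; first exact: filter_uniq.
by move=> n; rewrite mem_filter; case: (boolP (n \in s)) => //= /st ->.
Qed.

Section Level.
Variables (R : realType) (alpha : nat -> R) (g : {poly rat}).
Variables (x d : R) (m N : nat) (P : {set 'I_N}).
Hypothesis P_primes : forall i, i \in P -> prime i /\ (nat_of_ord i)%:R <= x `^ (d / m%:R).
Hypothesis level1 : 1 <= x `^ (d / m%:R).

Definition modulus (T : {set 'I_N}) : nat := (\prod_(i in T) nat_of_ord i)%N.

Definition ord_list (T : {set 'I_N}) : seq nat := [seq nat_of_ord i | i <- enum T].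

Lemma ord_list_uniq T : uniq (ord_list T).
Proof. by rewrite map_inj_uniq ?enum_uniq //; exact: val_inj. Qed.

Lemma mem_ord_list T (i : 'I_N) : (nat_of_ord i \in ord_list T) = (i \in T).
Proof. by rewrite mem_map ?mem_enum //; exact: val_inj. Qed.

Lemma size_ord_list T : size (ord_list T) = #|T|.
Proof. by rewrite size_map -cardE. Qed.

Lemma modulusE T : modulus T = (\prod_(p <- ord_list T) p)%N.
Proof. by rewrite /modulus /ord_list big_map big_enum. Qed.

Lemma ord_list_primes (T : {set 'I_N}) : T \subset P -> all prime (ord_list T).
Proof.
move=> /fintype.subsetP TP; apply/allP => _ /mapP[i + ->]; rewrite mem_enum => /TP.
by move=> /P_primes[].
Qed.

Lemma modulus_gt0 (T : {set 'I_N}) : T \subset P -> (0 < modulus T)%N.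
Proof.
move=> /fintype.subsetP TP; apply: prodn_cond_gt0 => i /TP /P_primes[ip _]; exact: prime_gt0.
Qed.

Lemma primes_modulus (T : {set 'I_N}) : T \subset P -> primes (modulus T) =i ord_list T.
Proof.
move=> TP p; case: (boolP (prime p)) => [pp|np].
  rewrite -logn_gt0 modulusE logn_prod_primes ?ord_list_uniq ?ord_list_primes //.
  by case: (p \in _).
rewrite mem_primes (negbTE np) /=; apply/esym/negbTE.
by apply: contra np => /(allP (ord_list_primes TP)).
Qed.

Lemma moebius_modulus (T : {set 'I_N}) : T \subset P -> (moebius (modulus T)) ^+ 2 = 1.
Proof.
move=> TP; rewrite /moebius ifT ?sqrr_sign //; last first.
  apply/allP => p pm; have pp : prime p by move: pm; rewrite mem_primes => /andP[].
  move: (pm); rewrite primes_modulus // modulusE => pT.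
  by rewrite logn_prod_primes ?ord_list_uniq ?ord_list_primes // pT.
Qed.

Lemma modulus_inj : {in [pred T : {set 'I_N} | T \subset P] &, injective modulus}.
Proof.
move=> T U TP UP E; apply/setP => i.
have := primes_modulus TP i; rewrite E primes_modulus //.
by rewrite !mem_ord_list.
Qed.

(** Distinct sets of primes have distinct products, which are squarefree
    moduli of the level sum. *)
Lemma level_sum_ge :
  \sum_(T : {set 'I_N} | (T \subset P) && (#|T| <= m)%N)
    \sum_(a in Zstar g (modulus T)) `|discrepancy alpha x (modulus T) (a : nat)%:Z|
  <= level_sum alpha g x d m.
Proof.
pose W q : R := (moebius q)%:~R ^+ 2 * \sum_(a in Zstar g q) `|discrepancy alpha x q (a : nat)%:Z|.
have W0 q : 0 <= W q by rewrite mulr_ge0 ?sqr_ge0 ?sumr_ge0.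
rewrite (eq_bigr (fun T => W (modulus T))); last first.
  by move=> T /andP[TP _]; rewrite /W -rmorphXn /= moebius_modulus // mul1r.
rewrite /level_sum; set A := [set q : nat | _].
change (\sum_(T : {set 'I_N} | (T \subset P) && (#|T| <= m)%N) W (modulus T) <= \sum_(q \in A) W q).
have fA : finite_set (A `&` W @^-1` [set~ 0]).
  apply: sub_finite_set (finite_level_support (x `^ (d / m%:R))).
  move=> q [] /= [q0 _ qx] Wq; split=> //; split=> //.
  by apply: contra_notN Wq => /eqP mq; rewrite /W mq expr0n /= mul0r.
rewrite fsbig_supp (fsbig_finite _ _ fA) /= -big_enum_cond -big_filter -(big_map modulus xpredT W).
rewrite (bigID (fun q => W q == 0)) /= big1 ?add0r; last by move=> i /eqP.
rewrite -big_filter; apply: sum_subset_le => //.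
  rewrite filter_uniq // map_inj_in_uniq; first by rewrite !filter_uniq // -enumT enum_uniq.
  move=> T U; rewrite !mem_filter => /andP[_ /andP[TP _]] /andP[_ /andP[UP _]].
  exact: modulus_inj.
  exact: finmap.fset_uniq.
move=> q; rewrite mem_filter => /andP[Wq /mapP[T]].
rewrite mem_filter => /andP[Tm]; rewrite mem_filter => /andP[TP _] qE.
rewrite in_fset_set // inE /= qE; split; last by apply/eqP; rewrite -qE.
split; first exact: modulus_gt0.
  rewrite /nb_primes (perm_size (uniq_perm (primes_uniq _) (ord_list_uniq T) (primes_modulus TP))).
  by rewrite size_ord_list.
have [q1|q1] := leqP (modulus T) 1.
  by rewrite (_ : max_pdiv _ = 1%N) //; move: q1; rewrite leq_eqVlt ltnNge modulus_gt0 // orbF => /eqP ->.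
have : max_pdiv (modulus T) \in primes (modulus T).
  by rewrite mem_primes max_pdiv_prime // modulus_gt0 // max_pdiv_dvd.
rewrite primes_modulus // => /mapP[i + ->]; rewrite mem_enum => /(fintype.subsetP TP).
by move=> /P_primes[].
Qed.

End Level.

(** * Densities of the sieving primes *)

Lemma pred_half (R : realType) p : prime p -> p%:R / 2 <= p.-1%:R :> R.
Proof.
move=> pp; rewrite ler_pdivrMr // -natrM ler_nat.
by have := prime_gt1 pp; case: p {pp} => // p; rewrite /= => ?; lia.
Qed.

Section SieveDensity.
Variables (R : realType) (rho : nat -> nat) (a : nat -> R) (D p1 : nat) (L tau z : R).
Hypothesis rho_le_self : forall p, (rho p <= p)%N.
Hypothesis rho_le_D : forall p, prime p -> (p1 <= p)%N -> (rho p <= D)%N.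
Hypothesis p1D : (D < p1)%N.
Hypothesis a_ge0 : forall p, prime p -> 0 <= a p.
Hypothesis a_le : forall p, prime p -> (p1 <= p)%N -> a p <= 2 * L * p%:R `^ (- tau).
Hypothesis L_ge0 : 0 <= L.
Hypothesis tau01 : 0 < tau <= 1.

(** The proportion of the mass of a multiplicative weight carried by the
    integers whose polynomial value is divisible by [p]. *)
Definition density p : R := (rho p)%:R / (p.-1%:R * (1 + a p)).

Let pos p : prime p -> [/\ 0 < p%:R :> R, 0 < p.-1%:R :> R & 1 <= 1 + a p].
Proof.
move=> pp; have p0 : 0 < p%:R :> R by rewrite ltr0n prime_gt0.
split=> //; first by apply: lt_le_trans (pred_half R pp); rewrite divr_gt0.
by rewrite lerDl a_ge0.
Qed.

Lemma density_ge0 p : prime p -> 0 <= density p.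
Proof. move=> /pos[_ h h']; apply: divr_ge0 => //; apply: mulr_ge0; first exact: ltW.
exact: le_trans ler01 h'. Qed.

Lemma density_le_recip p : prime p -> (p1 <= p)%N -> density p <= (rho p)%:R / p.-1%:R.
Proof.
move=> pp p1p; have [p0 q0 a1] := pos pp.
rewrite /density ler_wpM2l // lef_pV2 ?posrE //; last by rewrite mulr_gt0 // (lt_le_trans ltr01).
by rewrite ler_peMr // ltW.
Qed.

Lemma density_le1 p : prime p -> (p1 <= p)%N -> density p <= 1.
Proof.
move=> pp p1p; apply: le_trans (density_le_recip pp p1p) _.
have [p0 q0 a1] := pos pp; rewrite ler_pdivrMr // mul1r ler_nat.
apply: leq_trans (rho_le_D pp p1p) _.
by move: (leq_trans p1D p1p); case: (p).
Qed.

Lemma density_le p : prime p -> (p1 <= p)%N -> density p <= 2 * D%:R * p%:R^-1.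
Proof.
move=> pp p1p; apply: le_trans (density_le_recip pp p1p) _.
have [p0 q0 a1] := pos pp.
rewrite -[leRHS]mulrA [leRHS]mulrCA; apply: ler_pM => //; first by rewrite ler_nat rho_le_D.
by rewrite -[2]invrK -invfM lef_pV2 ?posrE ?mulr_gt0 // mulrC pred_half.
Qed.

(** The local mass and [1 / p] are both at most a power of [p] below [1], so
    these differences have a convergent sum. *)
Lemma density_approx p : prime p -> (p1 <= p)%N ->
  `|density p - (rho p)%:R / p%:R| <= D%:R * (2 * L + 2) * p%:R `^ (- 1 - tau).
Proof.
move=> pp p1p; have [p0 q0 a1] := pos pp.
have pE : p%:R = p.-1%:R + 1 :> R by rewrite natr1 prednK // prime_gt0.
have a0 := a_ge0 pp.
have den : 0 < 1 + a p by lra.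
have -> : density p - (rho p)%:R / p%:R =
  (rho p)%:R * ((1 - p.-1%:R * a p) / (p.-1%:R * (1 + a p) * p%:R)).
  by rewrite /density pE; field; rewrite !gt_eqF //; lra.
rewrite normrM ger0_norm // -[leRHS]mulrA; apply: ler_pM => //; first by rewrite ler_nat rho_le_D.
have pw0 : 0 < p%:R `^ (- 1 - tau) :> R by rewrite powR_gt0.
have e1 : a p / p%:R <= 2 * L * p%:R `^ (- 1 - tau).
  rewrite ler_pdivrMr // -[leRHS]mulrA; apply: le_trans (a_le pp p1p) _.
  rewrite ler_wpM2l ?mulr_ge0 // -{3}[p%:R]powRr1 ?(ltW p0) // -powRD; last by apply/implyP => _; rewrite gt_eqF.
  by rewrite (_ : - 1 - tau + 1 = - tau) //; ring.
have e2 : (p.-1%:R * p%:R)^-1 <= 2 * p%:R `^ (- 1 - tau).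
  apply: (@le_trans _ _ (2 * p%:R `^ (- 2%:R))).
    rewrite powRN powR_mulrn ?(ltW p0) // -[2]invrK -invfM lef_pV2 ?posrE ?mulr_gt0 ?exprn_gt0 ?invr_gt0 //.
    by rewrite expr2 mulrA ler_pM2r // mulrC pred_half.
  rewrite ler_wpM2l // ler_powR ?ler1n ?prime_gt0 //.
  by move: tau01 => /andP[h1 h2]; lra.
apply: (@le_trans _ _ (a p / p%:R + (p.-1%:R * p%:R)^-1)); last by lra.
rewrite normrM (ger0_norm (x := _^-1)); last by rewrite invr_ge0 !mulr_ge0 // ltW.
have n1 : `|1 - p.-1%:R * a p| <= 1 + p.-1%:R * a p.
  apply: le_trans (ler_normB _ _) _; rewrite normr1 ger0_norm // mulr_ge0 //; exact: ltW.
have -> : a p / p%:R + (p.-1%:R * p%:R)^-1 = (1 + p.-1%:R * a p) / (p.-1%:R * p%:R).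
  by rewrite pE; field; rewrite !gt_eqF //; lra.
apply: ler_pM => //; first by rewrite invr_ge0 !mulr_ge0 // ltW.
rewrite lef_pV2 ?posrE ?mulr_gt0 // ler_pM2r // ler_peMr //; exact: ltW.
Qed.

Lemma density_sqr_le p : prime p -> (p1 <= p)%N ->
  density p ^+ 2 <= 4 * D%:R ^+ 2 * p%:R `^ (- 1 - tau).
Proof.
move=> pp p1p; have [p0 q0 a1] := pos pp.
apply: (@le_trans _ _ ((2 * D%:R * p%:R^-1) ^+ 2)).
  by rewrite lerXn2r ?nnegrE ?density_le ?density_ge0 // !mulr_ge0 // invr_ge0 ltW.
have -> : (2 * D%:R * p%:R^-1) ^+ 2 = 4 * D%:R ^+ 2 * p%:R ^- 2 :> R by field; rewrite gt_eqF.
rewrite ler_wpM2l ?mulr_ge0 ?sqr_ge0 //.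
rewrite -powR_mulrn ?(ltW p0) // -powRN ler_powR ?ler1n ?prime_gt0 //.
by move: tau01 => /andP[h1 h2]; lra.
Qed.

Definition sieving (p : nat) : bool := [&& prime p, (p1 <= p)%N & p%:R <= z].

Lemma sum_sieving_powR N :
  \sum_(0 <= p < N.+1 | sieving p) p%:R `^ (- 1 - tau) <= 1 + tau^-1.
Proof.
move: tau01 => /andP[t0 _]; apply: le_trans (sum_powRN_le N t0).
rewrite [leLHS]big_ltn_cond // (_ : sieving 0 = false) //.
rewrite big_mkcond; apply: ler_sum => p _; case: ifP => // _; exact: powR_ge0.
Qed.

Lemma sum_density_approx N :
  \sum_(0 <= p < N.+1 | sieving p) `|density p - (rho p)%:R / p%:R| <=
    D%:R * (2 * L + 2) * (1 + tau^-1).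
Proof.
apply: le_trans (ler_wpM2l _ (sum_sieving_powR N)); last by rewrite mulr_ge0 // addr_ge0 ?mulr_ge0.
by rewrite mulr_sumr; apply: ler_sum => p /and3P[pp p1p _]; exact: density_approx.
Qed.

Lemma sum_density_sqr N :
  \sum_(0 <= p < N.+1 | sieving p) density p ^+ 2 <= 4 * D%:R ^+ 2 * (1 + tau^-1).
Proof.
apply: le_trans (ler_wpM2l _ (sum_sieving_powR N)); last by rewrite mulr_ge0 // sqr_ge0.
by rewrite mulr_sumr; apply: ler_sum => p /and3P[pp p1p _]; exact: density_sqr_le.
Qed.

(** Beyond [z] one has [1 <= ln p / ln z], which reduces the sum of [1 / p] to
    that of [ln p / p]. *)
Lemma sum_outside N : (2 <= N)%N -> 1 < z ->
  \sum_(0 <= p < N.+1 | prime p && ~~ sieving p) (rho p)%:R / p%:R <=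
    p1%:R + 4 * D%:R * (ln N%:R / ln z) :> R.
Proof.
move=> N2 z1; have lz : 0 < ln z by rewrite ln_gt0.
have -> : 4 * D%:R * (ln N%:R / ln z) = D%:R / ln z * (4 * ln N%:R) :> R by ring.
apply: le_trans (lerD (lexx _) (ler_wpM2l _ (mertens_log R N2))); last first.
  by rewrite divr_ge0 // ltW.
rewrite (bigID (fun p => p < p1)%N) /=; apply: lerD.
  apply: (@le_trans _ _ (\sum_(0 <= p < N.+1 | (p < p1)%N) 1)).
    rewrite big_mkcond [leRHS]big_mkcond; apply: ler_sum => p _.
    case: ifP => [/andP[/andP[pp _] ->]|_]; last by case: ifP.
    have p0 : 0 < p%:R :> R by rewrite ltr0n prime_gt0.
    by rewrite ler_pdivrMr // mul1r ler_nat.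
  rewrite -big_filter big_const_seq count_predT iter_addr_0 ler_nat.
  rewrite -[leqRHS](size_iota 0); apply: uniq_leq_size; first by rewrite filter_uniq // iota_uniq.
  by move=> p; rewrite mem_filter mem_iota => /andP[].
rewrite mulr_sumr big_mkcond [leRHS]big_mkcond; apply: ler_sum => p _.
case: ifP => [/andP[/andP[pp]] |_]; last first.
  case: ifP => // pp; have p0 : 1 <= p%:R :> R by rewrite ler1n prime_gt0.
  by rewrite !mulr_ge0 ?invr_ge0 ?ln_ge0 // ltW.
rewrite pp /sieving pp /= -leqNgt => + p1p; rewrite p1p /= -ltNge => zp.
have p0 : 0 < p%:R :> R by rewrite ltr0n prime_gt0.
rewrite mulrA ler_pM2r ?invr_gt0 // mulrAC -mulrA.
apply: (@le_trans _ _ (D%:R * 1)); first by rewrite mulr1 ler_nat rho_le_D.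
rewrite ler_wpM2l // ler_pdivlMr // mul1r ler_ln ?posrE ?(ltW zp) //.
exact: lt_trans z1.
Qed.

End SieveDensity.

(** * The empirical law against the independent model *)

(** Rankin's trick, with the parameter [1 + \sum w]. *)
Lemma sum_small_subsets_le (R : realType) (I : finType) (w : I -> R) m :
  (forall i, 0 <= w i) ->
  \sum_(T : {set I} | (#|T| <= m)%N) \prod_(i in T) w i <= expR 1 * (1 + \sum_i w i) ^+ m.
Proof.
move=> w0; set W := \sum_i w i; have W0 : 0 <= W by apply: sumr_ge0.
set t := 1 + W; have t1 : 1 <= t by rewrite lerDl.
have t0 : 0 < t by lra.
apply: (@le_trans _ _ (\sum_(T : {set I}) t ^+ m * \prod_(i in T) (w i / t))).
  rewrite big_mkcond; apply: ler_sum => T _; case: ifPn => [Tm|_]; last first.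
    apply: mulr_ge0; first by rewrite exprn_ge0 // ltW.
    by apply: prodr_ge0 => i _; rewrite divr_ge0 // ltW.
  rewrite big_split /= prodr_const exprVn -(subnK Tm) exprD.
  rewrite -mulrA [t ^+ #|T| * _]mulrCA divff ?mulr1; last by rewrite expf_neq0 // gt_eqF.
  by rewrite ler_peMl ?prodr_ge0 // exprn_ege1.
rewrite -mulr_sumr mulrC ler_wpM2r ?exprn_ge0 ?(ltW t0) //.
have -> : \sum_(T : {set I}) \prod_(i in T) (w i / t) = \prod_i (w i / t + 1).
  rewrite bigA_distr; apply: eq_big => // T _.
  by rewrite [LHS]big_mkcond.
apply: (@le_trans _ _ (\prod_i expR (w i / t))).
  apply: ler_prod => i _; rewrite addrC expR_ge1Dx andbT.
  by rewrite addr_ge0 // divr_ge0 // ltW.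
rewrite -expR_sum ler_expR -mulr_suml -/W ler_pdivrMr // mul1r /t; lra.
Qed.

Section Comparison.
Variables (R : realType) (g : {poly rat}) (alpha : nat -> R) (sigma rho0 L : R).
Hypothesis g_nonconst : (1 < size g)%N.
Hypothesis g0 : g.[0] != 0.
Hypothesis g_pos : maps_pos_to_pos g.
Hypothesis sigma_gt0 : 0 < sigma.
Hypothesis rho0_01 : 0 <= rho0 < 1.
Hypothesis alpha_ge0 : forall n, (0 < n)%N -> 0 <= alpha n.
Hypothesis alpha_mul : Defs.multiplicative alpha.
Hypothesis alpha_pow : forall p k, prime p -> (0 < k)%N ->
  alpha (p ^ k)%N <= L * p%:R `^ ((rho0 + sigma - 1) * k%:R).
Variables (x z eta : R) (p1 : nat).
Hypothesis x1 : 1 <= x.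
Hypothesis eta0 : 0 <= eta.
Hypothesis S_regular : forall y, 0 < y -> y <= x ->
  `|summatory alpha y - (y / x) `^ sigma * summatory alpha x| <=
    eta * ((y / x) `^ sigma * summatory alpha x) * (x / y) `^ tilt rho0.
Hypothesis p1_bad : (bad_bound g <= p1)%N.
Hypothesis p1_good : forall p, prime p -> (p1 <= p)%N -> good_prime rho0 L p.

Notation X := (Num.truncn x).
Notation N := X.+1.
Notation K := X.+2.
Notation S := (summatory alpha x).
Notation mass := (local_mass alpha sigma K).

Definition sieve_set : {set 'I_N} := [set i : 'I_N | sieving p1 z i]%SET.

(** Zero outside the sieving primes, so that the model ignores other indices. *)
Definition sieve_density (i : 'I_N) : R :=
  if i \in sieve_set then density (rho g) mass i else 0.

Definition prime_divisors n : {set 'I_N} := [set i in sieve_set | (i %| natval g n)%N]%SET.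

Definition empirical_weight (Q : {set 'I_N}) : R :=
  S^-1 * \sum_(1 <= n < N | prime_divisors n == Q) alpha n.

Definition law_gap Q : R := empirical_weight Q - bernoulli_weight sieve_density Q.

Lemma empirical_sum (phi : {set 'I_N} -> R) :
  \sum_Q empirical_weight Q * phi Q =
  S^-1 * \sum_(1 <= n < N) alpha n * phi (prime_divisors n).
Proof.
rewrite (partition_big prime_divisors xpredT) //= mulr_sumr.
apply: eq_bigr => Q _; rewrite /empirical_weight -mulrA; congr (_ * _).
by rewrite mulr_suml; apply: eq_bigr => n /eqP ->.
Qed.

Lemma empirical_incl (T : {set 'I_N}) :
  \sum_(Q : {set 'I_N} | T \subset Q) empirical_weight Q =
  S^-1 * \sum_(1 <= n < N | T \subset prime_divisors n) alpha n.
Proof.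
rewrite (partition_big prime_divisors (fun Q => T \subset Q)) //= mulr_sumr.
apply: eq_bigr => Q TQ; rewrite /empirical_weight; congr (_ * _).
by apply: eq_bigl => n; case: eqP => [->|]; rewrite ?TQ ?andbF.
Qed.

Lemma law_gap_incl (T : {set 'I_N}) : incl_weight law_gap T =
  S^-1 * \sum_(1 <= n < N | T \subset prime_divisors n) alpha n -
  \prod_(i in T) sieve_density i.
Proof. by rewrite /incl_weight sumrB empirical_incl bernoulli_incl. Qed.

Lemma law_gap_incl_outside (T : {set 'I_N}) : ~~ (T \subset sieve_set) -> incl_weight law_gap T = 0.
Proof.
case/fintype.subsetPn => i iT iS; rewrite law_gap_incl [X in _ * X]big_pred0.
  by rewrite mulr0 sub0r (bigD1 i) //= /sieve_density (negbTE iS) mul0r oppr0.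
move=> n; apply: contraNF iS => /fintype.subsetP /(_ i iT).
by rewrite inE => /andP[].
Qed.

Let sieve_prime i : i \in sieve_set -> [/\ prime i, (p1 <= i)%N & (nat_of_ord i)%:R <= z].
Proof. by rewrite inE => /and3P. Qed.

Lemma sieve_large (T : {set 'I_N}) : T \subset sieve_set -> large_primes g (ord_list T).
Proof.
move=> /fintype.subsetP TS; rewrite /large_primes ord_list_uniq /=.
apply/allP => _ /mapP[i + ->]; rewrite mem_enum => /TS /sieve_prime[-> p1i _].
exact: leq_trans p1i.
Qed.

Lemma subset_prime_divisors (T : {set 'I_N}) n : T \subset sieve_set -> (0 < n)%N ->
  (T \subset prime_divisors n) = (modulus T %| natval g n)%N.
Proof.
move=> TS n0; have := sieve_large TS => /andP[us /allP lp].
rewrite modulusE; apply/idP/idP => [/fintype.subsetP TQ|dv].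
  apply: prod_primes_dvd => //; first by apply/allP => p /lp /andP[].
  apply/allP => _ /mapP[i + ->]; rewrite mem_enum => /TQ.
  by rewrite inE => /andP[].
apply/fintype.subsetP => i iT; rewrite inE (fintype.subsetP TS) //=.
apply: dvdn_trans dv; rewrite (big_rem (nat_of_ord i)) ?mem_ord_list //=.
exact: dvdn_mulr.
Qed.

(** The integers [n] with [modulus T] dividing [g n] fill the classes of
    [Zstar]; each class carries its discrepancy and an equal share of the
    integers prime to the modulus. *)
Lemma law_gap_incl_le (T : {set 'I_N}) : 0 < S -> T \subset sieve_set ->
  `|incl_weight law_gap T| <=
    S^-1 * (\sum_(a in Zstar g (modulus T)) `|discrepancy alpha x (modulus T) (a : nat)%:Z|)
    + eta * \prod_(i in T) (2 * ((rho g i)%:R / i.-1%:R)).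
Proof.
move=> S0 TS; have lp := sieve_large TS.
have lT : all prime (ord_list T).
  by move: lp => /andP[_ /allP h]; apply/allP => p /h /andP[].
have q0 : (0 < modulus T)%N by rewrite modulusE (large_primes_prod_gt0 lp).
pose q := modulus T; rewrite -/q.
have E : \sum_(1 <= n < N | T \subset prime_divisors n) alpha n =
   \sum_(a in Zstar g q) discrepancy alpha x q (a : nat)%:Z +
   #|Zstar g q|%:R / (totient q)%:R * coprime_sum alpha q X.
  rewrite big_nat_cond (eq_bigl (fun n => (1 <= n < N)%N && (q %| natval g n)%N)); last first.
    by move=> n; case: (boolP (1 <= n < N)%N) => //= /andP[n0 _]; rewrite subset_prime_divisors.
  rewrite -big_nat_cond /q modulusE (sum_divisible g0 g_pos _ _ lp).
  set q' := (\prod_(p <- _) p)%N.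
  rewrite (eq_bigr (fun a : 'I_q' => discrepancy alpha x q' (a : nat)%:Z +
     (totient q')%:R^-1 * coprime_sum alpha q' X)); last first.
    by move=> a _; rewrite /discrepancy /coprime_sum subrK.
  rewrite big_split /=; congr (_ + _).
  by rewrite sumr_const -[RHS]mulrA [RHS]mulr_natl.
have tE : #|Zstar g q|%:R / (totient q)%:R = \prod_(i in T) ((rho g i)%:R / i.-1%:R) :> R.
  rewrite prodf_div /q modulusE (card_Zstar_prod g0 lp) (totient_prod lp) !natr_prod.
  by rewrite /ord_list !big_map !big_enum.
have x0 : 0 < x := lt_le_trans ltr01 x1.
have good p : p \in ord_list T -> good_prime rho0 L p.
  move=> /mapP[i + ->]; rewrite mem_enum => /(fintype.subsetP TS) /sieve_prime[ip i1 _].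
  exact: p1_good.
have := coprime_sum_asymp alpha_ge0 alpha_mul alpha_pow x1 eta0
  (fun p pp => pow_bound X pp) S_regular (ord_list_uniq T) good x0 (lexx x).
rewrite /= divff ?gt_eqF // !powR1 !mul1r mulr1 size_ord_list -modulusE -/q => cs.
set W := \prod_(i in T) ((rho g i)%:R / i.-1%:R) : R in tE.
have W0 : 0 <= W by apply: prodr_ge0 => i _; rewrite divr_ge0.
have hE : \prod_(i in T) sieve_density i = W * mean_factor alpha sigma K (ord_list T).
  rewrite /mean_factor /ord_list big_map big_enum -big_split /=; apply: eq_bigr => i iT.
  by rewrite /sieve_density (fintype.subsetP TS) // /density invfM mulrA.
rewrite law_gap_incl E tE hE mulrDr -addrA; apply: le_trans (ler_normD _ _) _.
apply: lerD.
  rewrite normrM ger0_norm ?invr_ge0 ?(ltW S0) // ler_wpM2l ?invr_ge0 ?(ltW S0) //.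
  exact: ler_norm_sum.
rewrite big_split /= prodr_const -/W.
have -> : S^-1 * (W * coprime_sum alpha q X) - W * mean_factor alpha sigma K (ord_list T) =
  W / S * (coprime_sum alpha q X - mean_factor alpha sigma K (ord_list T) * S).
  by field; rewrite gt_eqF.
have WS : 0 <= W / S by rewrite divr_ge0 // ltW.
rewrite normrM (ger0_norm WS); apply: le_trans (ler_wpM2l WS cs) _.
have key (a b c e : R) : b != 0 -> a / b * (c * (e * b)) = e * (c * a) by move=> ?; field.
by rewrite key ?gt_eqF.
Qed.

Lemma sum_law_gap_le d m : 0 < S -> z = x `^ (d / m%:R) -> 1 <= z ->
  \sum_(T : {set 'I_N} | (#|T| <= m)%N) `|incl_weight law_gap T| <=
    S^-1 * level_sum alpha g x d m +
    eta * (expR 1 * (1 + \sum_(i in sieve_set) 2 * ((rho g i)%:R / i.-1%:R)) ^+ m).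
Proof.
move=> S0 zE z1.
have V0 : 0 <= S^-1 by rewrite invr_ge0 ltW.
rewrite (bigID (fun T : {set 'I_N} => T \subset sieve_set)) /= [X in _ + X]big1 ?addr0; last first.
  by move=> T /andP[_ TS]; rewrite law_gap_incl_outside // normr0.
apply: (@le_trans _ _ (\sum_(T : {set 'I_N} | (#|T| <= m)%N && (T \subset sieve_set))
   (S^-1 * (\sum_(a in Zstar g (modulus T)) `|discrepancy alpha x (modulus T) (a : nat)%:Z|)
    + eta * \prod_(i in T) (2 * ((rho g i)%:R / i.-1%:R))))).
  by apply: ler_sum => T /andP[_ TS]; exact: law_gap_incl_le.
rewrite big_split -[X in X + _ <= _]mulr_sumr -[X in _ + X <= _]mulr_sumr /=; apply: lerD.
  rewrite ler_wpM2l // (eq_bigl (fun T : {set 'I_N} => (T \subset sieve_set) && (#|T| <= m)%N)); last first.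
    by move=> T; rewrite andbC.
  apply: level_sum_ge; last by rewrite -zE.
  by move=> i /sieve_prime[ip _ iz]; rewrite -zE.
rewrite ler_wpM2l //.
pose w (i : 'I_N) : R := if i \in sieve_set then 2 * ((rho g i)%:R / i.-1%:R) else 0.
have w0 i : 0 <= w i by rewrite /w; case: ifP => // _; rewrite mulr_ge0 // divr_ge0.
have -> : \sum_(i in sieve_set) 2 * ((rho g i)%:R / i.-1%:R) = \sum_i w i by rewrite big_mkcond.
apply: le_trans (sum_small_subsets_le m w0).
rewrite [leRHS](bigID (fun T : {set 'I_N} => T \subset sieve_set)) /= -[leLHS]addr0.
apply: lerD; last by apply: sumr_ge0 => T _; apply: prodr_ge0.
apply: ler_sum => T /andP[_ TS]; rewrite le_eqVlt; apply/orP; left; apply/eqP.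
by apply: eq_bigr => i iT; rewrite /w (fintype.subsetP TS).
Qed.

End Comparison.

(** * The part left out by the sieving primes *)

Section Remainder.
Variables (R : realType) (g : {poly rat}) (f alpha : nat -> R) (sigma L tau M : R).
Hypothesis g_nonconst : (1 < size g)%N.
Hypothesis g_pos : maps_pos_to_pos g.
Hypothesis f_add : strongly_additive f.
Hypothesis M_ge0 : 0 <= M.
Hypothesis f_le : forall p, prime p -> `|f p| <= M.
Variables (x z : R) (p1 : nat).
Notation X := (Num.truncn x).
Notation N := X.+1.
Notation mass := (local_mass alpha sigma X.+2).
Notation D := (size g).-1.
Hypothesis x2 : 2 <= x.
Hypothesis z1 : 1 < z.
Hypothesis zx : z <= x.
Hypothesis p1_bad : (bad_bound g <= p1)%N.
Hypothesis p1D : (D < p1)%N.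
Hypothesis mass_ge0 : forall p, prime p -> 0 <= mass p.
Hypothesis mass_le : forall p, prime p -> (p1 <= p)%N -> mass p <= 2 * L * p%:R `^ (- tau).
Hypothesis L_ge0 : 0 <= L.
Hypothesis tau01 : 0 < tau <= 1.

Notation A := (Amean f g x).
Notation B := (Bvar f g x).
Notation sv := (sieving p1 z).
Notation dens := (density (rho g) mass).
Notation hI := (sieve_density g alpha sigma z p1).

Definition sieve_value (i : 'I_N) : R := if i \in sieve_set x z p1 then f i else 0.

Lemma sieve_value_le i : `|sieve_value i| <= M.
Proof.
rewrite /sieve_value; case: ifP; last by rewrite normr0.
by rewrite inE => /and3P[ip _ _]; exact: f_le.
Qed.

Lemma rho_le_self p : (rho g p <= p)%N.
Proof.
rewrite /rho; case: ifP => // _; by apply: leq_trans (max_card _) _; rewrite card_ord.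
Qed.

Lemma rho_le_D p : prime p -> (p1 <= p)%N -> (rho g p <= D)%N.
Proof. by move=> pp p1p; apply: rho_le => //; apply: leq_trans p1p. Qed.

Lemma sieve_density01 (i : 'I_N) : 0 <= hI i <= 1.
Proof.
rewrite /sieve_density; case: ifP; last by rewrite lexx ler01.
rewrite inE => /and3P[ip i1 _].
by rewrite density_ge0 //= (density_le1 rho_le_D p1D mass_ge0).
Qed.

Lemma X2 : (2 <= X)%N.
Proof. by rewrite truncn_ge_nat // (le_trans _ x2). Qed.

Lemma X_le : X%:R <= x.
Proof. by rewrite truncn_le // (le_trans _ x2). Qed.

Lemma sieving_lt p : sv p -> (p < N)%N.
Proof.
by move=> /and3P[pp _ pz]; rewrite ltnS truncn_ge_nat ?(le_trans pz) // (le_trans _ x2).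
Qed.

Definition remainder n : R :=
  f (natval g n) - A - centred_sum hI sieve_value (prime_divisors g x z p1 n).

Lemma centred_sumE (n : nat) :
  centred_sum hI sieve_value (prime_divisors g x z p1 n) =
  \sum_(0 <= p < N | sv p) ((p %| natval g n)%N%:R - dens p) * f p.
Proof.
rewrite /centred_sum big_mkord [RHS]big_mkcond; apply: eq_bigr => i _.
rewrite /sieve_value !inE /sieve_density !inE; case: ifP => //= si; last by rewrite mulr0.
Qed.

Let excess : R := \sum_(0 <= p < N | prime p && ~~ sv p) (rho g p)%:R / p%:R.
Let approx : R := \sum_(0 <= p < N | sv p) `|dens p - (rho g p)%:R / p%:R|.

Lemma prime_sum_split (F : nat -> R) : \sum_(0 <= p < N | prime p) F p =
  \sum_(0 <= p < N | sv p) F p + \sum_(0 <= p < N | prime p && ~~ sv p) F p.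
Proof.
rewrite (bigID sv) /=; congr (_ + _); apply: eq_bigl => p.
by rewrite /sieving; case: (prime p).
Qed.

(** The three parts are the prime factors of [g n] that are not sieved, their
    share in the mean [A], and the difference between the densities and
    [rho / p]. *)
Lemma remainderE n : (0 < n)%N -> remainder n =
  \sum_(p <- primes (natval g n) | ~~ sv p) f p
  - \sum_(0 <= p < N | prime p && ~~ sv p) (rho g p)%:R * (f p / p%:R)
  + \sum_(0 <= p < N | sv p) (dens p - (rho g p)%:R / p%:R) * f p.
Proof.
move=> n0; have k0 := natval_gt0 g_pos n0.
rewrite /remainder centred_sumE /Amean prime_sum_split (strongly_additiveE f_add k0).
rewrite (bigID sv) /=.
have -> : \sum_(p <- primes (natval g n) | sv p) f p =
          \sum_(0 <= p < N | sv p) (p %| natval g n)%N%:R * f p.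
  rewrite [RHS](eq_bigr (fun p => if (p %| natval g n)%N then f p else 0)); last first.
    by move=> p _; case: ifP => _; rewrite ?mul1r ?mul0r.
  rewrite -big_mkcondr /= -big_filter -[RHS]big_filter; apply: perm_big; apply: uniq_perm.
  - by rewrite filter_uniq // primes_uniq.
  - by rewrite filter_uniq // iota_uniq.
  move=> p; rewrite !mem_filter mem_primes mem_index_iota k0 /=.
  case: (boolP (sv p)) => //= sp; rewrite (sieving_lt sp) andbT.
  by move: sp => /and3P[-> _ _].
have -> : \sum_(0 <= p < N | sv p) ((p %| natval g n)%N%:R - dens p) * f p =
  \sum_(0 <= p < N | sv p) (p %| natval g n)%N%:R * f p - \sum_(0 <= p < N | sv p) dens p * f p.
  by rewrite -sumrB; apply: eq_bigr => p _; rewrite mulrBl.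
have -> : \sum_(0 <= p < N | sv p) (dens p - (rho g p)%:R / p%:R) * f p =
  \sum_(0 <= p < N | sv p) dens p * f p - \sum_(0 <= p < N | sv p) (rho g p)%:R * (f p / p%:R).
  by rewrite -sumrB; apply: eq_bigr => p _; rewrite mulrBl (mulrC (f p)) mulrA.
ring.
Qed.

Lemma small_prime_count (s : seq nat) : uniq s -> (count (fun p => (p < p1)%N) s <= p1)%N.
Proof.
move=> us; rewrite -size_filter -[leqRHS](size_iota 0); apply: uniq_leq_size.
  by rewrite filter_uniq.
by move=> p; rewrite mem_filter mem_iota => /andP[].
Qed.

Lemma unsieved_count k : (0 < k)%N ->
  (count (fun p => ~~ sv p) (primes k))%:R <= p1%:R + ln k%:R / ln z :> R.
Proof.
move=> k0; have lz : 0 < ln z by rewrite ln_gt0.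
apply: (@le_trans _ _ ((count (fun p => (p < p1)%N) (primes k))%:R +
   (count (fun p : nat => z < p%:R) (primes k))%:R)).
  rewrite -natrD ler_nat -count_predUI; apply: leq_trans (leq_addr _ _).
  rewrite -[X in (X <= _)%N]size_filter -[X in (_ <= X)%N]size_filter.
  apply: uniq_leq_size; first by rewrite filter_uniq // primes_uniq.
  move=> p; rewrite !mem_filter => /andP[+ pk]; rewrite pk andbT.
  move: pk; rewrite mem_primes /sieving => /and3P[-> _ _] /=.
  by rewrite negb_and -ltnNge -ltNge.
apply: lerD; first by rewrite ler_nat small_prime_count // primes_uniq.
rewrite ler_pdivlMr // -size_filter; apply: prime_count_le => //.
- exact: ltW.
- by rewrite filter_uniq // primes_uniq.
- by apply/allP => p; rewrite mem_filter mem_primes => /andP[_ /andP[]].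
- by apply/allP => p; rewrite mem_filter mem_primes => /andP[_ /and3P[]].
- by apply/allP => p; rewrite mem_filter => /andP[].
Qed.

Let rhodiv_ge0 p : 0 <= (rho g p)%:R / p%:R :> R.
Proof. by rewrite divr_ge0. Qed.

Lemma remainder_le n : (0 < n)%N ->
  `|remainder n| <= M * (p1%:R + ln (natval g n)%:R / ln z + excess + approx).
Proof.
move=> n0; rewrite remainderE // !mulrDr -mulrDr.
apply: le_trans (ler_normD _ _) _; apply: lerD; last first.
  rewrite mulr_sumr; apply: le_trans (ler_norm_sum _ _ _) _.
  apply: ler_sum => p /and3P[pp _ _]; rewrite normrM mulrC ler_wpM2r //; exact: f_le.
apply: le_trans (ler_normB _ _) _; apply: lerD; last first.
  rewrite mulr_sumr; apply: le_trans (ler_norm_sum _ _ _) _.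
  apply: ler_sum => p /andP[pp _]; rewrite mulrCA normrM (mulrC M).
  have -> : (rho g p)%:R / p%:R * M = M * ((rho g p)%:R / p%:R) by rewrite mulrC.
  rewrite ler_pM // ?f_le // ger0_norm //.
apply: (@le_trans _ _ (M * (count (fun p => ~~ sv p) (primes (natval g n)))%:R)); last first.
  by rewrite ler_wpM2l // unsieved_count // natval_gt0.
apply: le_trans (ler_norm_sum _ _ _) _.
rewrite -sum1_count natr_sum mulr_sumr; rewrite big_seq_cond [leRHS]big_seq_cond.
apply: ler_sum => p /andP[+ _]; rewrite mem_primes mulr1 => /andP[pp _]; exact: f_le.
Qed.

Lemma bernoulli_varE : bernoulli_var hI sieve_value =
  \sum_(0 <= p < N | sv p) dens p * (1 - dens p) * f p ^+ 2.
Proof.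
rewrite /bernoulli_var big_mkord [RHS]big_mkcond; apply: eq_bigr => i _.
by rewrite /sieve_value /sieve_density !inE; case: ifP => // _; rewrite expr0n mulr0.
Qed.

(** Beside the terms already met in [remainder_le], the factor [1 - h] of a
    Bernoulli variance brings in the squares of the densities. *)
Lemma var_gap_le : `|bernoulli_var hI sieve_value - B| <=
  M ^+ 2 * (excess + approx + \sum_(0 <= p < N | sv p) dens p ^+ 2).
Proof.
have f2 p : prime p -> `|f p ^+ 2| <= M ^+ 2.
  by move=> pp; rewrite normrX lerXn2r ?nnegrE // f_le.
have -> : bernoulli_var hI sieve_value - B =
   \sum_(0 <= p < N | sv p) (dens p - (rho g p)%:R / p%:R) * f p ^+ 2
   - \sum_(0 <= p < N | sv p) dens p ^+ 2 * f p ^+ 2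
   - \sum_(0 <= p < N | prime p && ~~ sv p) (rho g p)%:R / p%:R * f p ^+ 2.
  rewrite bernoulli_varE /Bvar prime_sum_split opprD addrA; congr (_ + _).
    by rewrite -!sumrB; apply: eq_bigr => p _; ring.
  by congr (- _); apply: eq_bigr => p _; ring.
have sq0 p : 0 <= dens p ^+ 2 := sqr_ge0 _.
apply: le_trans (ler_normB _ _) _.
rewrite [excess + approx]addrC -addrA [excess + _]addrC addrA mulrDr; apply: lerD; last first.
  rewrite mulr_sumr; apply: le_trans (ler_norm_sum _ _ _) _.
  apply: ler_sum => p /andP[pp _]; rewrite normrM mulrC (ger0_norm (rhodiv_ge0 p)) ler_wpM2r //; exact: f2.
apply: le_trans (ler_normB _ _) _; rewrite mulrDr; apply: lerD.
  rewrite mulr_sumr; apply: le_trans (ler_norm_sum _ _ _) _.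
  apply: ler_sum => p /and3P[pp _ _]; rewrite normrM mulrC ler_wpM2r //; exact: f2.
rewrite mulr_sumr; apply: le_trans (ler_norm_sum _ _ _) _.
apply: ler_sum => p /and3P[pp _ _]; rewrite normrM mulrC (ger0_norm (sq0 p)) ler_wpM2r //; exact: f2.
Qed.

Definition mass_bound : R := 4 * D%:R * (9 + 2 * ln (ln X%:R)).

Lemma sum_rho_le : \sum_(i in sieve_set x z p1) 2 * ((rho g i)%:R / i.-1%:R) <= mass_bound.
Proof.
have -> : \sum_(i in sieve_set x z p1) 2 * ((rho g i)%:R / i.-1%:R) =
   \sum_(0 <= p < N | sv p) 2 * ((rho g p)%:R / p.-1%:R) :> R.
  by rewrite big_mkord; apply: eq_bigl => i; rewrite inE.
apply: le_trans (ler_wpM2l _ (mertens_recip R X2)); last by rewrite mulr_ge0.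
rewrite mulr_sumr [leLHS]big_mkcond [leRHS]big_mkcond; apply: ler_sum => p _.
case: ifP => [/and3P[pp i1 _]|_]; last by case: ifP => // _; rewrite mulr_ge0 ?invr_ge0.
rewrite pp (_ : 4 * D%:R * p%:R^-1 = 2 * (D%:R * (2 * p%:R^-1)) :> R); last by ring.
have p0 : 0 < p%:R :> R by rewrite ltr0n prime_gt0.
have q0 : 0 < p.-1%:R :> R by apply: lt_le_trans (pred_half R pp); rewrite divr_gt0.
rewrite ler_wpM2l //; apply: ler_pM => //; first by rewrite ler_nat rho_le_D.
by rewrite -[2]invrK -invfM lef_pV2 ?posrE ?mulr_gt0 // mulrC pred_half.
Qed.

Lemma mean_le : `|\sum_i hI i * sieve_value i| <= M * mass_bound.
Proof.
apply: le_trans (_ : _ <= M * \sum_(i in sieve_set x z p1) 2 * ((rho g i)%:R / i.-1%:R)) _.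
  apply: le_trans (ler_norm_sum _ _ _) _; rewrite mulr_sumr [leRHS]big_mkcond.
  apply: ler_sum => i _; rewrite normrM mulrC /sieve_density; case: ifP; last by rewrite normr0 mulr0.
  rewrite inE => /and3P[ip i1 _]; have h0 := density_ge0 (rho g) mass_ge0 ip.
  apply: ler_pM => //; first exact: sieve_value_le.
  rewrite ger0_norm //; apply: le_trans (density_le_recip _ mass_ge0 ip i1) _.
  by rewrite ler_peMl ?divr_ge0 // ler1n.
by rewrite ler_wpM2l // sum_rho_le.
Qed.

Lemma Bvar_le : B <= M ^+ 2 * (p1%:R + D%:R * (9 + 2 * ln (ln X%:R))).
Proof.
apply: (@le_trans _ _ (M ^+ 2 * \sum_(0 <= p < N | prime p) (rho g p)%:R / p%:R)).
  rewrite mulr_sumr; apply: ler_sum => p pp.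
  rewrite mulrA mulrAC mulrC ler_wpM2r //.
  by rewrite -[f p ^+ 2]ger0_norm ?sqr_ge0 // normrX lerXn2r ?nnegrE // f_le.
rewrite ler_wpM2l ?sqr_ge0 //.
apply: le_trans (lerD (lexx _) (ler_wpM2l _ (mertens_recip R X2))) => //.
rewrite (bigID (fun p => p < p1)%N) /=; apply: lerD.
  apply: (@le_trans _ _ (\sum_(0 <= p < N | (p < p1)%N) 1)).
    rewrite big_mkcond [leRHS]big_mkcond; apply: ler_sum => p _.
    case: ifP => [/andP[pp ->]|_]; last by case: ifP.
    by rewrite ler_pdivrMr ?ltr0n ?prime_gt0 // mul1r ler_nat rho_le_self.
  rewrite -big_filter big_const_seq count_predT iter_addr_0 ler_nat size_filter.
  by rewrite small_prime_count // iota_uniq.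
rewrite mulr_sumr big_mkcond [leRHS]big_mkcond; apply: ler_sum => p _.
case: ifP => [/andP[pp]|_]; last by case: ifP => // _; rewrite mulr_ge0 ?invr_ge0.
by rewrite pp -leqNgt => p1p; rewrite ler_wpM2r ?invr_ge0 // ler_nat rho_le_D.
Qed.

End Remainder.

(** * Adding up the errors *)

Lemma exp_sum_le (R : realType) (u : R) m : 0 <= u -> \sum_(k < m) u ^+ k / k`!%:R <= expR u.
Proof.
move=> u0; rewrite -(big_mkord xpredT (fun k => u ^+ k / k`!%:R)).
have nd : nondecreasing_seq (series (exp_coeff u)).
  apply/nondecreasing_seqP => k; rewrite /series /= big_nat_recr //= lerDl.
  by rewrite /exp_coeff /= divr_ge0 // exprn_ge0.
have := nondecreasing_cvgn_le nd (is_cvg_series_exp_coeff u) m.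
by rewrite /series /exp_coeff.
Qed.

Lemma pow_sub1_le (R : realType) (a th : R) m : 0 <= a -> 0 <= th -> `|a - 1| <= th ->
  `|a ^+ m - 1| <= m%:R * th * expR (m%:R * th) /\ a ^+ m <= expR (m%:R * th).
Proof.
move=> a0 th0 ath; have a1 : a <= expR th.
  apply: le_trans (expR_ge1Dx th); move: ath; rewrite ler_norml => /andP[_]; lra.
have e1 : 1 <= expR th by rewrite -expR0 ler_expR.
have pw k : a ^+ k <= expR th ^+ k by apply: lerXn2r; rewrite ?nnegrE ?expR_ge0.
split; last by rewrite expRM_natl.
rewrite expRM_natl; elim: m => [|m IH].
  by rewrite expr0 subrr normr0 !mul0r.
have -> : a ^+ m.+1 - 1 = a * (a ^+ m - 1) + (a - 1) by rewrite exprS; ring.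
apply: le_trans (ler_normD _ _) _; rewrite normrM (ger0_norm a0).
have em : 1 <= expR th ^+ m.+1 by rewrite exprn_ege1.
rewrite -natr1 mulrDl mul1r mulrDl; apply: lerD; last first.
  by apply: le_trans ath _; rewrite ler_peMr.
rewrite exprS mulrCA; apply: ler_pM => //.
Qed.

Section Assembly.
Variables (R : realType) (G : nat -> R).
Hypothesis G0 : G 0%N = 1.
Hypothesis G1 : 0 < G 1%N.
Hypothesis GS : forall j, j.+2%:R * G j.+2 = G j.
Notation kap := (gauss_ratio G).

Let kap1 : 1 <= kap := gauss_ratio_ge1 G0 G1 GS.
Let g0 j : 0 < G j := gauss_gt0 G0 G1 GS j.

(** A crude lower bound for the Gaussian moments, used only where the error is
    smaller than any such exponential. *)
Lemma fact_gauss_ge j : 1 <= kap ^+ j * (j`!%:R * G j).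
Proof.
elim: j => [|j IH]; first by rewrite expr0 fact0 G0 !mul1r.
apply: le_trans IH _; rewrite exprSr -mulrA ler_wpM2l ?exprn_ge0 ?(le_trans ler01) //.
have := gauss_ratioP G0 G1 GS j => h.
have sq : Num.sqrt j.+1%:R <= j.+1%:R :> R.
  by rewrite -ler_sqr ?nnegrE ?sqrtr_ge0 // sqr_sqrtr // expr2 ler_peMl // ler1n.
have k0 : 0 <= kap by apply: le_trans kap1.
rewrite factS natrM; apply: (@le_trans _ _ (j`!%:R * (kap * Num.sqrt j.+1%:R * G j.+1))).
  by rewrite ler_wpM2l.
rewrite (_ : kap * (j.+1%:R * j`!%:R * G j.+1) = j`!%:R * (kap * j.+1%:R * G j.+1)); last by ring.
by rewrite ler_wpM2l // ler_wpM2r ?(ltW (g0 _)) // ler_wpM2l.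
Qed.

Variables (I : finType) (h fv : I -> R) (M : R).
Hypothesis h01 : forall i, 0 <= h i <= 1.
Hypothesis M_gt0 : 0 < M.
Hypothesis fvM : forall i, `|fv i| <= M.
Variables (r : seq nat) (P : pred nat) (w Y : nat -> R) (Qm : nat -> {set I}).
Hypothesis w_ge0 : forall n, P n -> 0 <= w n.
Variable emp : {set I} -> R.
Hypothesis empE : forall phi : {set I} -> R,
  \sum_Q emp Q * phi Q = \sum_(n <- r | P n) w n * phi (Qm n).
Variables (m : nat) (t d W E C1 C2 H : R).
Hypothesis m_gt0 : (0 < m)%N.
Hypothesis t_gt0 : 0 < t.
Hypothesis d01 : 0 < d <= 1.
Hypothesis W_ge0 : 0 <= W.
Hypothesis C1_ge0 : 0 <= C1.
Hypothesis C2_ge0 : 0 <= C2.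
Hypothesis H_ge0 : 0 <= H.

Let q : R := Num.sqrt m%:R.
Let b : R := M / t.
Let om : R := b * q ^+ 3 / d.
Let V : R := bernoulli_var h fv.
Let s : R := Num.sqrt V.

Hypothesis om_le : om <= H.
Hypothesis V_close : `|V - t ^+ 2| <= C1 * (M ^+ 2 * (m%:R / d)).
Hypothesis Y_le : forall n, P n -> `|Y n| <= C2 * (M * (m%:R / d)).
Hypothesis mean_small : `|\sum_i h i * fv i| <= M * W.
Hypothesis gap_le : \sum_(T : {set I} | (#|T| <= m)%N)
   `|incl_weight (fun Q => emp Q - bernoulli_weight h Q) T| <= E.
Hypothesis E_small : (kap * (m%:R + W)) ^+ m * E <= b.
Hypothesis b_small1 : C1 * b * H <= 2^-1.
Hypothesis b_small2 : b ^+ 2 * H <= (4 * kap) ^- 3.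

Let b0 : 0 < b. Proof. exact: divr_gt0. Qed.
Let q1 : 1 <= q. Proof. by rewrite -[leLHS]sqrtr1 ler_wsqrtr // ler1n. Qed.
Let q2 : q ^+ 2 = m%:R. Proof. by rewrite sqr_sqrtr. Qed.
Let d0 : 0 < d. Proof. by case/andP: d01. Qed.
Let dV : 1 <= d^-1. Proof. by rewrite invf_ge1 //; case/andP: d01. Qed.

Let bq3 : b * q ^+ 3 <= om.
Proof. by rewrite /om ler_peMr // mulr_ge0 ?exprn_ge0 ?(ltW b0) // (le_trans ler01). Qed.

Let om0 : 0 <= om.
Proof. apply: le_trans bq3; by rewrite mulr_ge0 ?exprn_ge0 ?(ltW b0) // (le_trans ler01). Qed.

Let bq_le : b * q <= b * q ^+ 3.
Proof. by rewrite ler_wpM2l ?(ltW b0) // ler_eXnr. Qed.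

Let b_le : b <= om.
Proof. by apply: le_trans bq3; rewrite ler_peMr ?(ltW b0) // exprn_ege1. Qed.

(** The relative error of the model variance. *)
Let th : R := C1 * (b * q^-1 * om).

Let th0 : 0 <= th.
Proof.
apply: mulr_ge0 => //; apply: mulr_ge0 => //; apply: mulr_ge0; first exact: ltW.
by rewrite invr_ge0 (le_trans ler01).

Qed.

Let qn0 : q != 0. Proof. by rewrite gt_eqF // (lt_le_trans ltr01). Qed.

Let thE : C1 * (M ^+ 2 * (m%:R / d)) = th * t ^+ 2.
Proof.
rewrite /th /om /b -q2; field; rewrite qn0 !gt_eqF //.
Qed.

Let th_half : th <= 2^-1.
Proof.
apply: le_trans b_small1; rewrite /th -[leRHS]mulrA ler_wpM2l //.
have qV : q^-1 <= 1 by rewrite invf_le1 ?(lt_le_trans ltr01).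
apply: le_trans (_ : _ <= b * 1 * H) _; last by rewrite mulr1.
apply: ler_pM => //.
  by rewrite mulr_ge0 ?(ltW b0) // invr_ge0 (le_trans ler01).
by rewrite ler_wpM2l ?(ltW b0).
Qed.

Let mth : m%:R * th <= C1 * H * om.
Proof.
have -> : m%:R * th = C1 * (b * q * om) by rewrite /th -q2; field.
rewrite -[leRHS]mulrA ler_wpM2l // ler_wpM2r //.
exact: le_trans bq_le (le_trans bq3 om_le).
Qed.

Let V_bounds : (1 - th) * t ^+ 2 <= V <= (1 + th) * t ^+ 2.
Proof. by move: V_close; rewrite thE ler_norml => /andP[? ?]; apply/andP; split; lra. Qed.

Let t2 : 0 < t ^+ 2. Proof. exact: exprn_gt0. Qed.

Let V0 : 0 < V.
Proof.
have /andP[lo _] := V_bounds; apply: lt_le_trans lo; rewrite mulr_gt0 //.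
by move: th_half => h'; lra.
Qed.

Let s0 : 0 < s. Proof. by rewrite sqrtr_gt0. Qed.
Let s2 : s ^+ 2 = V. Proof. by rewrite sqr_sqrtr // ltW. Qed.

(** [|a - 1| <= |a ^ 2 - 1|] for [a >= 0]. *)
Let ratio_close : `|s / t - 1| <= th.
Proof.
have a0 : 0 < s / t by rewrite divr_gt0.
have /andP[lo hi] := V_bounds.
have a2 : (s / t) ^+ 2 = V / t ^+ 2 by rewrite expr_div_n s2.
have l1 : 1 - th <= (s / t) ^+ 2 by rewrite a2 ler_pdivlMr.
have l2 : (s / t) ^+ 2 <= 1 + th by rewrite a2 ler_pdivrMr.
move: (s / t) a0 l1 l2 th0 => a a0 l1 l2 h0; rewrite ler_norml; apply/andP; split.
  by case: (leP 1 a) => a1; [lra | nra].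
by case: (leP 1 a) => a1; [nra | lra].
Qed.

Let s_ge : t / 2 <= s.
Proof.
have := ratio_close; rewrite ler_norml => /andP[lo _].
have : 2^-1 <= s / t by move: th_half => ?; lra.
by rewrite ler_pdivlMr // mulrC.
Qed.

Let Ms : M / s <= 2 * b.
Proof.
rewrite /b mulrCA ler_pM2l // -[2]invrK -invfM lef_pV2 ?posrE ?mulr_gt0 ?invr_gt0 //.
by rewrite mulrC.
Qed.

Let eta : R := kap * q * (M / s).

Let kap0 : 0 < kap. Proof. exact: lt_le_trans ltr01 kap1. Qed.
Let q0 : 0 < q. Proof. exact: lt_le_trans ltr01 q1. Qed.

Let eta0 : 0 <= eta.
Proof. by rewrite !mulr_ge0 ?invr_ge0 ?(ltW s0) ?(ltW kap0) ?(ltW q0) ?(ltW M_gt0). Qed.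

Let eta_le : eta <= 2 * kap * (b * q).
Proof.
apply: le_trans (ler_wpM2l _ Ms) _; first by rewrite mulr_ge0 ?(ltW kap0) ?(ltW q0).
by rewrite le_eqVlt; apply/orP; left; apply/eqP; ring.
Qed.

Let eta_half : eta <= 2^-1.
Proof.
apply: le_trans eta_le _.
have : b * q <= (4 * kap)^-1.
  rewrite leNgt; apply/negP => lt.
  have k4 : 0 < (4 * kap)^-1 by rewrite invr_gt0 mulr_gt0.
  have : (4 * kap)^-1 ^+ 3 < (b * q) ^+ 3.
    by rewrite ltrXn2r // ltW.
  rewrite ltNge exprVn; move/negP; apply; apply: le_trans b_small2.
  rewrite exprMn exprSr -mulrA ler_wpM2l ?sqr_ge0 //.
  exact: le_trans bq3 om_le.
move=> bq; apply: le_trans (ler_wpM2l _ bq) _; first by rewrite mulr_ge0 ?(ltW kap0).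
by rewrite le_eqVlt; apply/orP; left; apply/eqP; field; rewrite gt_eqF.
Qed.

Let meta : m%:R * (2 * eta) <= 4 * kap * om.
Proof.
apply: (@le_trans _ _ (m%:R * (2 * (2 * kap * (b * q))))).
  by rewrite ler_wpM2l // ler_wpM2l.
have -> : m%:R * (2 * (2 * kap * (b * q))) = 4 * kap * (b * q ^+ 3) by rewrite -q2; ring.
by rewrite ler_wpM2l // mulr_ge0 ?(ltW kap0).
Qed.

Definition model_size : R := expR (4 * kap * H).

Let E1 := model_size.

Let eta_pow j : (j <= m)%N -> (1 + 2 * eta) ^+ j <= E1.
Proof.
move=> jm; apply: (@le_trans _ _ (expR (2 * eta) ^+ m)).
  apply: (@le_trans _ _ (expR (2 * eta) ^+ j)).
    by rewrite lerXn2r ?nnegrE ?expR_ge0 ?expR_ge1Dx // addr_ge0 // mulr_ge0.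
  by apply: ler_weXn2l => //; rewrite -expR0 ler_expR mulr_ge0.
rewrite -expRM_natl ler_expR; apply: le_trans meta _.
by rewrite ler_wpM2l // mulr_ge0 ?(ltW kap0).
Qed.

Let modelP : (forall j, (j <= m)%N ->
    `|bernoulli_moment h fv j / j`!%:R| <= G j * s ^+ j * (1 + 2 * eta) ^+ j) /\
  `|bernoulli_moment h fv m / m`!%:R - (~~ odd m)%:R * G m * s ^+ m| <=
    m%:R * (2 * eta) * (1 + 2 * eta) ^+ m * (G m * s ^+ m).
Proof.
have N2 : (2 <= m.+1)%N by [].
have [K [cK K0 K1 K2 Kb]] := bernoulli_cumulants h01 fvM N2 (ltW M_gt0).
set p := \prod_i _ in cK.
have pE j : (j <= m)%N -> bernoulli_moment h fv j / j`!%:R = p`_j.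
  by move=> jm; rewrite (bernoulli_moment_egf h fv (N := m.+1)) // ltnW // ltnS.
have a0 : p`_0 = 1.
  rewrite -(pE 0%N) // /bernoulli_moment fact0 divr1.
  under eq_bigr do rewrite expr0 mulr1.
  have := bernoulli_incl h finset.set0; rewrite big_set0 => <-.
  by apply: eq_bigl => Q; rewrite finset.sub0set.
have a_rec j : (j <= m)%N -> j%:R * p`_j = \sum_(l < j.+1) K`_l * p`_(j - l).
  by move=> jm; apply: (cumulant_rec cK); apply: ltnW; rewrite ltnS.
have K2' : K`_2 = s ^+ 2 by rewrite s2.
have Kb' k : (2 <= k <= m)%N -> `|K`_k| <= s ^+ 2 * M ^+ (k - 2).
  by move=> /andP[k2 km]; rewrite s2; apply: Kb; rewrite k2 ltnW // ltnS.
split=> [j jm|].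
  rewrite pE //; exact: (@moment_size _ _ G0 G1 GS m (fun k => K`_k) (fun k => p`_k) _ _ s0 (ltW M_gt0) a0 a_rec K0 K1 Kb' eta_half j jm).
rewrite pE //; exact: (@moment_asymp _ _ G0 G1 GS m (fun k => K`_k) (fun k => p`_k) _ _ s0 (ltW M_gt0) a0 a_rec K0 K1 K2' Kb' eta_half m (leqnn m)).
Qed.
Let S n : R := centred_sum h fv (Qm n).

Let sj j : 0 < s ^+ j. Proof. exact: exprn_gt0. Qed.
Let fj j : 0 < j`!%:R :> R. Proof. by rewrite ltr0n fact_gt0. Qed.

(** Each summand is at most [M <= s], so the comparison error is at most [s ^ j]
    times a factor that [E_small] absorbs. *)
Let moment_gap j : (j <= m)%N ->
  `|\sum_(n <- r | P n) w n * S n ^+ j - bernoulli_moment h fv j| <=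
    om * (j`!%:R * G j * s ^+ j).
Proof.
move=> jm; rewrite /S -(empE (fun Q => centred_sum h fv Q ^+ j)) /bernoulli_moment -sumrB.
set mu := \sum_i h i * fv i.
rewrite (eq_bigr (fun Q => (emp Q - bernoulli_weight h Q) * (\sum_(i in Q) fv i - mu) ^+ j)); last first.
  move=> Q _; rewrite -mulrBl; congr (_ * _ ^+ _).
  rewrite /centred_sum /mu [X in _ = X - _]big_mkcond -sumrB; apply: eq_bigr => i _.
  by rewrite mulrBl; case: (i \in Q); rewrite ?mul1r ?mul0r.
apply: le_trans (signed_moment_le _ (ltW M_gt0) fvM _ _) _.
set T1 := \sum_(T : {set I} | _) _.
have T1E : T1 <= E.
  apply: le_trans gap_le; rewrite /T1 big_mkcond [leRHS]big_mkcond; apply: ler_sum => T _.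
  case: ifP => Tj; last by case: ifP.
  by rewrite (leq_trans Tj jm).
have T10 : 0 <= T1 by apply: sumr_ge0.
have E0 : 0 <= E := le_trans T10 T1E.
have mW : 1 <= m%:R + W by apply: (@le_trans _ _ m%:R); rewrite ?ler1n // lerDl.
have mW0 : 0 <= m%:R + W := le_trans ler01 mW.
have base : M * j%:R + `|mu| <= s * (m%:R + W).
  apply: (@le_trans _ _ (M * (m%:R + W))).
    by rewrite mulrDr; apply: lerD => //; rewrite ler_wpM2l ?(ltW M_gt0) // ler_nat.
  rewrite ler_wpM2r // -[M](divfK (lt0r_neq0 s0)) ler_piMl ?(ltW s0) //.
  have eM : M / s <= eta.
    rewrite /eta ler_peMl ?divr_ge0 ?(ltW M_gt0) ?(ltW s0) //.
    exact: mulr_ege1.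
  by apply: le_trans eM _; apply: le_trans eta_half _; rewrite invf_le1 // ler1n.
apply: (@le_trans _ _ ((s * (m%:R + W)) ^+ j * E)).
  apply: ler_pM => //; first by rewrite exprn_ge0 // addr_ge0 // mulr_ge0 // ltW.
  by rewrite lerXn2r ?nnegrE // ?mulr_ge0 ?(ltW s0) // addr_ge0 // mulr_ge0 // ltW.
have fg := fact_gauss_ge j.
apply: (@le_trans _ _ ((kap * (m%:R + W)) ^+ m * E * (j`!%:R * G j * s ^+ j))); last first.
  by rewrite ler_wpM2r ?(le_trans E_small) // !mulr_ge0 ?(ltW (g0 _)) // ltW.
apply: (@le_trans _ _ ((kap * (m%:R + W)) ^+ j * E * (j`!%:R * G j * s ^+ j))); last first.
  rewrite ler_wpM2r ?mulr_ge0 ?(ltW (g0 _)) ?(ltW (sj _)) // ler_wpM2r //.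
  by apply: ler_weXn2l => //; exact: mulr_ege1.
rewrite !exprMn.
have -> : kap ^+ j * (m%:R + W) ^+ j * E * (j`!%:R * G j * s ^+ j) =
  (s ^+ j * (m%:R + W) ^+ j * E) * (kap ^+ j * (j`!%:R * G j)) by ring.
by rewrite ler_peMr // !mulr_ge0 ?exprn_ge0 // ltW.
Qed.

Let Bc := E1 + H.

Let emp_size j : (j <= m)%N ->
  \sum_(n <- r | P n) w n * S n ^+ j <= Bc * (j`!%:R * G j * s ^+ j).
Proof.
move=> jm; have := moment_gap jm; rewrite ler_norml => /andP[_].
rewrite lerBlDr => /le_trans; apply; rewrite addrC mulrDl; apply: lerD; last first.
  by rewrite ler_wpM2r // !mulr_ge0 ?(ltW (g0 _)) // ltW.
apply: le_trans (ler_norm _) _.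
have := (modelP.1 j jm); rewrite normrM normfV (ger0_norm (ltW (fj j))) ler_pdivrMr // => /le_trans; apply.
have -> : G j * s ^+ j * (1 + 2 * eta) ^+ j * j`!%:R = (1 + 2 * eta) ^+ j * (j`!%:R * G j * s ^+ j).
  by ring.
by rewrite ler_wpM2r ?eta_pow // !mulr_ge0 ?(ltW (g0 _)) // ltW.
Qed.

(** In order: the non-Gaussian cumulants, the comparison with the model and the
    shift by the remainder, all measured against the model variance; then the
    replacement of that variance by [t ^ 2]. *)
Definition assembly_const : R :=
  let E2 := expR (C1 * H * H) in
  (4 * kap * E1 + 1 + kap * Bc * (2 * kap * C2 * expR (2 * kap * C2 * H))) * E2 + C1 * H * E2.

Let y : R := C2 * (M * (m%:R / d)).
Let u : R := kap * q * (y / s).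

Let y0 : 0 <= y. Proof. by rewrite !mulr_ge0 ?invr_ge0 ?(ltW M_gt0) ?(ltW d0). Qed.
Let u0 : 0 <= u.
Proof. by apply: mulr_ge0; [apply: mulr_ge0; exact: ltW|apply: divr_ge0 => //; exact: ltW]. Qed.

Let u_le : u <= 2 * kap * C2 * om.
Proof.
have -> : u = kap * C2 * q ^+ 3 / d * (M / s).
  by rewrite /u /y -q2; field; rewrite !gt_eqF.
apply: le_trans (ler_wpM2l _ Ms) _.
  by rewrite !mulr_ge0 ?invr_ge0 ?exprn_ge0 ?(ltW kap0) ?(ltW q0) ?(ltW d0).
rewrite le_eqVlt; apply/orP; left; apply/eqP; rewrite /om; field; rewrite gt_eqF //.
Qed.

Lemma assembled_moment :
  `|\sum_(n <- r | P n) w n * (S n + Y n) ^+ m - (~~ odd m)%:R * (m`!%:R * G m * t ^+ m)| <=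
    assembly_const * om * (m`!%:R * G m * t ^+ m).
Proof.
have E10 : 0 <= E1 := expR_ge0 _.
have Bc0 : 0 <= Bc by rewrite addr_ge0.
set Gs := m`!%:R * G m * s ^+ m; set Gt := m`!%:R * G m * t ^+ m.
have Gs0 : 0 <= Gs by rewrite !mulr_ge0 ?(ltW (g0 _)) // ltW.
have Gt0 : 0 <= Gt by rewrite !mulr_ge0 ?(ltW (g0 _)) ?exprn_ge0 // ltW.
have st1 := shifted_moment G0 G1 GS w_ge0 s0 Y_le y0 emp_size Bc0 (erefl u).
have st2 := moment_gap (leqnn m).
have st3 : `|bernoulli_moment h fv m - (~~ odd m)%:R * Gs| <= 4 * kap * om * E1 * Gs.
  have -> : bernoulli_moment h fv m - (~~ odd m)%:R * Gs =
     m`!%:R * (bernoulli_moment h fv m / m`!%:R - (~~ odd m)%:R * G m * s ^+ m).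
    by rewrite /Gs; field; rewrite gt_eqF.
  rewrite normrM (ger0_norm (ltW (fj m))).
  apply: le_trans (ler_wpM2l (ltW (fj m)) modelP.2) _.
  have -> : m`!%:R * (m%:R * (2 * eta) * (1 + 2 * eta) ^+ m * (G m * s ^+ m)) =
     m%:R * (2 * eta) * (1 + 2 * eta) ^+ m * Gs by rewrite /Gs; ring.
  rewrite ler_wpM2r //; apply: ler_pM => //; first by rewrite mulr_ge0 // mulr_ge0.
    by rewrite exprn_ge0 // addr_ge0 // mulr_ge0.
  exact: eta_pow.
have kc0 : 0 <= 2 * kap * C2 by rewrite !mulr_ge0 // ltW.
have us : u * \sum_(k < m) u ^+ k / k`!%:R <= 2 * kap * C2 * om * expR (2 * kap * C2 * H).
  apply: ler_pM => //; first by apply: sumr_ge0 => k _; rewrite divr_ge0 // exprn_ge0.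
  apply: le_trans (exp_sum_le _ u0) _; rewrite ler_expR; apply: le_trans u_le _.
  by rewrite ler_wpM2l.
have kB0 : 0 <= kap * Bc * Gs by rewrite !mulr_ge0 // ltW.
pose K1 := 4 * kap * E1 + 1 + kap * Bc * (2 * kap * C2 * expR (2 * kap * C2 * H)).
have K10 : 0 <= K1.
  by rewrite !addr_ge0 // !mulr_ge0 ?expR_ge0 // ltW.
have tot : `|\sum_(n <- r | P n) w n * (S n + Y n) ^+ m - (~~ odd m)%:R * Gs| <= K1 * om * Gs.
  have st1' := le_trans st1 (ler_wpM2l kB0 us).
  apply: (@le_trans _ _ (kap * Bc * Gs * (2 * kap * C2 * om * expR (2 * kap * C2 * H)) +
     om * Gs + 4 * kap * om * E1 * Gs)).
    move: st1' st2 st3; rewrite -/Gs.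
    set A1 := \sum_(n <- r | P n) _; set A2 := \sum_(n <- r | P n) _.
    move: (bernoulli_moment h fv m) => A3 h1 h2 h3.
    have -> : A1 - (~~ odd m)%:R * Gs = (A1 - A2) + (A2 - A3) + (A3 - (~~ odd m)%:R * Gs) by ring.
    apply: le_trans (ler_normD _ _) _; apply: lerD => //.
    by apply: le_trans (ler_normD _ _) _; apply: lerD.
  by rewrite le_eqVlt; apply/orP; left; apply/eqP; rewrite /K1; ring.
have a0 : 0 <= s / t by rewrite divr_ge0 // ltW.
have [p1 p2] := pow_sub1_le m a0 th0 ratio_close.
have E2 : expR (m%:R * th) <= expR (C1 * H * H).
  by rewrite ler_expR; apply: le_trans mth _; rewrite ler_wpM2l // mulr_ge0.
have GsE : Gs = (s / t) ^+ m * Gt.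
  by rewrite /Gs /Gt expr_div_n; field; rewrite expf_neq0 // gt_eqF.
have -> : forall Z, Z - (~~ odd m)%:R * Gt = (Z - (~~ odd m)%:R * Gs) + (~~ odd m)%:R * ((s / t) ^+ m - 1) * Gt.
  by move=> Z; rewrite GsE; ring.
apply: le_trans (ler_normD _ _) _.
rewrite /assembly_const -/K1 mulrDl mulrDl; apply: lerD.
  apply: le_trans tot _; rewrite GsE.
  have -> : K1 * expR (C1 * H * H) * om * Gt = K1 * om * (expR (C1 * H * H) * Gt) by ring.
  apply: ler_wpM2l; first exact: mulr_ge0 K10 om0.
  by apply: ler_wpM2r => //; exact: le_trans p2 E2.
rewrite normrM (ger0_norm Gt0); apply: ler_wpM2r => //; rewrite normrM.
apply: (@le_trans _ _ (1 * (C1 * H * om * expR (C1 * H * H)))); last first.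
  by rewrite mul1r le_eqVlt; apply/orP; left; apply/eqP; ring.
apply: ler_pM => //; first by case: (odd m); rewrite /= ?normr0 ?normr1.
apply: le_trans p1 _; apply: ler_pM; [exact: mulr_ge0|exact: expR_ge0|exact: mth|exact: E2].
Qed.

End Assembly.

(** * The moment at one point *)

Lemma powR_half_nat (R : realType) (a : R) k : 0 <= a -> a `^ (k%:R / 2) = Num.sqrt a ^+ k.
Proof.
by move=> a0; rewrite mulrC powRrM powR12_sqrt // powR_mulrn // sqrtr_ge0.
Qed.

Lemma chiE (R : realType) m : chi m = (~~ odd m)%:R :> R.
Proof.
rewrite /chi -signr_odd; case: (odd m); rewrite /= ?expr1 ?expr0 ?subrr ?mul0r //.
by rewrite divff // pnatr_eq0.
Qed.

Section Pointwise.
Variables (R : realType) (g : {poly rat}) (rho0 L h0' : R).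
Hypothesis g_nonconst : (1 < size g)%N.
Hypothesis g0 : g.[0] != 0.
Hypothesis g_pos : maps_pos_to_pos g.
Hypothesis rho0_01 : 0 <= rho0 < 1.
Hypothesis L_ge0 : 0 <= L.
Notation D := (size g).-1.
Notation tau := (tilt rho0).

(** Every larger prime is admissible for all the estimates on sieving primes. *)
Definition first_prime : nat :=
  (bad_bound g + size g + Num.truncn ((2 + 4 * L) `^ tau^-1)).+1.

Definition degree_const : R :=
  (size (cleared g))%:R + ln (1 + \sum_(i < size (cleared g)) `|(cleared g)`_i|)%:~R.

Definition density_const : R := D%:R * (2 * L + 2) * (1 + tau^-1).

Definition var_const : R :=
  first_prime%:R + 4 * D%:R + density_const + 4 * D%:R ^+ 2 * (1 + tau^-1).

Definition remainder_const : R :=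
  first_prime%:R + degree_const + (first_prime%:R + 4 * D%:R) + density_const.

Lemma first_prime_bad : (bad_bound g <= first_prime)%N.
Proof. by apply: leqW; rewrite -addnA leq_addr. Qed.

Lemma first_prime_D : (D < first_prime)%N.
Proof. by rewrite ltnS; apply: leq_trans (leq_pred _) _; rewrite addnAC leq_addl. Qed.

Lemma first_prime_good p : prime p -> (first_prime <= p)%N -> good_prime rho0 L p.
Proof.
move=> pp p1p; have [t0 _] := andP (tilt_bounds rho0_01).
have l0 : 0 <= 2 + 4 * L by move: L_ge0 => ?; lra.
have : 2 + 4 * L <= p%:R `^ tau.
  have -> : 2 + 4 * L = ((2 + 4 * L) `^ tau^-1) `^ tau by rewrite -powRrM mulVf ?powRr1 ?gt_eqF.
  apply: ge0_ler_powR; rewrite ?nnegrE ?powR_ge0 ?(ltW t0) //.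
  apply: ltW; apply: lt_le_trans (truncnS_gt _) _; rewrite ler_nat.
  by apply: leq_trans p1p; rewrite /first_prime ltnS leq_addl.
by move: L_ge0 => ? ?; split=> //; lra.
Qed.

Lemma degree_const_ge0 : 0 <= degree_const.
Proof.
rewrite addr_ge0 // ln_ge0 // ler1z lerDl; exact: sumr_ge0.
Qed.

Lemma var_const_ge0 : 0 <= var_const.
Proof.
have [tt0 _] := andP (tilt_bounds rho0_01).
have u0 : 0 <= 1 + tau^-1 by rewrite addr_ge0 // invr_ge0 ltW.
have l0 : 0 <= 2 * L + 2 by rewrite addr_ge0 // mulr_ge0.
have p0 : 0 <= first_prime%:R + 4 * D%:R :> R by rewrite addr_ge0 // mulr_ge0.
apply: addr_ge0; first exact: addr_ge0 p0 (mulr_ge0 (mulr_ge0 (ler0n _ _) l0) u0).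
by apply: mulr_ge0 => //; apply: mulr_ge0 => //; exact: sqr_ge0.
Qed.

(** [g n] is at most a constant times [n ^ size g], and [1 <= ln x] absorbs the
    constant. *)
Lemma natval_log_le n (x : R) : (0 < n)%N -> n%:R <= x -> 1 <= ln x ->
  ln (natval g n)%:R <= degree_const * ln x.
Proof.
move=> n0 nx lx; have x0 : 0 < x by apply: lt_le_trans nx; rewrite ltr0n.
have k0 := natval_gt0 g_pos n0; have kb := natval_le g_pos n0.
set c := \sum_(i < _) _ in kb; have c0 : 0 <= c by apply: sumr_ge0.
set e := size _ in kb.
have c1 : 0 < (1 + c)%:~R :> R by rewrite ltr0z; apply: lt_le_trans ltr01 _; rewrite lerDl.
apply: (@le_trans _ _ (ln ((1 + c)%:~R * x ^+ e))).
  rewrite ler_ln ?posrE ?ltr0n ?mulr_gt0 ?exprn_gt0 //.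
  apply: (@le_trans _ _ ((1 + c)%:~R * n%:R ^+ e)); last first.
    by apply: ler_wpM2l; [exact: ltW|apply: lerXn2r; rewrite ?nnegrE ?(ltW x0)].
  have : (natval g n)%:Z%:~R <= ((1 + c) * n%:Z ^+ e)%:~R :> R.
    rewrite ler_int; apply: le_trans kb _; apply: ler_wpM2r; first exact: exprn_ge0.
    by rewrite lerDr.
  by rewrite rmorphM rmorphXn.
rewrite lnM ?posrE ?exprn_gt0 // lnXn // addrC /degree_const mulrDl -/e -/c mulr_natl lerD2l.
by rewrite ler_peMr // ln_ge0 // ler1z lerDl.
Qed.

Variables (f alpha : nat -> R) (M sigma eta x d : R) (m : nat).
Hypothesis f_add : strongly_additive f.
Hypothesis M_gt0 : 0 < M.
Hypothesis f_le : forall p, prime p -> `|f p| <= M.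
Hypothesis sigma_gt0 : 0 < sigma.
Hypothesis alpha_ge0 : forall n, (0 < n)%N -> 0 <= alpha n.
Hypothesis alpha_mul : Defs.multiplicative alpha.
Hypothesis alpha_pow : forall p k, prime p -> (0 < k)%N ->
  alpha (p ^ k)%N <= L * p%:R `^ ((rho0 + sigma - 1) * k%:R).
Hypothesis x2 : 2 <= x.
Hypothesis lnx : 1 <= ln x.
Hypothesis d01 : 0 < d <= 1.
Hypothesis m_gt0 : (0 < m)%N.
Hypothesis eta0 : 0 <= eta.
Hypothesis S_regular : forall y, 0 < y -> y <= x ->
  `|summatory alpha y - (y / x) `^ sigma * summatory alpha x| <=
    eta * ((y / x) `^ sigma * summatory alpha x) * (x / y) `^ tau.
Notation S := (summatory alpha x).
Notation B := (Bvar f g x).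
Notation X := (Num.truncn x).
Notation kap := (gauss_ratio (@gauss_coef R)).
Notation W := (@mass_bound R g x).
Variable level : R.
Hypothesis level_le : level_sum alpha g x d m <= level * S.
Hypothesis B_gt0 : 0 < B.
Let H : R := h0' `^ (3 / 2).
Hypothesis om_le : M / Num.sqrt B * Num.sqrt m%:R ^+ 3 / d <= H.
Hypothesis small_law_gap :
  (kap * (m%:R + W)) ^+ m * (level + eta * (expR 1 * (1 + W) ^+ m)) <= M / Num.sqrt B.
Hypothesis small1 : var_const * (M / Num.sqrt B) * H <= 2^-1.
Hypothesis small2 : (M / Num.sqrt B) ^+ 2 * H <= (4 * kap) ^- 3.

Let z : R := x `^ (d / m%:R).
Let x0 : 0 < x. Proof. exact: lt_le_trans x2. Qed.
Let d0 : 0 < d. Proof. by case/andP: d01. Qed.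
Let m0 : 0 < m%:R :> R. Proof. by rewrite ltr0n. Qed.
Let dm0 : 0 < d / m%:R. Proof. exact: divr_gt0. Qed.
Let lnz : ln z = d / m%:R * ln x. Proof. by rewrite ln_powR. Qed.
Let lx0 : 0 < ln x. Proof. exact: lt_le_trans lnx. Qed.

Let z1 : 1 < z.
Proof.
rewrite ltNge; apply/negP => /ln_le0; rewrite lnz leNgt (mulr_gt0 dm0 lx0) //.
Qed.

Let zx : z <= x.
Proof.
rewrite -[leRHS]powRr1 ?(ltW x0) // /z ler_powR ?(le_trans _ x2) ?ler1n // ler_pdivrMr // mul1r.
by apply: (@le_trans _ _ 1); [case/andP: d01|rewrite ler1n].
Qed.

Let md1 : 1 <= m%:R / d.
Proof.
by rewrite ler_pdivlMr // mul1r (@le_trans _ _ 1) //; [case/andP: d01|rewrite ler1n].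
Qed.

Let S_gt0 : 0 < S.
Proof.
rewrite /summatory big_ltn; last by rewrite ltnS truncn_ge_nat // ?(le_trans _ x2) // ?ler1n.
rewrite alpha_mul.1 ltr_pwDl // big_nat_cond sumr_ge0 // => n /andP[/andP[n2 _] _].
by apply: alpha_ge0; apply: ltn_trans n2.
Qed.

Notation p1 := first_prime.
Notation mass := (local_mass alpha sigma X.+2).

Let mass_ge0 p : prime p -> 0 <= mass p.
Proof. exact: local_mass_ge0. Qed.

Let mass_le p : prime p -> (p1 <= p)%N -> mass p <= 2 * L * p%:R `^ (- tau).
Proof.
move=> pp p1p; have [_ h _] := first_prime_good pp p1p.
exact: (local_mass_le rho0_01 alpha_ge0 alpha_pow).
Qed.

Let tau01 : 0 < tau <= 1. Proof. exact: tilt_bounds. Qed.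
Let rhoD := rho_le_D g_nonconst first_prime_bad.

Let density_const_ge0 : 0 <= density_const.
Proof.
have [t0 _] := andP tau01.
by rewrite !mulr_ge0 ?addr_ge0 ?mulr_ge0 ?invr_ge0 // ltW.
Qed.

Let outside_le : \sum_(0 <= p < X.+1 | prime p && ~~ sieving p1 z p) (rho g p)%:R / p%:R <=
   (p1%:R + 4 * D%:R) * (m%:R / d).
Proof.
have X2 := X2 x2; have XR : 0 < X%:R :> R by rewrite ltr0n ltnW.
apply: le_trans (sum_outside (rho_le_self g) rhoD X2 z1) _.
rewrite [leRHS]mulrDl; apply: lerD; first by rewrite ler_peMr.
rewrite ler_wpM2l ?mulr_ge0 // lnz ler_pdivrMr ?(mulr_gt0 dm0 lx0) //.
have -> : m%:R / d * (d / m%:R * ln x) = ln x by field; rewrite !gt_eqF.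
by rewrite ler_ln ?posrE // X_le.
Qed.

Let approx_le : \sum_(0 <= p < X.+1 | sieving p1 z p)
    `|density (rho g) mass p - (rho g p)%:R / p%:R| <= density_const * (m%:R / d).
Proof.
apply: le_trans (_ : _ <= density_const) _; last by rewrite ler_peMr.
exact: (sum_density_approx _ rhoD mass_ge0 mass_le L_ge0 tau01).
Qed.

(** The constant depends on [g], [rho0], [L] and [h0'] only, whereas the size
    conditions on [x] may involve everything else. *)
Lemma pointwise_moment : exists2 err : R,
  `|err| <= assembly_const (@gauss_coef R) var_const remainder_const H *
              (M * m%:R `^ (3 / 2) / (d * Num.sqrt B))
  & S^-1 * \sum_(1 <= n < X.+1) alpha n * (f (natval g n) - Amean f g x) ^+ m
    = Cmoment m * B `^ (m%:R / 2) * (chi m + err).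
Proof.
set t := Num.sqrt B; have t0 : 0 < t by rewrite sqrtr_gt0.
have t2 : t ^+ 2 = B by rewrite sqr_sqrtr // ltW.
pose hI := sieve_density g alpha sigma z p1 : 'I_X.+1 -> R.
pose fv := sieve_value f (x := x) z p1.
have h01 i : 0 <= hI i <= 1.
  exact: (sieve_density01 g_nonconst z first_prime_bad first_prime_D mass_ge0).
have fvM i : `|fv i| <= M by exact: (sieve_value_le (ltW M_gt0) f_le).
pose P n := (1 <= n < X.+1)%N && true.
pose r := index_iota 1 X.+1.
have w0 n : P n -> 0 <= S^-1 * alpha n.
  by move=> /andP[/andP[n1 _] _]; rewrite mulr_ge0 ?invr_ge0 ?(ltW S_gt0) ?alpha_ge0.
have empE phi : \sum_Q empirical_weight g alpha (x := x) z p1 Q * phi Q =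
    \sum_(n <- r | P n) S^-1 * alpha n * phi (prime_divisors g x z p1 n).
  rewrite empirical_sum big_nat_cond mulr_sumr.
  by apply: eq_bigr => n _; rewrite mulrA.
have W0 : 0 <= W.
  apply: le_trans (sum_rho_le g_nonconst z x2 first_prime_bad).
  by apply: sumr_ge0 => i _; rewrite mulr_ge0 // divr_ge0.
have C1 : 0 <= var_const := var_const_ge0.
have C2 : 0 <= remainder_const.
  have p10 : 0 <= p1%:R :> R by [].
  have q10 : 0 <= p1%:R + 4 * D%:R :> R by rewrite addr_ge0 // mulr_ge0.
  exact: addr_ge0 (addr_ge0 (addr_ge0 p10 degree_const_ge0) q10) density_const_ge0.
have H0 : 0 <= H := powR_ge0 _ _.
have Vc : `|bernoulli_var hI fv - t ^+ 2| <= var_const * (M ^+ 2 * (m%:R / d)).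
  rewrite t2; apply: le_trans (var_gap_le g alpha sigma (ltW M_gt0) f_le x z p1) _.
  rewrite [leRHS]mulrCA ler_wpM2l ?sqr_ge0 // mulrDl; apply: lerD.
    by rewrite mulrDl; apply: lerD; [exact: outside_le|exact: approx_le].
  apply: le_trans (_ : _ <= 4 * D%:R ^+ 2 * (1 + tau^-1)) _; last first.
    have [tt0 _] := andP tau01.
    by rewrite ler_peMr // !mulr_ge0 ?addr_ge0 ?sqr_ge0 ?invr_ge0 // ltW.
  exact: (sum_density_sqr _ rhoD mass_ge0 tau01).
have Yl n : P n -> `|remainder g f alpha sigma x z p1 n| <= remainder_const * (M * (m%:R / d)).
  move=> /andP[/andP[n1 nX] _].
  have nx : n%:R <= x by apply: le_trans (X_le x2); rewrite ler_nat -ltnS.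
  apply: le_trans (remainder_le alpha sigma g_pos f_add (ltW M_gt0) f_le p1 x2 z1 zx n1) _.
  rewrite [leRHS]mulrCA ler_wpM2l ?(ltW M_gt0) //.
  apply: (@le_trans _ _ (p1%:R * (m%:R / d) + degree_const * (m%:R / d) +
    (p1%:R + 4 * D%:R) * (m%:R / d) + density_const * (m%:R / d))); last first.
    by rewrite /remainder_const !mulrDl.
  apply: lerD; last exact: approx_le.
  apply: lerD; last exact: outside_le.
  apply: lerD; first by rewrite ler_peMr.
  rewrite lnz ler_pdivrMr ?(mulr_gt0 dm0 lx0) //.
  have -> : degree_const * (m%:R / d) * (d / m%:R * ln x) = degree_const * ln x.
    by field; rewrite !gt_eqF.
  exact: natval_log_le.
have mu : `|\sum_i hI i * fv i| <= M * W.
  exact: (mean_le g_nonconst (ltW M_gt0) f_le z x2 first_prime_bad mass_ge0).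
have gapE : \sum_(T : {set 'I_X.+1} | (#|T| <= m)%N)
    `|incl_weight (fun Q => empirical_weight g alpha (x := x) z p1 Q - bernoulli_weight hI Q) T|
   <= level + eta * (expR 1 * (1 + W) ^+ m).
  have x1 : 1 <= x by apply: le_trans x2; rewrite ler1n.
  apply: le_trans (sum_law_gap_le g0 g_pos alpha_ge0 alpha_mul alpha_pow x1 eta0 S_regular
    first_prime_bad first_prime_good S_gt0 (erefl z) (ltW z1)) _.
  apply: lerD; first by rewrite ler_pdivrMl // mulrC.
  rewrite ler_wpM2l // ler_wpM2l ?expR_ge0 //.
  apply: lerXn2r; rewrite ?nnegrE ?addr_ge0 //.
    by apply: sumr_ge0 => i _; rewrite mulr_ge0 // divr_ge0.
  by rewrite lerD2l; exact: (sum_rho_le g_nonconst z x2 first_prime_bad).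
have := assembled_moment (gauss_coef0 R) (gauss_coef1 R) (@gauss_coefS R) h01 M_gt0 fvM w0 empE
  m_gt0 t0 d01 W0 C1 C2 H0 om_le Vc Yl mu gapE small_law_gap small1 small2.
set c := assembly_const _ _ _ _; set G := m`!%:R * _ * _.
set T := \sum_(n <- r | P n) _.
have -> : T = S^-1 * \sum_(1 <= n < X.+1) alpha n * (f (natval g n) - Amean f g x) ^+ m.
  rewrite big_nat_cond mulr_sumr; apply: eq_bigr => n _.
  by rewrite mulrA; congr (_ * _ ^+ _); rewrite /remainder addrC subrK.
set Z := S^-1 * _ => main.
have Gpos : 0 < G.
  rewrite !mulr_gt0 ?exprn_gt0 ?ltr0n ?fact_gt0 //.
  exact: (gauss_gt0 (gauss_coef0 R) (gauss_coef1 R) (@gauss_coefS R)).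
have GE : Cmoment m * B `^ (m%:R / 2) = G by rewrite CmomentE powR_half_nat ?(ltW B_gt0).
exists (Z / G - chi m); last by rewrite GE; field; rewrite gt_eqF.
rewrite chiE powR_half_nat //.
have -> : Z / G - (~~ odd m)%:R = (Z - (~~ odd m)%:R * G) / G by field; rewrite gt_eqF.
rewrite normrM normfV (gtr0_norm Gpos) ler_pdivrMr //; apply: le_trans main _.
rewrite le_eqVlt; apply/orP; left; apply/eqP; congr (_ * _ * _).
by field; rewrite !gt_eqF.
Qed.

End Pointwise.

(** * Large arguments *)

(** With [y = c2 lam], the factor [y ^ (2 m + 1)] is at most
    [exp (c4 lam ^ (1/3 + a))] for any small [a > 0], by [a ln y <= y ^ a]; both
    exponentials beat it as soon as [lam ^ a] is large. *)
Lemma small_gap_eventually (R : realType) (A c c2 c3 eps : R) :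
  0 <= A -> 0 < c -> 1 <= c2 -> 0 <= c3 -> 0 < eps ->
  exists2 Lam : R, 1 <= Lam & forall (lam : R) (m : nat), Lam <= lam -> (0 < m)%N ->
    m%:R <= c3 * lam `^ 3^-1 ->
    (c2 * lam) ^+ m * (A * expR (- lam `^ (3^-1 + eps)) + A * expR (- (c * lam)) * (c2 * lam) ^+ m)
      * (c2 * lam) <= 1.
Proof.
move=> A0 c0 c21 c30 eps0.
pose a : R := Num.min eps 3^-1 / 2.
have a0 : 0 < a by rewrite /a divr_gt0 // lt_min eps0 invr_gt0 ltr0n.
have a_eps : a <= eps - a.
  have : Num.min eps 3^-1 <= eps by rewrite ge_min lexx.
  by rewrite /a; lra.
have a_third : a <= 2 / 3 - a.
  have : Num.min eps 3^-1 <= 3^-1 :> R by rewrite ge_min lexx orbT.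
  by rewrite /a; lra.
pose c4 := 3 * c3 * (c2 `^ a / a).
have c40 : 0 <= c4 by rewrite !mulr_ge0 ?powR_ge0 ?invr_ge0 // ltW.
pose c7 := (c4 + 2 * A) * (1 + c^-1).
have c70 : 0 <= c7.
  apply: mulr_ge0; apply: addr_ge0 => //; first exact: mulr_ge0.
  by rewrite invr_ge0 ltW.
exists (1 + c7 `^ a^-1); first by rewrite lerDl powR_ge0.
move=> lam m lamL m0 mle.
have lam1 : 1 <= lam by apply: le_trans lamL; rewrite lerDl powR_ge0.
have lam0 : 0 < lam := lt_le_trans ltr01 lam1.
have la : c7 <= lam `^ a.
  rewrite -[c7]powRr1 // -(mulVf (lt0r_neq0 a0)) powRrM.
  apply: ge0_ler_powR; rewrite ?nnegrE ?powR_ge0 ?(ltW a0) ?(ltW lam0) //.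
  by apply: le_trans lamL; rewrite lerDr.
set y := c2 * lam; have y1 : 1 <= y by apply: mulr_ege1.
have y0 : 0 < y := lt_le_trans ltr01 y1.
pose P := lam `^ (3^-1 + a).
have P1 : 1 <= P by apply: powR_ge1 => //; rewrite addr_ge0 ?invr_ge0 // ltW.
have P0 : 0 <= P := le_trans ler01 P1.
have mm : ((m + m).+1 <= 3 * m)%N by clear -m0; lia.
have ypow : y ^+ m * y ^+ m * y <= expR (c4 * P).
  have -> : y ^+ m * y ^+ m * y = expR ((m + m).+1%:R * ln y).
    by rewrite expRM_natl lnK ?posrE // exprSr exprD.
  rewrite ler_expR.
  have ly0 : 0 <= ln y by rewrite ln_ge0.
  apply: (@le_trans _ _ (3 * (c3 * lam `^ 3^-1) * ln y)).
    rewrite ler_wpM2r //; apply: (@le_trans _ _ (3 * m%:R)); last by rewrite ler_wpM2l.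
    by rewrite -natrM ler_nat.
  have lny : ln y <= c2 `^ a * lam `^ a / a.
    rewrite ler_pdivlMr // mulrC -powRM ?(le_trans ler01) // ?(ltW lam0) //.
    exact: ln_le_powR.
  apply: le_trans (ler_wpM2l _ lny) _; first by rewrite !mulr_ge0 // powR_ge0.
  rewrite le_eqVlt; apply/orP; left; apply/eqP.
  rewrite /c4 /P powRD; last by apply/implyP => _; rewrite gt_eqF.
  by ring.
have e2A : A <= expR (2 * A) / 2.
  by have := expR_ge1Dx (2 * A); lra.
have half T : (c4 + 2 * A) * P <= T -> y ^+ m * y ^+ m * y * (A * expR (- T)) <= 2^-1.
  move=> hT; apply: (@le_trans _ _ (expR (c4 * P) * (expR (2 * A) / 2 * expR (- T)))).
    have yy0 : 0 <= y ^+ m * y ^+ m * y by apply: mulr_ge0; [apply: mulr_ge0; exact: exprn_ge0 (ltW y0)|exact: ltW].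
    apply: ler_pM => //.
      by rewrite mulr_ge0 // expR_ge0.
    by rewrite ler_wpM2r // expR_ge0.
  have -> : expR (c4 * P) * (expR (2 * A) / 2 * expR (- T)) = expR (c4 * P + 2 * A - T) / 2.
    by rewrite !expRD; ring.
  rewrite ler_pdivrMr // mulVf // -[leRHS]expR0 ler_expR subr_le0.
  by apply: le_trans hT; rewrite [leRHS]mulrDl lerD2l ler_peMr // mulr_ge0.
have cV0 : 0 <= c^-1 by rewrite invr_ge0 ltW.
have s0 : 0 <= c4 + 2 * A by rewrite addr_ge0 // mulr_ge0.
have l1 : (c4 + 2 * A) * P <= lam `^ (3^-1 + eps).
  have -> : lam `^ (3^-1 + eps) = lam `^ (eps - a) * P.
    rewrite /P -powRD; last by apply/implyP => _; rewrite gt_eqF.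
    by congr (_ `^ _); ring.
  rewrite ler_wpM2r //; apply: (@le_trans _ _ (lam `^ a)); last by rewrite ler_powR.
  by apply: le_trans la; rewrite /c7 ler_peMr // lerDl.
have l2 : (c4 + 2 * A) * P <= c * lam.
  have -> : c * lam = c * lam `^ (2 / 3 - a) * P.
    rewrite /P -mulrA -powRD; last by apply/implyP => _; rewrite gt_eqF.
    by rewrite (_ : 2 / 3 - a + (3^-1 + a) = 1) ?powRr1 ?(ltW lam0) //; field.
  rewrite ler_wpM2r // -ler_pdivrMl //.
  apply: (@le_trans _ _ (lam `^ a)); last by rewrite ler_powR.
  by apply: le_trans la; rewrite /c7 mulrC ler_wpM2l // lerDr.
have h1 := half _ l1; have h2 := half _ l2.
apply: (@le_trans _ _ (2^-1 + 2^-1)); last by lra.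
apply: le_trans (lerD h1 h2).
rewrite mulrDr mulrDl; apply: lerD; last by rewrite le_eqVlt; apply/orP; left; apply/eqP; ring.
have ym : 1 <= y ^+ m by rewrite exprn_ege1.
rewrite mulrAC ler_wpM2r ?mulr_ge0 ?expR_ge0 // -mulrA ler_wpM2l ?exprn_ge0 ?(ltW y0) //.
by rewrite ler_peMl // ltW.
Qed.

(** The range of [m] says precisely that the relative error is bounded. *)
Lemma moment_range_level (R : realType) (h0 h0' M B d : R) m : 0 < h0' -> 0 < M -> 0 < B ->
  0 < d -> moment_range h0 h0' M B d m ->
  M / Num.sqrt B * Num.sqrt m%:R ^+ 3 / d <= h0' `^ (3 / 2).
Proof.
move=> hp M0 B0 d0 [_]; rewrite le_min => /andP[_ mle].
have t0 : 0 < Num.sqrt B by rewrite sqrtr_gt0.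
set t := Num.sqrt B in t0 *.
have ZE : d ^+ 2 * B / M ^+ 2 = (d * t / M) ^+ 2.
  by rewrite expr_div_n exprMn sqr_sqrtr // ltW.
have w0 : 0 < d * t / M by rewrite !mulr_gt0 ?invr_gt0.
have Z0 : 0 <= (d ^+ 2 * B / M ^+ 2) `^ 3^-1 := powR_ge0 _ _.
have : Num.sqrt m%:R ^+ 3 <= h0' `^ (3 / 2) * (d * t / M).
  rewrite -powR_half_nat //; apply: (@le_trans _ _ ((h0' * (d ^+ 2 * B / M ^+ 2) `^ 3^-1) `^ (3 / 2))).
    by apply: ge0_ler_powR; rewrite ?nnegrE ?mulr_ge0 // ltW.
  rewrite powRM ?(ltW hp) // ler_wpM2l ?powR_ge0 // -powRrM ZE.
  have -> : 3^-1 * (3 / 2) = 2^-1 :> R by field.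
  by rewrite powR12_sqrt ?sqr_ge0 // sqrtr_sqr gtr0_norm.
move=> h; have -> : M / t * Num.sqrt m%:R ^+ 3 / d = Num.sqrt m%:R ^+ 3 / (d * t / M).
  by field; rewrite !gt_eqF.
by rewrite ler_pdivrMr.
Qed.

(** Since [B = O (M ^ 2 ln ln x)], this gives [m = O ((ln ln x) ^ (1/3))]. *)
Lemma moment_range_size (R : realType) (h0 h0' M B d : R) m c : 0 <= h0' -> 0 < M -> 0 <= B ->
  0 < d <= 1 -> B <= M ^+ 2 * c -> moment_range h0 h0' M B d m ->
  m%:R <= h0' * c `^ 3^-1.
Proof.
move=> hp M0 B0 /andP[d0 d1] Bc [_]; rewrite le_min => /andP[_ mle].
apply: le_trans mle _; rewrite ler_wpM2l //.
have M2 : 0 < M ^+ 2 by rewrite exprn_gt0.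
have c0 : 0 <= c by rewrite -(pmulr_rge0 _ M2) (le_trans B0).
have d20 : 0 <= d ^+ 2 := sqr_ge0 _.
have q0 : 0 <= d ^+ 2 * B / M ^+ 2 by rewrite divr_ge0 ?(ltW M2) // mulr_ge0.
apply: ge0_ler_powR; rewrite ?nnegrE //.
rewrite ler_pdivrMr // [leRHS]mulrC; apply: le_trans Bc.
by rewrite ler_piMl // exprn_ile1 // ltW.
Qed.

Theorem theorem2p3 (R : realType) (g : {poly rat})
    (g_nonconst : (1 < size g)%N) (g_irr : irreducible_poly g)
    (g0 : g.[0] != 0) (g_pos : maps_pos_to_pos g)
    (A0 beta sigma0 theta0 rho0 r L : R)
    (h0 h0' eps0 L0 : R)
    (h0_gt0 : 0 < h0) (h0_lt : h0 < (3 / 2) `^ (2 / 3))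
    (h0'_gt0 : 0 < h0') (eps0_gt0 : 0 < eps0) :
  exists K : R, 0 < K /\
  forall (f : nat -> R) (M : R) (alpha : nat -> R) (delta : R -> R),
    strongly_additive f ->
    0 < M ->
    (forall p : nat, prime p -> `|f p| <= M) ->
    in_Mstar alpha A0 beta sigma0 theta0 rho0 r L ->
    (forall x : R, 0 < delta x <= 1) ->
    (delta x ^+ 2 * Bvar f g x @[x --> +oo] --> +oo) ->
    (\forall x \near +oo, forall m : nat,
       moment_range h0 h0' M (Bvar f g x) (delta x) m ->
       level_sum alpha g x (delta x) m
         <= L0 * (summatory alpha x
                  * expR (- (ln (ln x) `^ (3^-1 + eps0))))) ->
    \forall x \near +oo, forall m : nat,
      moment_range h0 h0' M (Bvar f g x) (delta x) m ->
      exists2 err : R,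
        `|err| <= K * (M * m%:R `^ (3 / 2) / (delta x * Num.sqrt (Bvar f g x)))
        & (summatory alpha x)^-1
            * \sum_(1 <= n < (Num.truncn x).+1)
                alpha n * (f (natval g n) - Amean f g x) ^+ m
          = Cmoment m * Bvar f g x `^ (m%:R / 2) * (chi m + err).
Proof.
pose kap : R := gauss_ratio (@gauss_coef R).
have kap1 : 1 <= kap := gauss_ratio_ge1 (gauss_coef0 R) (gauss_coef1 R) (@gauss_coefS R).
have kap0 : 0 < kap := lt_le_trans ltr01 kap1.
pose H : R := h0' `^ (3 / 2); have H0 : 0 <= H := powR_ge0 _ _.
pose vc := var_const g rho0 L.
pose AC : R := assembly_const (@gauss_coef R) vc (remainder_const g rho0 L) H.
exists (1 + `|AC|); split; first by rewrite ltr_pwDl.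
move=> f M alpha delta f_add M0 fM [A00 beta0 sigma0_gt0 _ rho01 r01 al0 alM alpow alprimes alsum _].
move=> d01 Binf levelx.
have L00 : 0 <= L := prime_power_bound_ge0 al0 alpow.
have [Ct Ct0 HCt] := theta_asymp A00 beta0 sigma0_gt0 alprimes.
have [E Esum] := alsum.
have [Ch Ch0 HCh] := higher_sum_le sigma0_gt0 rho01 r01 al0 alpow Esum.
have [t1 t2 _ _] := power_room_bounds sigma0_gt0 rho01 r01.
have tb : 0 < power_room sigma0 rho0 r <= sigma0.
  by rewrite t1 (le_trans t2) // ler_pdivrMr // ler_peMr ?(ltW sigma0_gt0) // ler1n.
have [C [X0 [C0 X01 Sreg]]] := summatory_regular A00 sigma0_gt0 (divr_gt0 beta0 sigma0_gt0) tb Ct0 Ch0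
  al0 alM HCt HCh (tilt_bounds rho01).
have [c0 _] := andP (log_saving_bounds A00 sigma0_gt0).
set c := log_saving A0 sigma0 in c0 Sreg.
pose D : R := (size g).-1%:R.
pose p1 := first_prime g rho0 L.
pose c1 : R := p1%:R + 11 * D.
have D0 : 0 <= D by [].
have c11 : 1 <= c1 by apply: (@le_trans _ _ p1%:R); [rewrite ler1n|rewrite lerDl mulr_ge0].
pose c3 : R := h0' * c1 `^ 3^-1.
have c30 : 0 <= c3 by rewrite mulr_ge0 ?powR_ge0 // ltW.
pose c2 : R := kap * (c3 + 44 * D) + (1 + 44 * D) + c1.
have k44 : 0 <= kap * (c3 + 44 * D) by rewrite mulr_ge0 ?(ltW kap0) // addr_ge0 // mulr_ge0.
have D44 : 0 <= 44 * D by rewrite mulr_ge0.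
have c10 : 0 <= c1 := le_trans ler01 c11.
have s44 : 0 <= 1 + 44 * D := addr_ge0 ler01 D44.
have c2k : kap * (c3 + 44 * D) <= c2 by rewrite /c2 -addrA lerDl; exact: addr_ge0 s44 c10.
have c2D : 1 + 44 * D <= c2 by rewrite /c2 addrAC lerDr; exact: addr_ge0 k44 c10.
have c2c : c1 <= c2 by rewrite /c2 lerDr; exact: addr_ge0 k44 s44.
have c21 : 1 <= c2 := le_trans c11 c2c.
pose A : R := `|L0| + C * expR 1.
have A_ge0 : 0 <= A by rewrite addr_ge0 // mulr_ge0 // expR_ge0.
have [Lam Lam1 HLam] := small_gap_eventually A_ge0 c0 c21 c30 eps0_gt0.
have vc0 : 0 <= vc := var_const_ge0 g rho01 L00.
pose q0 : R := 1 + 2 * (vc * H) + (1 + H) * (4 * kap) ^+ 3.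
have k43 : 0 < (4 * kap) ^+ 3 by rewrite exprn_gt0 // mulr_gt0.
have vH : 0 <= vc * H := mulr_ge0 vc0 H0.
have Hk : 0 <= H * (4 * kap) ^+ 3 by rewrite mulr_ge0 // ltW.
have vH2 : 0 <= 2 * (vc * H) by rewrite mulr_ge0.
have kH : H * (4 * kap) ^+ 3 <= (1 + H) * (4 * kap) ^+ 3.
  by rewrite ler_wpM2r ?(ltW k43) // lerDr.
have kH0 : 0 <= (1 + H) * (4 * kap) ^+ 3 := le_trans Hk kH.
have q01 : 1 <= q0 by rewrite /q0 -addrA lerDl; exact: addr_ge0 vH2 kH0.
have q0v : 2 * (vc * H) <= q0 by rewrite /q0 addrAC lerDr; exact: addr_ge0 ler01 kH0.
have q0k : H * (4 * kap) ^+ 3 <= q0 by apply: le_trans kH _; rewrite /q0 lerDr; exact: addr_ge0 ler01 vH2.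
have q00 : 0 < q0 := lt_le_trans ltr01 q01.
have nine0 (u v : R) : u <= v -> 1 <= v -> 9 + 2 * u <= 11 * v by clear; lra.
near=> x => m rng.
have x2 : 2 <= x by near: x; apply: nbhs_pinfty_ge; rewrite num_real.
have xX0 : X0 <= x by near: x; apply: nbhs_pinfty_ge; rewrite num_real.
have xL : expR (expR Lam) <= x by near: x; apply: nbhs_pinfty_ge; rewrite num_real.
have Bbig : (M * q0) ^+ 2 <= delta x ^+ 2 * Bvar f g x.
  near: x; move/cvgryPge: Binf; exact.
have lev : level_sum alpha g x (delta x) m <= L0 * (summatory alpha x * expR (- (ln (ln x) `^ (3^-1 + eps0)))).
  by move: m rng; near: x.
have x0 : 0 < x := lt_le_trans (ltr0Sn R 1) x2.
have [d0 d1] := andP (d01 x).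
set d := delta x in d0 d1 Bbig lev rng *.
set B := Bvar f g x in Bbig rng *.
have Mq0 : 0 < M * q0 by rewrite mulr_gt0.
have B0 : 0 < B.
  have : 0 < d ^+ 2 * B by apply: lt_le_trans Bbig; rewrite exprn_gt0.
  by rewrite pmulr_rgt0 // exprn_gt0.
have B_ge : (M * q0) ^+ 2 <= B.
  by apply: le_trans Bbig _; rewrite ler_piMl ?exprn_ile1 // ltW.
have t0 : 0 < Num.sqrt B by rewrite sqrtr_gt0.
have t_ge : M * q0 <= Num.sqrt B.
  by rewrite -ler_sqr ?nnegrE ?(ltW Mq0) ?sqrtr_ge0 // sqr_sqrtr // ltW.
set b := M / Num.sqrt B.
have b0 : 0 < b by rewrite divr_gt0.
have bq0 : b * q0 <= 1 by rewrite /b mulrAC ler_pdivrMr // mul1r.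
have hb y : y <= q0 -> b * y <= 1.
  by move=> h; apply: le_trans bq0; rewrite ler_wpM2l // ltW.
have small1 : vc * b * H <= 2^-1.
  have : b * (2 * (vc * H)) <= 1 by exact: hb.
  have -> : vc * b * H = b * (2 * (vc * H)) / 2 by field.
  by rewrite ler_pdivrMr // mulVf.
have small2 : b ^+ 2 * H <= (4 * kap) ^- 3.
  rewrite -(ler_pM2r k43) mulVf ?gt_eqF //.
  have -> : b ^+ 2 * H * (4 * kap) ^+ 3 = b * (b * (H * (4 * kap) ^+ 3)) by ring.
  apply: (@le_trans _ _ (b * 1)); last exact: hb.
  by rewrite ler_wpM2l ?(ltW b0) //; exact: hb.
have lx_ge : expR Lam <= ln x by rewrite -[leLHS]expRK ler_ln ?posrE ?expR_gt0.
have lx1 : 1 <= ln x.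
  by apply: le_trans lx_ge; rewrite -expR0 ler_expR (le_trans ler01).
have lx0 : 0 < ln x := lt_le_trans ltr01 lx1.
pose lam := ln (ln x).
have lamL : Lam <= lam by rewrite -[leLHS]expRK ler_ln ?posrE ?expR_gt0.
have lam1 : 1 <= lam := le_trans Lam1 lamL.
have lam0 : 0 < lam := lt_le_trans ltr01 lam1.
have X2' := X2 x2; have XR : 0 < (Num.truncn x)%:R :> R by rewrite ltr0n ltnW.
have lX0 : 0 < ln (Num.truncn x)%:R :> R by rewrite ln_gt0 // ltr1n.
have llX : ln (ln (Num.truncn x)%:R) <= lam.
  by rewrite /lam ler_ln ?posrE // ler_ln ?posrE // X_le.
have nine : 9 + 2 * ln (ln (Num.truncn x)%:R) <= 11 * lam by exact: nine0.
have W_le : mass_bound g x <= 44 * D * lam.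
  rewrite /mass_bound -/D (_ : 44 * D * lam = 4 * D * (11 * lam)); last by ring.
  by rewrite ler_wpM2l // mulr_ge0.
have W_ge0 : 0 <= mass_bound g x.
  apply: le_trans (sum_rho_le g_nonconst 1 x2 (first_prime_bad g rho0 L)).
  by apply: sumr_ge0 => i _; rewrite mulr_ge0 // divr_ge0.
have B_le : B <= M ^+ 2 * (c1 * lam).
  apply: le_trans (Bvar_le g_nonconst (ltW M0) fM x2 (first_prime_bad g rho0 L)) _.
  apply: ler_wpM2l; first exact: sqr_ge0.
  rewrite /c1 [leRHS]mulrDl (mulrC 11 D) -[D * 11 * lam]mulrA; apply: lerD; first by rewrite ler_peMr.
  by rewrite ler_wpM2l.
have m0 : (0 < m)%N by case: rng.
have m_le : m%:R <= c3 * lam `^ 3^-1.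
  rewrite /c3 -mulrA -powRM ?(le_trans ler01) ?(ltW lam0) //.
  exact: moment_range_size (ltW h0'_gt0) M0 (ltW B0) (d01 x) B_le rng.
have m_le' : m%:R <= c3 * lam.
  apply: le_trans m_le _; rewrite ler_wpM2l // -[leRHS]powRr1 ?(ltW lam0) // ler_powR //.
  by rewrite invf_le1 // ler1n.
have km : kap * (m%:R + mass_bound g x) <= c2 * lam.
  apply: (@le_trans _ _ (kap * (c3 + 44 * D) * lam)).
    by rewrite -mulrA ler_wpM2l ?(ltW kap0) // mulrDl lerD.
  by rewrite ler_wpM2r ?(ltW lam0).
have wm : 1 + mass_bound g x <= c2 * lam.
  apply: (@le_trans _ _ ((1 + 44 * D) * lam)); first by rewrite mulrDl mul1r lerD.
  by rewrite ler_wpM2r ?(ltW lam0).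
have y1 : 1 <= c2 * lam by apply: mulr_ege1.
have t_le : Num.sqrt B <= M * (c2 * lam).
  rewrite -ler_sqr ?nnegrE ?sqrtr_ge0 ?mulr_ge0 ?(ltW M0) ?(le_trans ler01) // sqr_sqrtr ?(ltW B0) //.
  apply: le_trans B_le _; rewrite exprMn ler_wpM2l ?sqr_ge0 //.
  apply: (@le_trans _ _ (c2 * lam)); first by rewrite ler_wpM2r ?(ltW lam0).
  by rewrite expr2 ler_peMr // (le_trans ler01).
have small := HLam lam m lamL m0 m_le.
set eta := C * ln x `^ (- c) in Sreg *.
have etaE : C * ln x `^ (- c) = C * expR (- (c * lam)) by rewrite powR_exp // mulNr.
have gap : (kap * (m%:R + mass_bound g x)) ^+ m *
    (L0 * expR (- lam `^ (3^-1 + eps0)) + C * ln x `^ (- c) * (expR 1 * (1 + mass_bound g x) ^+ m))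
    <= M / Num.sqrt B.
  apply: (@le_trans _ _ (c2 * lam)^-1); last first.
    rewrite ler_pdivlMr // mulrC ler_pdivrMr ?(lt_le_trans ltr01) //.
  rewrite -[leRHS]mul1r ler_pdivlMr ?(lt_le_trans ltr01) //; apply: le_trans small.
  apply: ler_wpM2r; first exact: le_trans y1.
  set W := mass_bound g x in W_ge0 km wm *.
  set y := c2 * lam in y1 km wm *.
  have e1 : 0 <= expR (- lam `^ (3^-1 + eps0)) := expR_ge0 _.
  have e2 : 0 <= expR (- (c * lam)) := expR_ge0 _.
  have y0 : 0 <= y := le_trans ler01 y1.
  have W1 : 0 <= 1 + W by rewrite addr_ge0.
  have kW : 0 <= kap * (m%:R + W) by rewrite mulr_ge0 ?(ltW kap0) // addr_ge0.
  apply: (@le_trans _ _ ((kap * (m%:R + W)) ^+ m *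
     (A * expR (- lam `^ (3^-1 + eps0)) + A * expR (- (c * lam)) * y ^+ m))).
    apply: ler_wpM2l; first exact: exprn_ge0.
    rewrite etaE; apply: lerD.
      rewrite ler_wpM2r //; apply: le_trans (ler_norm _) _.
      by rewrite /A lerDl mulr_ge0 // expR_ge0.
    rewrite mulrA; apply: ler_pM => //.
    - by rewrite !mulr_ge0 // expR_ge0.
    - exact: exprn_ge0.
    - by rewrite mulrAC ler_wpM2r // /A lerDr.
    - by apply: lerXn2r; rewrite ?nnegrE.
  apply: ler_wpM2r; last by apply: lerXn2r; rewrite ?nnegrE.
  by apply: addr_ge0; apply: mulr_ge0 => //; [exact: mulr_ge0|exact: exprn_ge0].
have Breg := moment_range_level h0'_gt0 M0 B0 d0 rng.
have eta0 : 0 <= C * ln x `^ (- c) by rewrite mulr_ge0 // powR_ge0.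
have lev' : level_sum alpha g x d m <= L0 * expR (- lam `^ (3^-1 + eps0)) * summatory alpha x.
  by apply: le_trans lev _; rewrite -/lam -mulrA [X in L0 * X]mulrC.
have [err err_le ->] := pointwise_moment g_nonconst g0 g_pos rho01 L00 f_add M0 fM al0 alM alpow x2 lx1
  (d01 x) m0 eta0 (fun y => Sreg x y xX0) lev' B0 Breg gap small1 small2.
exists err => //; apply: le_trans err_le _.
rewrite ler_wpM2r //; last by apply: le_trans (ler_norm _) _; rewrite lerDr.
by rewrite !mulr_ge0 ?powR_ge0 ?invr_ge0 ?mulr_ge0 ?sqrtr_ge0 // ltW.
Unshelve. all: by end_near. Qed.
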